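(* Let $X_{d-1}\subset X_d=X$ be an oriented $d$-manifold with defect, with its oriented directed space structure $dX$, and let $\mathcal C$ be a regular fiber-finite $\Gamma_2$-parcel with structure functor $\gamma$. Let $\mathcal T$ be any directed triangulation of $X$, let $v_\beta$ (resp. $v_\delta$) denote the number of vertices of $\mathcal T$ in the bulk (resp. defect), and let $\sigma_\beta$ (resp. $\sigma_\delta$) denote the number of strata in the bulk (resp. defect). Let $\mathcal N_{\mathcal C}(X,dX)$ be the number of functors from the fundamental parcel $\uparrow\!\pi_1(X,dX,\{x_i\})$ (for a choice of base points $x_i$, one in each stratum) to $\mathcal C$ whose composite with $\gamma$ is the structure functor of the fundamental parcel. Then $\mathcal N_{\mathcal C}(X,dX)$ is equal to the number of $\mathcal C$-colorings of $\mathcal T$ divided by \[(\#\gamma^{-1}(Id_\beta))^{v_\beta-\sigma_\beta}\cdot(\#\gamma^{-1}(Id_\delta))^{v_\delta-\sigma_\delta}.\]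
   Context: Composition is written in diagrammatic order: $fg$ means $f$ followed by $g$. $\mathbf I=[0,1]$. **Oriented $d$-manifold with defect.** This is a compact oriented $d$-manifold $X=X_d$ (without boundary) with a stratification $\emptyset=X_{d-2}\subset X_{d-1}\subset X_d$, where $X_{d-1}$ is a compact $(d-1)$-manifold. The strata are the connected components of $X_{d-1}$ (together forming the ''defect'') and of $X_d\setminus X_{d-1}$ (together forming the ''bulk''). The bulk strata carry the orientation of $X$ and each defect stratum carries a chosen orientation. Two strata are adjacent if one is contained in the closure of the other. The stratification is collared: each defect stratum $D$ has a connected open neighborhood $U_D$, meeting no stratum other than $D$ and bulk strata adjacent to $D$, and homeomorphic to $D\times(-1,1)$ with $D$ corresponding to $D\times\{0\}$. The side $D\times(-1,0)$ or $D\times(0,1)$ whose orientation induces on $D$ a boundary orientation agreeing with (resp. opposite to) that of $D$ is the positive (resp. negative) side. **Directed space structure $dX$.** Write $x\preceq_+y$ if $x,y$ lie in the same stratum, or for some $D$, $x$ lies in the positive side of $U_D$ and $y\in D$. Write $x\preceq_-y$ if $x,y$ lie in the same stratum, or for some $D$, $x\in D$ and $y$ lies in the negative side of $U_D$. Let $d_{\pm}X$ be the set of continuous $\phi:\mathbf I\to X$ for which there is $\epsilon>0$ such that $a\le b$ and $|a-b|<\epsilon$ imply $\phi(a)\preceq_\pm\phi(b)$. The set $dX$ of directed paths consists of all continuous $p:\mathbf I\to X$ such that for some $0=a_0\le\dots\le a_n=1$ each restriction $p|_{[a_{j-1},a_j]}$ (reparametrized by $\mathbf I$) is in $d_+X$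 or $d_-X$. **Fundamental category.** Objects of $\uparrow\!\Pi_1(X,dX)$ are points of $X$; arrows from $x$ to $y$ are classes of directed paths from $x$ to $y$ modulo weakly monotone reparametrization and modulo the equivalence relation generated by immediate $d$-homotopy; composition is concatenation. Here $p_0,p_1$ with the same endpoints are immediately $d$-homotopic if, up to reparametrization, there is a continuous $h:\mathbf I^2\to X$ with $h(-,0)=p_0$, $h(-,1)=p_1$, fixing the endpoints, and carrying every path in $\mathbf I^2$ that is weakly increasing in both coordinates to a directed path of $X$. **$\Gamma_2$-parcels.** $\Gamma_2$ is the directed graph with vertices $\delta,\beta$ and two edges, $\omega$ from $\delta$ to $\beta$ and $\iota$ from $\beta$ to $\delta$; $\mathcal P(\Gamma_2)$ is its path (free) category. A $\Gamma_2$-parcel is a category $\mathcal C$ with a conservative functor $\gamma:\mathcal C\to\mathcal P(\Gamma_2)$ surjective on arrows. It is fiber-finite if the preimage of every arrow is finite, and regular if $\gamma$ is injective on objects. An arrow $x$ of $\mathcal C$ lies above $\gamma(x)$. **Fundamental parcel.** Given base points $x_i$, one in each stratum, $\uparrow\!\pi_1(X,dX,\{x_i\})$ is the full subcategory of $\uparrow\!\Pi_1(X,dX)$ on the objects $x_i$. Its structure functor to $\mathcal P(\Gamma_2)$ sends base points of bulk strata to $\beta$ and those of defect strata to $\delta$; it sends classes of paths lying in a single bulk (resp. defect) stratum to $Id_\beta$ (resp. $Id_\delta$), and classes of directed paths passing from a bulk stratum to an adjacent defect stratum (resp. from a defect stratum to an adjacent bulk stratum), and meeting no other strata, to $\iota$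 (resp. $\omega$). In general the image of a directed path is determined by the sequence of strata it traverses. The number $\mathcal N_{\mathcal C}(X,dX)$ does not depend on the choice of base points. **Directed triangulations.** A triangulation $\mathcal T$ of $X$ is flag-like if the strata are given by subcomplexes (i.e. $X_{d-1}$ and the closures of the strata are subcomplexes) and every simplex meets $X_{d-1}$ in the empty set or in a face. A directed triangulation is a flag-like triangulation with edges oriented as follows: the vertices in each stratum are totally ordered and each edge lying entirely in one stratum is oriented from the earlier to the later vertex; each remaining edge (having exactly one vertex in $X_{d-1}$) is oriented so that, traversed in that direction, it is a directed path. **Colorings.** A $\mathcal C$-coloring of $\mathcal T$ assigns to each edge an arrow of $\mathcal C$ so that: edges in the bulk get arrows above $Id_\beta$; edges in the defect get arrows above $Id_\delta$; edges with initial vertex in the bulk and terminal vertex in the defect get arrows above $\iota$; edges with initial vertex in the defect and terminal vertex in the bulk get arrows above $\omega$; and for each 2-face the composite of the arrows on the two composable edges equals the arrow on the third edge. *)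

(* Defs.v *)
From HB Require Import structures.
From mathcomp Require Import all_boot all_order all_algebra generic_quotient.
From mathcomp Require Import all_classical all_reals all_analysis.
From mathcomp Require Import ring lra.
From Stdlib Require Import Relation_Operators.

Set Implicit Arguments.
Unset Strict Implicit.
Unset Printing Implicit Defensive.

Import Order.TTheory GRing.Theory Num.Theory.
Import numFieldNormedType.Exports.

Local Open Scope classical_set_scope.
Local Open Scope ring_scope.
Local Open Scope card_scope.

(* Number of elements of a finite set; 0 for an infinite one. *)
Definition ncard (T : Type) (A : set T) : nat := xget 0%N [set n | A #= `I_n].

(* Composition is diagrammatic: [mcomp f g] is f followed by g. *)
Record category := Category {
  ob :> Type;
  mor : ob -> ob -> Type;
  idm : forall a, mor a a;
  mcomp : forall a b c, mor a b -> mor b c -> mor a c;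
  mcomp1f : forall a b (f : mor a b), mcomp (idm a) f = f;
  mcompf1 : forall a b (f : mor a b), mcomp f (idm b) = f;
  mcompA : forall a b c e (f : mor a b) (g : mor b c) (h : mor c e),
    mcomp (mcomp f g) h = mcomp f (mcomp g h) }.

Arguments mcomp {c0 a b c} f g : rename.
Arguments mor {c0} a b : rename.
Arguments idm {c0} a : rename.

Record functor (C D : category) := Functor {
  fob :> C -> D;
  fmor : forall a b : C, mor a b -> mor (fob a) (fob b);
  fmor_id : forall a, fmor (idm a) = idm (fob a);
  fmor_comp : forall (a b c : C) (f : mor a b) (g : mor b c),
    fmor (mcomp f g) = mcomp (fmor f) (fmor g) }.

Record arrow (C : category) := Arrow { src : C; tgt : C; arr :> mor src tgt }.

Definition map_arrow (C D : category) (F : functor C D) (f : arrow C) : arrow D :=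
  Arrow (fmor F f).

Variant composes (C : category) : arrow C -> arrow C -> arrow C -> Prop :=
  Composes (a b c : C) (f : mor a b) (g : mor b c) :
    composes (Arrow f) (Arrow g) (Arrow (mcomp f g)).

Definition is_iso (C : category) (a b : C) (f : mor a b) : Prop :=
  exists g : mor b a, mcomp f g = idm a /\ mcomp g f = idm b.

Definition conservative (C D : category) (F : functor C D) : Prop :=
  forall (a b : C) (f : mor a b), is_iso (fmor F f) -> is_iso f.

Definition full_subcategory (C : category) (A : set C) : category :=
  @Category {x : C | A x} (fun x y => mor (sval x) (sval y))
    (fun x => idm (sval x)) (fun x y z f g => mcomp f g)
    (fun x y f => mcomp1f f) (fun x y f => mcompf1 f)
    (fun x y z t f g h => mcompA f g h).

Record digraph := Digraph { vertex : Type; edge : vertex -> vertex -> Type }.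

Inductive edge_word (G : digraph) : vertex G -> vertex G -> Type :=
| EmptyWord x : edge_word x x
| ConsWord x y z : edge x y -> edge_word y z -> edge_word x z.

Fixpoint word_cat (G : digraph) (x y z : vertex G) (p : edge_word x y) :
    edge_word y z -> edge_word x z :=
  match p in edge_word x y return edge_word y z -> edge_word x z with
  | EmptyWord _ => fun q => q
  | ConsWord _ _ _ e p' => fun q => ConsWord e (word_cat p' q)
  end.

Lemma word_cat0 (G : digraph) (x y : vertex G) (p : edge_word x y) :
  word_cat p (EmptyWord y) = p.
Proof. by elim: p => //= ? ? ? e p ->. Qed.

Lemma word_catA (G : digraph) (x y z t : vertex G) (p : edge_word x y)
    (q : edge_word y z) (r : edge_word z t) :
  word_cat (word_cat p q) r = word_cat p (word_cat q r).
Proof. by elim: p z t q r => //= ? ? ? e p IH ? ? q r; rewrite IH. Qed.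

Definition path_category (G : digraph) : category :=
  @Category (vertex G) (@edge_word G) (@EmptyWord G) (@word_cat G)
    (fun x y p => erefl) (@word_cat0 G) (@word_catA G).

Definition edge_arrow (G : digraph) (x y : vertex G) (e : edge x y) :
    arrow (path_category G) :=
  @Arrow (path_category G) x y (ConsWord e (EmptyWord y)).

Definition id_arrow (C : category) (a : C) : arrow C := Arrow (idm a).

Variant gamma2_vertex := delta | beta.

Variant gamma2_edge : gamma2_vertex -> gamma2_vertex -> Type :=
| omega_edge : gamma2_edge delta beta
| iota_edge : gamma2_edge beta delta.

Definition Gamma2 : digraph := Digraph gamma2_edge.

Definition Id_beta : arrow (path_category Gamma2) :=
  @id_arrow (path_category Gamma2) beta.
Definition Id_delta : arrow (path_category Gamma2) :=
  @id_arrow (path_category Gamma2) delta.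
Definition arrow_omega : arrow (path_category Gamma2) :=
  @edge_arrow Gamma2 _ _ omega_edge.
Definition arrow_iota : arrow (path_category Gamma2) :=
  @edge_arrow Gamma2 _ _ iota_edge.

Record parcel (G : digraph) := Parcel {
  parcel_category :> category;
  parcel_map : functor parcel_category (path_category G);
  parcel_conservative : conservative parcel_map;
  parcel_surjective : forall w, exists f, map_arrow parcel_map f = w }.

Arguments parcel_map {G} p.

Definition above (G : digraph) (C : parcel G) (w : arrow (path_category G)) :
    set (arrow C) :=
  [set f | map_arrow (parcel_map C) f = w].
Arguments above {G} C w.

Definition fiber_finite (G : digraph) (C : parcel G) : Prop :=
  forall w, finite_set (above C w).

Definition regular_parcel (G : digraph) (C : parcel G) : Prop :=
  injective (fob (parcel_map C)).

Definition homeo_on (T U : topologicalType) (A : set T) (B : set U) (f : T -> U) : Prop :=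
  exists g : U -> T,
    [/\ {within A, continuous f}, {within B, continuous g},
        (forall x, A x -> B (f x) /\ g (f x) = x) &
        (forall y, B y -> A (g y) /\ f (g y) = y)].

Section Manifolds.
Variable R : realType.
Local Notation I := (`[(0 : R), 1]%classic).

(* A chart of the subspace M of T: a homeomorphism from R^n onto an open subset of M. *)
Definition chart (T : topologicalType) (M : set T) (n : nat) (phi : 'rV[R]_n -> T) : Prop :=
  exists V : set T, open V /\ homeo_on [set: 'rV[R]_n] (V `&` M) phi.

Definition is_manifold (T : topologicalType) (M : set T) (n : nat) : Prop :=
  forall x, M x -> exists phi : 'rV[R]_n -> T, chart M phi /\ range phi x.

(* When phi x = psi y, the transition map psi^-1 phi has local degree 1 at x, that is
   (by Hopf's theorem): its restriction to a small sphere around x, translated so as to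
   map into R^n \ 0, is homotopic there to the inclusion.  The norm is the sup norm. *)
Definition orientation_preserving (T : topologicalType) (n : nat)
    (phi psi : 'rV[R]_n -> T) (x y : 'rV[R]_n) : Prop :=
  exists (r : R) (g : 'rV[R]_n -> 'rV[R]_n) (H : R * 'rV[R]_n -> 'rV[R]_n),
    [/\ 0 < r,
        (forall v, `|v| <= r -> psi (y + g v) = phi (x + v)),
        {within I `*` [set v | `|v| = r], continuous H},
        (forall v, `|v| = r -> H (0, v) = g v /\ H (1, v) = v) &
        (forall t v, I t -> `|v| = r -> H (t, v) != 0)].

(* An orientation assigns a sign to every chart, overlapping charts getting equal signs
   exactly when the transition map preserves orientation.  For n = 0 every transition map
   does, and an orientation is an arbitrary choice of sign at each point. *)
Record orientation (T : topologicalType) (M : set T) (n : nat) := Orientation {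
  chart_sign :> ('rV[R]_n -> T) -> bool;
  chart_signP : forall (phi psi : 'rV[R]_n -> T) x y,
    chart M phi -> chart M psi -> phi x = psi y ->
    (chart_sign phi = chart_sign psi <-> orientation_preserving phi psi x y) }.

(* The stratum of x for the stratification D of T. *)
Definition stratum_of (T : topologicalType) (D : set T) (x : T) : set T :=
  connected_component (if `[< D x >] then D else ~` D) x.

Definition adjacent_strata (T : topologicalType) (S S' : set T) : Prop :=
  S `<=` closure S' \/ S' `<=` closure S.

Definition row_coord (n : nat) (v : 'rV[R]_n) (k : nat) : R :=
  if insub k is Some i then v ord0 i else 0.

(* For a chart psi of the defect and a collar c, the chart
   (v_0, ..., v_(d-1)) |-> c (psi (v_1, ..., v_(d-1)), v_0 / (1 + |v_0|)). *)
Definition collar_chart (T : topologicalType) (c : T * R -> T) (d : nat)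
    (psi : 'rV[R]_d.-1 -> T) (v : 'rV[R]_d) : T :=
  c (psi (\row_(j < d.-1) row_coord v j.+1), row_coord v 0%N / (1 + `|row_coord v 0%N|)).

(* The collars of all defect strata D are gathered in one function, whose restriction to
   D * ]-1, 1[ is the homeomorphism onto U_D.  They are normalized (by t |-> -t where
   needed) so that D * ]-1, 0[ is the positive side: by the convention "outward normal
   first", it induces on D the boundary orientation for which (d/dt, e_1, ..., e_(d-1)) is
   positive when (e_1, ..., e_(d-1)) is, and [collar_oriented] says that this is the
   orientation of D.  For d = 0 the collar condition forces the defect to be empty. *)
Record manifold_with_defect (d : nat) := ManifoldWithDefect {
  carrier :> topologicalType;
  defect : set carrier;
  ambient_orientation : orientation [set: carrier] d;
  defect_orientation : orientation defect d.-1;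
  collar : carrier * R -> carrier;
  carrier_compact : compact [set: carrier];
  carrier_hausdorff : hausdorff_space carrier;
  carrier_manifold : is_manifold [set: carrier] d;
  defect_compact : compact defect;
  defect_manifold : is_manifold defect d.-1;
  collar0 : forall x, defect x -> collar (x, 0) = x;
  collarP : forall x, defect x ->
    let D := stratum_of defect x in
    let U := collar @` (D `*` `](-1 : R), 1[%classic) in
    [/\ homeo_on (D `*` `](-1 : R), 1[%classic) U collar, open U, connected U &
        forall y, U y ->
          D y \/ ~ defect y /\ adjacent_strata (stratum_of defect y) D];
  collar_oriented : forall psi : 'rV[R]_d.-1 -> carrier, chart defect psi ->
    ambient_orientation (collar_chart collar psi) = defect_orientation psi }.

End Manifolds.

Arguments defect {R d} m.
Arguments collar {R d} m.

Section Directed.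
Variables (R : realType) (d : nat) (X : manifold_with_defect R d).
Local Notation I := (`[(0 : R), 1]%classic).

Definition stratum (x : X) : set X := stratum_of (defect X) x.

Definition bulk_strata : set (set X) := [set stratum x | x in ~` defect X].
Definition defect_strata : set (set X) := [set stratum x | x in defect X].

Definition positive_side (D : set X) : set X := collar X @` (D `*` `](-1 : R), 0[%classic).
Definition negative_side (D : set X) : set X := collar X @` (D `*` `](0 : R), 1[%classic).

Definition prec_plus (x y : X) : Prop :=
  stratum x y \/ exists2 D, defect_strata D & positive_side D x /\ D y.

Definition prec_minus (x y : X) : Prop :=
  stratum x y \/ exists2 D, defect_strata D & D x /\ negative_side D y.

(* Paths are functions on R of which only the restriction to [0, 1] matters. *)
Definition locally_increasing (prec : X -> X -> Prop) : set (R -> X) :=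
  [set phi | {within I, continuous phi} /\
    exists2 e : R, 0 < e & forall a b, I a -> I b -> a <= b -> `|a - b| < e ->
      prec (phi a) (phi b)].

Definition d_plus : set (R -> X) := locally_increasing prec_plus.
Definition d_minus : set (R -> X) := locally_increasing prec_minus.

Definition path_restriction (p : R -> X) (a b : R) : R -> X := fun t => p (a + t * (b - a)).

Definition directed_path (p : R -> X) : Prop :=
  {within I, continuous p} /\
  exists (n : nat) (a : nat -> R),
    [/\ a 0%N = 0, a n = 1,
        (forall j, (j < n)%N -> a j <= a j.+1) &
        (forall j, (j < n)%N ->
           let q := path_restriction p (a j) (a j.+1) in d_plus q \/ d_minus q)].

Record dpath (x y : X) := DPath {
  dpath_fun :> R -> X;
  dpath_directed : directed_path dpath_fun;
  dpath0 : dpath_fun 0 = x;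
  dpath1 : dpath_fun 1 = y }.

Definition weakly_increasing (s : R -> R) : Prop :=
  [/\ {within I, continuous s}, (forall t, I t -> I (s t)) &
      forall t u, I t -> I u -> t <= u -> s t <= s u].

Definition reparametrization (x y : X) (p q : dpath x y) : Prop :=
  exists s, [/\ weakly_increasing s, s 0 = 0, s 1 = 1 & forall t, I t -> q t = p (s t)].

Definition immediately_dhomotopic (x y : X) (p0 p1 : dpath x y) : Prop :=
  exists h : R * R -> X,
    [/\ {within I `*` I, continuous h},
        (forall t, I t -> h (t, 0) = p0 t /\ h (t, 1) = p1 t),
        (forall s, I s -> h (0, s) = x /\ h (1, s) = y) &
        (forall a b, weakly_increasing a -> weakly_increasing b ->
           directed_path (fun t => h (a t, b t)))].

Definition dequiv (x y : X) : dpath x y -> dpath x y -> Prop :=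
  clos_refl_sym_trans (dpath x y)
    (fun p q => reparametrization p q \/ immediately_dhomotopic p q).

Definition path_concat (p q : R -> X) : R -> X :=
  fun t => if t <= 2^-1 then p (2 * t) else q (2 * t - 1).

End Directed.

Arguments bulk_strata {R d} X.
Arguments defect_strata {R d} X.

Section DirectedTheory.
Variables (R : realType) (d : nat) (X : manifold_with_defect R d).
Local Notation I := (`[(0 : R), 1]%classic).
Implicit Types (p q f g : R -> X) (s a b : R -> R).

Let IE (t : R) : I t <-> 0 <= t <= 1.
Proof. by rewrite /= in_itv. Qed.

Lemma within_comp (T U V : topologicalType) (A : set T) (B : set U)
    (f : T -> U) (g : U -> V) :
  {within A, continuous f} -> {within B, continuous g} ->
  (forall x, A x -> B (f x)) -> {within A, continuous (g \o f)}.
Proof.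
move=> /subspace_continuousP cf /subspace_continuousP cg AB.
apply/subspace_continuousP => x Ax W /(cg _ (AB _ Ax)) /(cf _ Ax) /=.
rewrite /nbhs/= /within/=; apply: filterS => y h Ay.
exact: h (AB _ Ay).
Qed.

Lemma within_sub (T U : topologicalType) (A B : set T) (f : T -> U) :
  A `<=` B -> {within B, continuous f} -> {within A, continuous f}.
Proof. exact: continuous_subspaceW. Qed.

Lemma within_pair (T U V : topologicalType) (A : set T) (f : T -> U) (g : T -> V) :
  {within A, continuous f} -> {within A, continuous g} ->
  {within A, continuous (fun x => (f x, g x))}.
Proof.
move=> cf cg x; exact: (cvg_pair (cf x) (cg x)).
Qed.

Lemma weakly_increasing_continuous s : continuous s -> (forall t, I t -> I (s t)) ->
  (forall t u, I t -> I u -> t <= u -> s t <= s u) -> weakly_increasing s.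
Proof. by move=> cs; split=> //; apply: continuous_subspaceT. Qed.

Lemma weakly_increasing_id : weakly_increasing (id : R -> R).
Proof. by apply: weakly_increasing_continuous => // x; exact: cvg_id. Qed.

Lemma weakly_increasing_comp a b : weakly_increasing a -> weakly_increasing b -> weakly_increasing (a \o b).
Proof.
move=> [ca Ia ma] [cb Ib mb]; split; first exact: within_comp cb ca Ib.
- by move=> t It; exact/Ia/Ib.
- by move=> t u It Iu tu; apply: ma; [exact: Ib|exact: Ib|exact: mb].
Qed.

Lemma monotone_unif s : weakly_increasing s -> forall e, 0 < e ->
  exists2 r, 0 < r & forall t u, I t -> I u -> `|t - u| < r -> `|s t - s u| < e.
Proof.
move=> [/subspace_continuousP cs _ _] e e0.
pose P (r x : R) := forall t, I t -> `|t - x| < r -> I x -> `|s t - s x| < e.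
have near_c : \forall r \near (0 : R)^'+, I `<=` P r.
  have /compact_near_coveringP := @segment_compact R 0 1.
  apply => x Ix.
  have : \forall y \near x, I y -> `|s x - s y| < e / 2.
    have := cs x Ix; move/cvgrPdist_lt/(_ (e / 2)).
    by rewrite divr_gt0// => /(_ isT); rewrite near_withinE.
  move=> /nbhs_ballP[r /= r0 rP].
  exists (ball x (r / 2), [set z : R | z < r / 2]).
    split => /=; first by apply: nbhsx_ballx; rewrite divr_gt0.
    by apply: nbhs_right_lt; rewrite divr_gt0.
  move=> [y z] /= [xy zr] t It tyz Iy.
  have h1 : `|s x - s y| < e / 2.
    by apply: rP => //; apply: le_ball xy; lra.
  have h2 : `|s x - s t| < e / 2.
    apply: rP => //; rewrite /ball/= in xy *.
    have -> : x - t = (x - y) - (t - y) by ring.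
    by rewrite (le_lt_trans (ler_normB _ _))//; lra.
  have -> : s t - s y = (s x - s y) - (s x - s t) by ring.
  by rewrite (le_lt_trans (ler_normB _ _))//; lra.
have /filter_ex[r [r0 rP]] : \forall r \near (0 : R)^'+, 0 < r /\ I `<=` P r.
  by near=> r; split; near: r; [exact: nbhs_right_gt|exact: near_c].
by exists r => // t u It Iu tu; exact: rP.
Unshelve. all: by end_near. Qed.

Lemma stratum_refl (x : X) : stratum x x.
Proof.
by apply: connected_component_refl; case: ifPn => [/asboolP|/asboolPn].
Qed.

Lemma locally_increasing_comp prec phi s : weakly_increasing s ->
  locally_increasing prec phi -> locally_increasing prec (phi \o s : R -> X).
Proof.
move=> ms [cphi [e e0 eP]]; have [cs Is hs] := ms.
split; first exact: within_comp cs cphi Is.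
have [r r0 rP] := monotone_unif ms e0.
exists r => // t u It Iu tu tur; apply: eP; [exact: Is|exact: Is|exact: hs|exact: rP].
Qed.

Lemma locally_increasing_ext prec f g : (forall t, I t -> f t = g t) ->
  locally_increasing prec f -> locally_increasing prec g.
Proof.
move=> fg [cf [e e0 eP]]; split.
  by apply: subspace_eq_continuous cf => t /set_mem; exact: fg.
by exists e => // a b Ia Ib; rewrite -!fg //; exact: eP.
Qed.

Definition piece p (u v : R) :=
  let q := path_restriction p u v in d_plus q \/ d_minus q.

Lemma piece_mono p (u v t w : R) s : u <= v -> t <= w ->
  {within `[t, w], continuous s} ->
  (forall x, t <= x <= w -> u <= s x <= v) ->
  (forall x y, t <= x -> x <= y -> y <= w -> s x <= s y) ->
  piece p u v -> piece (p \o s) t w.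
Proof.
move=> uv tw cs sI ms pc.
have reI : forall x, I x -> t <= t + x * (w - t) <= w.
  move=> x /IE/andP[x0 x1]; apply/andP; split; nra.
have [e|ne] := eqVneq u v.
  left; split.
    have sc : forall x, I x -> p u = path_restriction (p \o s) t w x.
      move=> x Ix; rewrite /path_restriction /=; congr (p _).
      by have := sI _ (reI _ Ix); rewrite -e => ?; lra.
    apply: (@subspace_eq_continuous _ _ _ (fun=> p u)).
      by move=> x /set_mem; exact: sc.
    by apply: continuous_subspaceT; exact: cst_continuous.
  exists 1 => // x y Ix Iy _ _; left; rewrite /path_restriction /=.
  have -> : s (t + x * (w - t)) = s (t + y * (w - t)).
    by have := sI _ (reI _ Ix); have := sI _ (reI _ Iy); rewrite -e => ? ?; lra.
  exact: stratum_refl.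
have uv' : u < v by rewrite lt_neqAle ne.
pose k x := (s (t + x * (w - t)) - u) / (v - u).
have mk : weakly_increasing k.
  split.
  - have c1 : {within I, continuous (fun x : R => s (t + x * (w - t)))}.
      apply: (@within_comp _ _ _ _ `[t, w] (fun x : R => t + x * (w - t)) s) => //.
        apply: continuous_subspaceT => x; apply: cvgD; first exact: cvg_cst.
        by apply: cvgM; [exact: cvg_id|exact: cvg_cst].
    move=> x; apply: cvgM; last exact: cvg_cst.
    by apply: cvgB; [exact: c1|exact: cvg_cst].
  - move=> x Ix; have /andP[h1 h2] := sI _ (reI _ Ix); apply/IE; rewrite /k.
    by rewrite divr_ge0 ?ler_pdivrMr ?mul1r; lra.
  - move=> x y Ix Iy xy; rewrite /k ler_pM2r ?invr_gt0; last lra.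
    rewrite lerB //; apply: ms; have := reI _ Ix; have := reI _ Iy; move=> ? ?; nra.
have ext : forall x, I x -> (path_restriction p u v \o k) x = path_restriction (p \o s) t w x.
  move=> x Ix; rewrite /path_restriction /k /=; congr (p _); field; lra.
by case: pc => pc; [left|right];
  apply: (locally_increasing_ext ext); apply: locally_increasing_comp.
Qed.

Lemma piece_ext f g (u v : R) : u <= v -> (forall x, u <= x <= v -> f x = g x) ->
  piece f u v -> piece g u v.
Proof.
move=> uv fg; have h x : I x -> path_restriction f u v x = path_restriction g u v x.
  by move=> /IE /andP[? ?]; apply: fg; apply/andP; split; nra.
by case=> H; [left|right]; apply: locally_increasing_ext H.
Qed.

Inductive dir_on p : R -> R -> Prop :=
| dir_on_nil u : dir_on p u u
| dir_on_step u v w : u <= v -> piece p u v -> dir_on p v w -> dir_on p u w.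

Lemma dir_on_le p u v : dir_on p u v -> u <= v.
Proof. by elim=> // {}u {}v w uv _ _; exact: le_trans. Qed.

Lemma dir_on_cat p u v w : dir_on p u v -> dir_on p v w -> dir_on p u w.
Proof.
by move=> H; elim: H w => // u' v' w' uv pc _ IH w /IH; exact: dir_on_step.
Qed.

Lemma directedE p : directed_path p <-> {within I, continuous p} /\ dir_on p 0 1.
Proof.
split=> -[cp].
  move=> [n [a [a0 an al ap]]]; split => //; rewrite -a0 -an.
  elim: n {a0 an} al ap => [|n IH] al ap; first exact: dir_on_nil.
  apply: (@dir_on_cat _ _ (a n)).
    by apply: IH => j jn; [apply: al|apply: ap]; exact: ltnW.
  by apply: (dir_on_step (al n _) (ap n _)) => //; exact: dir_on_nil.
move=> H; split => //.
suff : exists (n : nat) (a : nat -> R), [/\ a 0%N = 0, a n = 1,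
    (forall j, (j < n)%N -> a j <= a j.+1) &
    (forall j, (j < n)%N -> piece p (a j) (a j.+1))] by [].
elim: H => [u|u v w uv pc _ [n [a [a0 an al ap]]]].
  by exists 0%N, (fun=> u).
exists n.+1, (fun j => if j is j'.+1 then a j' else u); split=> // -[|j]//= jn.
- by rewrite a0.
- exact: al.
- by rewrite a0.
- exact: ap.
Qed.

Lemma dir_on_ext f g u v : (forall x, u <= x <= v -> f x = g x) ->
  dir_on f u v -> dir_on g u v.
Proof.
move=> + H; elim: H => [{}u|{}u {}v w uv pc vw IH] fg; first exact: dir_on_nil.
have vw' := dir_on_le vw.
apply: (@dir_on_step _ _ v) => //.
  by apply: piece_ext pc => // x xuv; apply: fg; lra.
by apply: IH => x xvw; apply: fg; lra.
Qed.

Lemma dir_on_mono p u v s t w : dir_on p u v -> t <= w ->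
  {within `[t, w], continuous s} ->
  (forall x y, t <= x -> x <= y -> y <= w -> s x <= s y) ->
  u <= s t -> s w <= v -> dir_on (p \o s) t w.
Proof.
move=> H; elim: H s t w => [{}u|{}u {}v z uv pc vw IH] s t w tw cs ms ut wv.
  apply: (@dir_on_step _ _ w) => //; last exact: dir_on_nil.
  have mid x : t <= x <= w -> s x = u.
    move=> xtw; have := ms t x; have := ms x w.
    by move=> /(_ _ _ _)/[swap] ?; lra.
  have mid' : forall x, I x -> p u = path_restriction (p \o s) t w x.
    move=> x /IE/andP[? ?]; rewrite /path_restriction /= mid //.
    by apply/andP; split; nra.
  left; split.
    apply: (@subspace_eq_continuous _ _ _ (fun=> p u)).
      by move=> x /set_mem; exact: mid'.
    by apply: continuous_subspaceT; exact: cst_continuous.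
  exists 1 => // x y Ix Iy _ _; left; rewrite -(mid' _ Ix) -(mid' _ Iy).
  exact: stratum_refl.
have [swv|vsw] := leP (s w) v.
  apply: (@dir_on_step _ _ w) => //; last exact: dir_on_nil.
  apply: (piece_mono uv tw cs _ ms pc) => x xtw.
  have := ms t x; have := ms x w; move=> h1 h2.
  by apply/andP; split; [apply: le_trans ut _; apply: h2|apply: le_trans swv; apply: h1]; lra.
have [vst|stv] := leP v (s t); first exact: IH.
have [c] : exists2 c, c \in `[t, w] & s c = v.
  apply: IVT => //.
  by rewrite ge_min le_max (ltW stv) (ltW vsw) orbT.
rewrite in_itv/= => /andP[tc cw] sc.
apply: (@dir_on_step _ _ c) => //.
  apply: (piece_mono uv tc _ _ _ pc).
  - by apply: within_sub cs => x /=; rewrite !in_itv/=; lra.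
  - move=> x xtc; have := ms t x; have := ms x c; move=> h1 h2.
    apply/andP; split; first by apply: le_trans ut _; apply: h2; lra.
    by rewrite -sc; apply: h1; lra.
  - by move=> x y tx xy yc; apply: ms => //; lra.
apply: IH => //.
- by apply: within_sub cs => x /=; rewrite !in_itv/=; lra.
- by move=> x y tx xy yc; apply: ms => //; lra.
- by rewrite sc.
Qed.

Lemma directed_path_comp p s : directed_path p -> weakly_increasing s -> directed_path (p \o s).
Proof.
move=> /directedE[cp dp] [cs Is ms]; apply/directedE; split.
  exact: within_comp cs cp Is.
have I0 : I 0 by apply/IE; lra.
have I1 : I 1 by apply/IE; lra.
have /IE h0 := Is 0 I0; have /IE h1 := Is 1 I1.
apply: (dir_on_mono dp) => //; try lra.
by move=> x y x0 xy y1; apply: ms => //; apply/IE; lra.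
Qed.

Lemma dir_on_sub p u v : directed_path p -> 0 <= u -> u <= v -> v <= 1 -> dir_on p u v.
Proof.
move=> /directedE[_ dp] u0 uv v1.
apply: (@dir_on_mono p 0 1 id u v) => //.
by apply: continuous_subspaceT => x; exact: cvg_id.
Qed.

Lemma directed_path_ext f g : (forall t, I t -> f t = g t) -> directed_path f -> directed_path g.
Proof.
move=> fg /directedE[cf df]; apply/directedE; split.
  by apply: subspace_eq_continuous cf => t /set_mem; exact: fg.
by apply: dir_on_ext df => x x01; apply: fg; apply/IE.
Qed.

Lemma within_paste f (c : R) : 0 <= c <= 1 ->
  {within `[0, c], continuous f} -> {within `[c, 1], continuous f} ->
  {within I, continuous f}.
Proof.
move=> c01 c1 c2; apply: (@within_sub _ _ _ (`[0, c] `|` `[c, 1])).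
  move=> t /IE/andP[t0 t1]; have [tc|ct] := leP t c; [left|right];
  by rewrite /= in_itv/=; lra.
by apply: withinU_continuous => //; exact: interval_closed.
Qed.

Lemma directed_path_paste f g h (c : R) : 0 <= c <= 1 -> directed_path g -> directed_path h ->
  (forall t, 0 <= t <= c -> f t = g t) -> (forall t, c <= t <= 1 -> f t = h t) ->
  directed_path f.
Proof.
move=> c01 dg dh fg fh; apply/directedE; split.
  apply: (within_paste c01).
  - apply: (@subspace_eq_continuous _ _ _ g).
      by move=> t /set_mem /=; rewrite in_itv/= => /fg.
    apply: within_sub (proj1 dg).
    by move=> t /=; rewrite !in_itv/=; lra.
  - apply: (@subspace_eq_continuous _ _ _ h).
      by move=> t /set_mem /=; rewrite in_itv/= => /fh.
    apply: within_sub (proj1 dh).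
    by move=> t /=; rewrite !in_itv/=; lra.
apply: (@dir_on_cat _ _ c).
  apply: (@dir_on_ext g); first by move=> t /fg.
  by apply: dir_on_sub => //; lra.
apply: (@dir_on_ext h); first by move=> t /fh.
by apply: dir_on_sub => //; lra.
Qed.

End DirectedTheory.

Section FundamentalCategory.
Variables (R : realType) (d : nat) (X : manifold_with_defect R d).
Local Notation I := (`[(0 : R), 1]%classic).
Implicit Types (x y z : X) (p q : R -> X) (s a b : R -> R).

Let IE (t : R) : I t <-> 0 <= t <= 1.
Proof. by rewrite /= in_itv. Qed.

Let first_half (t : R) : R := Num.min (2 * t) 1.
Let second_half (t : R) : R := Num.max (2 * t - 1) 0.

Lemma continuous_affine (k l : R) : continuous (fun t : R => k * t + l).
Proof.
move=> t; apply: cvgD; last exact: cvg_cst.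
by apply: cvgM; [exact: cvg_cst|exact: cvg_id].
Qed.

Lemma continuous_double : continuous (fun t : R => 2 * t).
Proof.
by move=> t; apply: cvgM; [exact: cvg_cst|exact: cvg_id].
Qed.

Lemma continuous_double1 : continuous (fun t : R => 2 * t - 1).
Proof. exact: continuous_affine. Qed.

Lemma continuous_maxr (f g : R -> R) : continuous f -> continuous g ->
  continuous (fun t => Num.max (f t) (g t)).
Proof. by move=> cf cg t; exact: (@continuous_max R R f g t (cf t) (cg t)). Qed.

Lemma continuous_minr (f g : R -> R) : continuous f -> continuous g ->
  continuous (fun t => Num.min (f t) (g t)).
Proof. by move=> cf cg t; exact: (@continuous_min R R f g t (cf t) (cg t)). Qed.

Lemma first_half_incr : weakly_increasing first_half.
Proof.
apply: weakly_increasing_continuous.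
- by apply: continuous_minr; [exact: continuous_double|exact: cst_continuous].
- move=> t /IE/andP[? ?]; apply/IE; rewrite /first_half.
  by case: (leP (2 * t) 1) => ?; apply/andP; split; lra.
- move=> t u _ _ tu; rewrite /first_half.
  by case: (leP (2 * t) 1); case: (leP (2 * u) 1) => ? ?; lra.
Qed.

Lemma second_half_incr : weakly_increasing second_half.
Proof.
apply: weakly_increasing_continuous.
- by apply: continuous_maxr; [exact: continuous_double1|exact: cst_continuous].
- move=> t /IE/andP[? ?]; apply/IE; rewrite /second_half.
  by case: (leP (2 * t - 1) 0) => ?; apply/andP; split; lra.
- move=> t u _ _ tu; rewrite /second_half.
  by case: (leP (2 * t - 1) 0); case: (leP (2 * u - 1) 0) => ? ?; lra.
Qed.

Lemma path_concat_first p q (t : R) : t <= 2^-1 ->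
  path_concat p q t = p (first_half t).
Proof. by move=> h; rewrite /path_concat /first_half h; congr p; case: (leP (2 * t) 1); lra. Qed.

Lemma path_concat_second p q (t : R) : p 1 = q 0 -> 2^-1 <= t ->
  path_concat p q t = q (second_half t).
Proof.
move=> pq h; rewrite /path_concat /second_half.
have [t2|t2] := leP t 2^-1.
  have -> : t = 2^-1 by lra.
  have -> : 2 * 2^-1 = 1 :> R by field.
  by rewrite subrr maxxx.
by congr q; case: (leP (2 * t - 1) 0); lra.
Qed.

Lemma directed_concat p q : directed_path p -> directed_path q -> p 1 = q 0 ->
  directed_path (path_concat p q).
Proof.
move=> dp dq pq.
apply: (@directed_path_paste _ _ _ _ (p \o first_half) (q \o second_half) 2^-1).
- by lra.
- exact: directed_path_comp dp first_half_incr.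
- exact: directed_path_comp dq second_half_incr.
- by move=> t /andP[_]; exact: path_concat_first.
- by move=> t /andP[h _]; exact: path_concat_second.
Qed.

Lemma directed_cst x : directed_path (fun=> x : X).
Proof.
split; first by apply: continuous_subspaceT; exact: cst_continuous.
exists 1%N, (fun j => j%:R); split => //; first by move=> j _; rewrite ler_nat.
move=> j _ /=; left; split.
  by apply: continuous_subspaceT; exact: cst_continuous.
by exists 1 => // ? ? _ _ _ _; left; exact: stratum_refl.
Qed.

Definition dpath_id x : dpath x x := @DPath _ _ X x x (fun=> x) (directed_cst x) erefl erefl.

Fact dpath_concat_subproof x y z (p : dpath x y) (q : dpath y z) : p 1 = q 0.
Proof. by rewrite dpath1 dpath0. Qed.

Fact dpath_concat0 x y z (p : dpath x y) (q : dpath y z) : path_concat p q 0 = x.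
Proof. by rewrite /path_concat invr_ge0 ler0n mulr0 dpath0. Qed.

Fact dpath_concat1 x y z (p : dpath x y) (q : dpath y z) : path_concat p q 1 = z.
Proof.
rewrite /path_concat; have -> : (1 <= 2^-1 :> R) = false by apply/negbTE; lra.
by have -> : 2 * 1 - 1 = 1 :> R; [ring|rewrite dpath1].
Qed.

Definition dpath_concat x y z (p : dpath x y) (q : dpath y z) : dpath x z :=
  DPath (directed_concat (dpath_directed p) (dpath_directed q)
                         (dpath_concat_subproof p q))
        (dpath_concat0 p q) (dpath_concat1 p q).

Lemma dequiv_reparam x y (p q : dpath x y) s : weakly_increasing s -> s 0 = 0 -> s 1 = 1 ->
  (forall t, I t -> q t = p (s t)) -> dequiv p q.
Proof. by move=> *; apply: rst_step; left; exists s. Qed.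

Lemma dequiv_ext x y (p q : dpath x y) : (forall t, I t -> q t = p t) -> dequiv p q.
Proof. by move=> pq; apply: (@dequiv_reparam _ _ _ _ id) => //; exact: weakly_increasing_id. Qed.

Lemma concat_incr a b : weakly_increasing a -> weakly_increasing b ->
  weakly_increasing (fun t => (a (first_half t) + b (second_half t)) / 2).
Proof.
move=> ma mb.
have [ca Ia ha] := weakly_increasing_comp ma first_half_incr.
have [cb Ib hb] := weakly_increasing_comp mb second_half_incr.
split.
- move=> t; apply: cvgM; last exact: cvg_cst.
  by apply: cvgD; [exact: ca|exact: cb].
- move=> t It; have /IE/= ? := Ia t It; have /IE/= ? := Ib t It.
  by apply/IE/andP; split; lra.
- move=> t u It Iu tu; have /= ? := ha t u It Iu tu; have /= ? := hb t u It Iu tu.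
  by rewrite ler_pM2r ?invr_gt0//; lra.
Qed.

Lemma reparam_concat x y z (p p' : dpath x y) (q q' : dpath y z) :
  reparametrization p p' -> reparametrization q q' ->
  reparametrization (dpath_concat p q) (dpath_concat p' q').
Proof.
move=> [a [ma a0 a1 pa]] [b [mb b0 b1 qb]].
have [_ Ia _] := ma; have [_ Ib _] := mb.
have [_ If _] := first_half_incr; have [_ Is _] := second_half_incr.
have f0 : first_half 0 = 0 by rewrite /first_half mulr0; case: (leP 0 1) => ?; lra.
have f1 : first_half 1 = 1 by rewrite /first_half mulr1; case: (leP 2 1) => ?; lra.
have s0 : second_half 0 = 0 by rewrite /second_half mulr0; case: (leP (0 - 1) 0) => ?; lra.
have s1 : second_half 1 = 1 by rewrite /second_half mulr1; case: (leP (2 - 1) 0) => ?; lra.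
exists (fun t => (a (first_half t) + b (second_half t)) / 2); split.
- exact: concat_incr.
- by rewrite f0 s0 a0 b0; ring.
- by rewrite f1 s1 a1 b1; field.
move=> t It /=; have /IE/andP[t0 t1] := It.
have [h|h] := leP t 2^-1.
  rewrite path_concat_first // pa; last exact: If.
  have -> : second_half t = 0 by rewrite /second_half; case: (leP (2 * t - 1) 0); lra.
  have /IE/andP[? ?] := Ia _ (If _ It).
  rewrite b0 /path_concat ifT; last by lra.
  by congr (p _); field.
rewrite path_concat_second; [|exact: dpath_concat_subproof|exact: ltW].
rewrite qb; last exact: Is.
have -> : first_half t = 1 by rewrite /first_half; case: (leP (2 * t) 1); lra.
have /IE/andP[] := Ib _ (Is _ It); move: (b _) => w ? ?.
rewrite a1 path_concat_second; [|exact: dpath_concat_subproof|lra].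
by congr (q _); rewrite /second_half; case: leP; lra.
Qed.

Lemma reparam_refl x y (p : dpath x y) : reparametrization p p.
Proof. by exists id; split => //; exact: weakly_increasing_id. Qed.

Lemma split_half s : weakly_increasing s ->
  [\/ forall t, I t -> 2^-1 <= s t, forall t, I t -> s t <= 2^-1 |
      exists2 c : R, 0 <= c <= 1 &
        (forall t, 0 <= t <= c -> s t <= 2^-1) /\
        (forall t, c <= t <= 1 -> 2^-1 <= s t)].
Proof.
move=> [cs Is ms].
have I0 : I 0 by apply/IE; lra.
have I1 : I 1 by apply/IE; lra.
have [h0|h0] := leP (2^-1) (s 0).
  constructor 1 => t It; apply: (le_trans h0); apply: ms => //.
  by have /IE := It; lra.
have [h1|h1] := leP (s 1) (2^-1).
  constructor 2 => t It; apply: le_trans h1; apply: ms => //.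
  by have /IE := It; lra.
have [c] : exists2 c, c \in `[0, 1] & s c = 2^-1.
  by apply: IVT => //; rewrite ge_min le_max (ltW h0) (ltW h1) orbT.
rewrite in_itv/= => c01 sc; constructor 3; exists c => //; split => t ht; rewrite -sc.
  by apply: ms; [apply/IE|apply/IE|]; lra.
by apply: ms; [apply/IE|apply/IE|]; lra.
Qed.

Lemma dhomotopic_concatl x y z (p0 p1 : dpath x y) (q : dpath y z) :
  immediately_dhomotopic p0 p1 ->
  immediately_dhomotopic (dpath_concat p0 q) (dpath_concat p1 q).
Proof.
move=> [h [ch hp hxy hd]].
have [cf If mf] := first_half_incr; have [cs Is ms] := second_half_incr.
pose H (w : R * R) : X :=
  if w.1 <= 2^-1 then h (first_half w.1, w.2) else q (second_half w.1).
have H2 w : (I `*` I) w -> 2^-1 <= w.1 -> H w = q (second_half w.1).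
  move=> [_ Iw] hw; rewrite /H; case: leP => // hw'.
  have -> : w.1 = 2^-1 by lra.
  rewrite /first_half /second_half.
  have -> : 2 * 2^-1 = 1 :> R by field.
  rewrite minxx subrr maxxx dpath0.
  by have [_ ->] := hxy _ Iw.
have H1 w : w.1 <= 2^-1 -> H w = h (first_half w.1, w.2) by rewrite /H => ->.
have cfst : continuous (fst : R * R -> R) by move=> w; exact: cvg_fst.
have csnd : continuous (snd : R * R -> R) by move=> w; exact: cvg_snd.
exists H; split.
- pose A := [set w : R * R | w.1 <= 2^-1] `&` (I `*` I).
  pose B := [set w : R * R | 2^-1 <= w.1] `&` (I `*` I).
  apply: (@within_sub _ _ _ (A `|` B)).
    by move=> w Iw; have [?|/ltW ?] := leP w.1 2^-1; [left|right].
  have cII : closed (I `*` I).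
    rewrite (_ : I `*` I = fst @^-1` I `&` snd @^-1` I) //.
    apply: closedI; (apply: closed_comp => [w _|]; last exact: interval_closed).
      exact: cfst.
    exact: csnd.
  apply: withinU_continuous.
  + apply: closedI => //.
    rewrite (_ : [set w : R * R | w.1 <= 2^-1] = fst @^-1` [set u | u <= 2^-1]) //.
    by apply: closed_comp => [w _|]; [exact: cfst|exact: closed_le].
  + apply: closedI => //.
    rewrite (_ : [set w : R * R | 2^-1 <= w.1] = fst @^-1` [set u | 2^-1 <= u]) //.
    by apply: closed_comp => [w _|]; [exact: cfst|exact: closed_ge].
  + apply: (@subspace_eq_continuous _ _ _ (h \o (fun w => (first_half w.1, w.2)))).
      by move=> w /set_mem[hw _]; rewrite -[RHS]/(H w) H1.
    apply: (@within_comp _ _ _ _ (I `*` I)) ch _ => //.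
      apply: within_pair; last exact: continuous_subspaceT.
      apply: (@within_comp _ _ _ _ I fst first_half _ cf).
        exact: continuous_subspaceT.
      by move=> w [_ []].
    by move=> w [_ [Iw1 Iw2]]; split => //=; exact: If.
  + apply: (@subspace_eq_continuous _ _ _ (q \o (fun w => second_half w.1))).
      by move=> w /set_mem[hw Iw]; rewrite -[RHS]/(H w) H2.
    apply: (@within_comp _ _ _ _ I) (proj1 (dpath_directed q)) _.
      apply: (@within_comp _ _ _ _ I fst second_half _ cs).
        exact: continuous_subspaceT.
      by move=> w [_ []].
    by move=> w [_ [Iw1 Iw2]]; exact: Is.
- move=> t It.
  have I0 : I 0 by apply/IE; lra.
  have I1 : I 1 by apply/IE; lra.
  have [ht|/ltW ht] := leP t 2^-1.
    rewrite !H1 //= !path_concat_first //; exact/hp/If.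
  by rewrite !H2 //= !path_concat_second //; exact: dpath_concat_subproof.
- move=> s Is0.
  have I0 : I 0 by apply/IE; lra.
  have I1 : I 1 by apply/IE; lra.
  rewrite H1 /=; last by lra.
  rewrite H2 //=; last by lra.
  have -> : first_half 0 = 0 by rewrite /first_half mulr0; case: (leP 0 1) => ?; lra.
  have -> : second_half 1 = 1 by rewrite /second_half mulr1; case: (leP (2 - 1) 0) => ?; lra.
  by split; [have [] := hxy _ Is0|exact: dpath1].
- move=> a b ma mb; have [_ Ia _] := ma; have [_ Ib _] := mb.
  pose f1 t := h (first_half (a t), b t).
  pose f2 t := q (second_half (a t)).
  have d1 : directed_path f1.
    exact: hd (weakly_increasing_comp first_half_incr ma) mb.
  have d2 : directed_path f2.
    apply: (@directed_path_comp _ _ _ q) (dpath_directed q) _.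
    exact: weakly_increasing_comp second_half_incr ma.
  have [hs|hs|[c c01 [h1 h2]]] := split_half ma.
  + apply: directed_path_ext d2 => t It; rewrite H2 //; last exact: hs.
    by split; [exact: Ia|exact: Ib].
  + by apply: directed_path_ext d1 => t It; rewrite H1 //=; exact: hs.
  + apply: (directed_path_paste c01 d1 d2) => t ht.
      by rewrite H1 //=; exact: h1.
    have It : I t by apply/IE; lra.
    rewrite H2 //=; last exact: h2.
    by split; [exact: Ia|exact: Ib].
Qed.

Lemma dhomotopic_concatr x y z (p : dpath x y) (q0 q1 : dpath y z) :
  immediately_dhomotopic q0 q1 ->
  immediately_dhomotopic (dpath_concat p q0) (dpath_concat p q1).
Proof.
move=> [h [ch hp hxy hd]].
have [cf If mf] := first_half_incr; have [cs Is ms] := second_half_incr.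
pose H (w : R * R) : X :=
  if w.1 <= 2^-1 then p (first_half w.1) else h (second_half w.1, w.2).
have H2 w : (I `*` I) w -> 2^-1 <= w.1 -> H w = h (second_half w.1, w.2).
  move=> [_ Iw] hw; rewrite /H; case: leP => // hw'.
  have -> : w.1 = 2^-1 by lra.
  rewrite /first_half /second_half.
  have -> : 2 * 2^-1 = 1 :> R by field.
  rewrite minxx subrr maxxx dpath1.
  by have [-> _] := hxy _ Iw.
have H1 w : w.1 <= 2^-1 -> H w = p (first_half w.1) by rewrite /H => ->.
have cfst : continuous (fst : R * R -> R) by move=> w; exact: cvg_fst.
have csnd : continuous (snd : R * R -> R) by move=> w; exact: cvg_snd.
exists H; split.
- pose A := [set w : R * R | w.1 <= 2^-1] `&` (I `*` I).
  pose B := [set w : R * R | 2^-1 <= w.1] `&` (I `*` I).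
  apply: (@within_sub _ _ _ (A `|` B)).
    by move=> w Iw; have [?|/ltW ?] := leP w.1 2^-1; [left|right].
  have cII : closed (I `*` I).
    rewrite (_ : I `*` I = fst @^-1` I `&` snd @^-1` I) //.
    apply: closedI; (apply: closed_comp => [w _|]; last exact: interval_closed).
      exact: cfst.
    exact: csnd.
  apply: withinU_continuous.
  + apply: closedI => //.
    rewrite (_ : [set w : R * R | w.1 <= 2^-1] = fst @^-1` [set u | u <= 2^-1]) //.
    by apply: closed_comp => [w _|]; [exact: cfst|exact: closed_le].
  + apply: closedI => //.
    rewrite (_ : [set w : R * R | 2^-1 <= w.1] = fst @^-1` [set u | 2^-1 <= u]) //.
    by apply: closed_comp => [w _|]; [exact: cfst|exact: closed_ge].
  + apply: (@subspace_eq_continuous _ _ _ (p \o (fun w => first_half w.1))).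
      by move=> w /set_mem[hw _]; rewrite -[RHS]/(H w) H1.
    apply: (@within_comp _ _ _ _ I) (proj1 (dpath_directed p)) _.
      apply: (@within_comp _ _ _ _ I fst first_half _ cf).
        exact: continuous_subspaceT.
      by move=> w [_ []].
    by move=> w [_ [Iw1 Iw2]]; exact: If.
  + apply: (@subspace_eq_continuous _ _ _ (h \o (fun w => (second_half w.1, w.2)))).
      by move=> w /set_mem[hw Iw]; rewrite -[RHS]/(H w) H2.
    apply: (@within_comp _ _ _ _ (I `*` I)) ch _ => //.
      apply: within_pair; last exact: continuous_subspaceT.
      apply: (@within_comp _ _ _ _ I fst second_half _ cs).
        exact: continuous_subspaceT.
      by move=> w [_ []].
    by move=> w [_ [Iw1 Iw2]]; split => //=; exact: Is.
- move=> t It.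
  have I0 : I 0 by apply/IE; lra.
  have I1 : I 1 by apply/IE; lra.
  have [ht|/ltW ht] := leP t 2^-1.
    by rewrite !H1 //= !path_concat_first.
  rewrite !H2 //= !path_concat_second //; try exact: dpath_concat_subproof.
  exact/hp/Is.
- move=> s Is0.
  have I0 : I 0 by apply/IE; lra.
  have I1 : I 1 by apply/IE; lra.
  rewrite H1 /=; last by lra.
  rewrite H2 //=; last by lra.
  have -> : first_half 0 = 0 by rewrite /first_half mulr0; case: (leP 0 1) => ?; lra.
  have -> : second_half 1 = 1 by rewrite /second_half mulr1; case: (leP (2 - 1) 0) => ?; lra.
  by split; [exact: dpath0|have [] := hxy _ Is0].
- move=> a b ma mb; have [_ Ia _] := ma; have [_ Ib _] := mb.
  pose f1 t := p (first_half (a t)).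
  pose f2 t := h (second_half (a t), b t).
  have d2 : directed_path f2.
    exact: hd (weakly_increasing_comp second_half_incr ma) mb.
  have d1 : directed_path f1.
    apply: (@directed_path_comp _ _ _ p) (dpath_directed p) _.
    exact: weakly_increasing_comp first_half_incr ma.
  have [hs|hs|[c c01 [h1 h2]]] := split_half ma.
  + apply: directed_path_ext d2 => t It; rewrite H2 //; last exact: hs.
    by split; [exact: Ia|exact: Ib].
  + by apply: directed_path_ext d1 => t It; rewrite H1 //=; exact: hs.
  + apply: (directed_path_paste c01 d1 d2) => t ht.
      by rewrite H1 //=; exact: h1.
    have It : I t by apply/IE; lra.
    rewrite H2 //=; last exact: h2.
    by split; [exact: Ia|exact: Ib].
Qed.

Lemma dequiv_concat x y z (p p' : dpath x y) (q q' : dpath y z) :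
  dequiv p p' -> dequiv q q' -> dequiv (dpath_concat p q) (dpath_concat p' q').
Proof.
move=> pp' qq'; apply: (@rst_trans _ _ _ (dpath_concat p' q)).
  elim: pp' => {p p'}.
  - move=> p p' [pp'|pp']; apply: rst_step; [left|right].
      exact: reparam_concat pp' (reparam_refl q).
    exact: dhomotopic_concatl.
  - by move=> p; exact: rst_refl.
  - by move=> p p' _; exact: rst_sym.
  - by move=> p p' p'' _ + _; exact: rst_trans.
elim: qq' => {q q'}.
- move=> q q' [qq'|qq']; apply: rst_step; [left|right].
    exact: reparam_concat (reparam_refl p') qq'.
  exact: dhomotopic_concatr.
- by move=> q; exact: rst_refl.
- by move=> q q' _; exact: rst_sym.
- by move=> q q' q'' _ + _; exact: rst_trans.
Qed.

Lemma dequiv_concat1p x y (p : dpath x y) : dequiv (dpath_concat (dpath_id x) p) p.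
Proof.
apply: rst_sym; apply: (@dequiv_reparam _ _ _ _ second_half second_half_incr).
- by rewrite /second_half mulr0; case: (leP (0 - 1) 0) => ?; lra.
- by rewrite /second_half mulr1; case: (leP (2 - 1) 0) => ?; lra.
move=> t It /=; have [ht|/ltW ht] := leP t 2^-1; last first.
  by rewrite path_concat_second //= dpath0.
rewrite path_concat_first //=.
have -> : second_half t = 0 by rewrite /second_half; case: (leP (2 * t - 1) 0); lra.
by rewrite dpath0.
Qed.

Lemma dequiv_concatp1 x y (p : dpath x y) : dequiv (dpath_concat p (dpath_id y)) p.
Proof.
apply: rst_sym; apply: (@dequiv_reparam _ _ _ _ first_half first_half_incr).
- by rewrite /first_half mulr0; case: (leP 0 1) => ?; lra.
- by rewrite /first_half mulr1; case: (leP 2 1) => ?; lra.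
move=> t It /=; have [ht|/ltW ht] := leP t 2^-1; first by rewrite path_concat_first.
rewrite path_concat_second //= ?dpath1 //.
have -> : first_half t = 1 by rewrite /first_half; case: (leP (2 * t) 1); lra.
by rewrite dpath1.
Qed.

Lemma dequiv_concatA x y z t (p : dpath x y) (q : dpath y z) (r : dpath z t) :
  dequiv (dpath_concat (dpath_concat p q) r) (dpath_concat p (dpath_concat q r)).
Proof.
pose a (u : R) : R := Num.min (2 * u) (Num.min (1 * u + 4^-1) (2^-1 * u + 2^-1)).
have aE (u : R) : 0 <= u <= 1 -> [\/ u <= 4^-1 /\ a u = 2 * u,
    4^-1 <= u <= 2^-1 /\ a u = u + 4^-1 | 2^-1 <= u /\ a u = u / 2 + 2^-1].
  move=> u01; rewrite /a; case: (leP (1 * u + 4^-1) (2^-1 * u + 2^-1)) => h1.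
    by case: (leP (2 * u) (1 * u + 4^-1)) => h2; [constructor 1|constructor 2]; split; lra.
  by case: (leP (2 * u) (2^-1 * u + 2^-1)) => h2; [constructor 1|constructor 3]; split; lra.
apply: rst_sym; apply: (@dequiv_reparam _ _ _ _ a).
- apply: weakly_increasing_continuous.
  + apply: continuous_minr; first exact: continuous_double.
    by apply: continuous_minr; exact: continuous_affine.
  + by move=> u /IE/[dup] u01 /aE h; apply/IE; case: h => -[? ->]; lra.
  + move=> u v /IE/aE hu /IE/aE hv uv.
    by case: hu => -[? ->]; case: hv => -[? ->]; lra.
- have h : 0 <= (0 : R) <= 1 by lra.
  by case: (aE _ h) => -[? ->]; lra.
- have h : 0 <= (1 : R) <= 1 by lra.
  by case: (aE _ h) => -[? ->]; lra.
move=> u /IE/[dup] u01 /aE.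
have pq := dpath_concat_subproof p q; have qr := dpath_concat_subproof q r.
have pqr := dpath_concat_subproof p (dpath_concat q r).
have pqr' := dpath_concat_subproof (dpath_concat p q) r.
have fhE (v : R) : v <= 2^-1 -> first_half v = 2 * v.
  by move=> ?; rewrite /first_half; case: (leP (2 * v) 1); lra.
have shE (v : R) : 2^-1 <= v -> second_half v = 2 * v - 1.
  by move=> ?; rewrite /second_half; case: (leP (2 * v - 1) 0); lra.
case=> -[hu ->] /=.
- rewrite path_concat_first; last by lra.
  rewrite fhE /=; last by lra.
  rewrite path_concat_first; last by lra.
  rewrite fhE /=; last by lra.
  rewrite path_concat_first; last by lra.
  by rewrite fhE; last by lra.
- rewrite path_concat_first; last by lra.
  rewrite fhE /=; last by lra.
  rewrite path_concat_second; [|first [exact: pq|exact: qr|exact: pqr|exact: pqr']|by lra].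
  rewrite shE /=; last by lra.
  rewrite path_concat_second; [|first [exact: pq|exact: qr|exact: pqr|exact: pqr']|by lra].
  rewrite shE /=; last by lra.
  rewrite path_concat_first; last by lra.
  rewrite fhE /=; last by lra.
  by congr (q _); field.
- rewrite path_concat_second; [|first [exact: pq|exact: qr|exact: pqr|exact: pqr']|by lra].
  rewrite shE /=; last by lra.
  rewrite path_concat_second; [|first [exact: pq|exact: qr|exact: pqr|exact: pqr']|by lra].
  rewrite shE /=; last by lra.
  rewrite path_concat_second; [|first [exact: pq|exact: qr|exact: pqr|exact: pqr']|by lra].
  rewrite shE /=; last by lra.
  by congr (r _); field.
Qed.

HB.instance Definition _ x y := gen_eqMixin (dpath x y).
HB.instance Definition _ x y := gen_choiceMixin (dpath x y).

Definition dequivb x y (p q : dpath x y) : bool := `[< dequiv p q >].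

Lemma dequivb_refl x y : reflexive (@dequivb x y).
Proof. by move=> p; apply/asboolP; exact: rst_refl. Qed.

Lemma dequivb_sym x y : ssrbool.symmetric (@dequivb x y).
Proof. by move=> p q; apply/asboolP/asboolP; exact: rst_sym. Qed.

Lemma dequivb_trans x y : ssrbool.transitive (@dequivb x y).
Proof.
by move=> q p r /asboolP pq /asboolP qr; apply/asboolP; exact: rst_trans pq qr.
Qed.

Canonical dequiv_rel x y := EquivRel (@dequivb x y) (@dequivb_refl x y)
  (@dequivb_sym x y) (@dequivb_trans x y).

Definition dpath_class_type x y := {eq_quot (dequiv_rel x y)}%qT.

Definition dpath_class x y (p : dpath x y) : dpath_class_type x y :=
  \pi_({eq_quot (dequiv_rel x y)})%qT p.

Lemma dpath_classP x y (p q : dpath x y) : dpath_class p = dpath_class q <-> dequiv p q.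
Proof. by split=> [/eqmodP/asboolP|pq]; last by apply/eqmodP/asboolP. Qed.

Lemma dpath_class_repr x y (f : dpath_class_type x y) : dpath_class (repr f) = f.
Proof. exact: reprK. Qed.

Definition class_concat x y z (f : dpath_class_type x y) (g : dpath_class_type y z) :
    dpath_class_type x z :=
  dpath_class (dpath_concat (repr f) (repr g)).

Lemma class_concatE x y z (p : dpath x y) (q : dpath y z) :
  class_concat (dpath_class p) (dpath_class q) = dpath_class (dpath_concat p q).
Proof.
by apply/dpath_classP/dequiv_concat; apply/dpath_classP; rewrite dpath_class_repr.
Qed.

Fact class_concat1f x y (f : dpath_class_type x y) :
  class_concat (dpath_class (dpath_id x)) f = f.
Proof.
rewrite -[f]dpath_class_repr class_concatE; apply/dpath_classP; exact: dequiv_concat1p.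
Qed.

Fact class_concatf1 x y (f : dpath_class_type x y) :
  class_concat f (dpath_class (dpath_id y)) = f.
Proof.
rewrite -[f]dpath_class_repr class_concatE; apply/dpath_classP; exact: dequiv_concatp1.
Qed.

Fact class_concatA x y z t (f : dpath_class_type x y) (g : dpath_class_type y z)
    (h : dpath_class_type z t) :
  class_concat (class_concat f g) h = class_concat f (class_concat g h).
Proof.
rewrite -[f]dpath_class_repr -[g]dpath_class_repr -[h]dpath_class_repr !class_concatE.
apply/dpath_classP; exact: dequiv_concatA.
Qed.

Definition fundamental_category : category :=
  @Category X dpath_class_type (fun x => dpath_class (dpath_id x)) class_concat
    class_concat1f class_concatf1 class_concatA.

End FundamentalCategory.

Section FundamentalParcel.
Variables (R : realType) (d : nat) (X : manifold_with_defect R d).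

(* [traverses p a b w]: w is the arrow of P(Gamma2) recording the sequence of strata
   through which p passes on [a, b]. *)
Inductive traverses (p : R -> X) : R -> R -> arrow (path_category Gamma2) -> Prop :=
| traverses_bulk a b : a <= b -> ~ defect X (p a) ->
    (forall t, a <= t <= b -> stratum (p a) (p t)) ->
    traverses p a b Id_beta
| traverses_defect a b : a <= b -> defect X (p a) ->
    (forall t, a <= t <= b -> stratum (p a) (p t)) ->
    traverses p a b Id_delta
| traverses_iota a c b : a < c <= b -> ~ defect X (p a) -> defect X (p b) ->
    (forall t, a <= t < c -> stratum (p a) (p t)) ->
    (forall t, c <= t <= b -> stratum (p b) (p t)) ->
    traverses p a b arrow_iota
| traverses_omega a c b : a <= c < b -> defect X (p a) -> ~ defect X (p b) ->
    (forall t, a <= t <= c -> stratum (p a) (p t)) ->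
    (forall t, c < t <= b -> stratum (p b) (p t)) ->
    traverses p a b arrow_omega
| traverses_concat a c b v w u : traverses p a c v -> traverses p c b w ->
    composes v w u -> traverses p a b u.

Definition base_points (B : set X) : Prop :=
  forall x, exists! b, B b /\ stratum x b.

Definition fundamental_parcel (B : set X) : category :=
  full_subcategory (C := fundamental_category X) B.

(* The structure functor of the fundamental parcel: its value on objects, and its graph on
   arrows, the image of a class being read off any of its representatives. *)
Definition structure_ob (x : X) : gamma2_vertex :=
  if `[< defect X x >] then delta else beta.

Definition structure_graph (B : set X) (f : arrow (fundamental_parcel B))
    (w : arrow (path_category Gamma2)) : Prop :=
  exists (x y : {x : X | B x}) (p : dpath (sval x) (sval y)),
    f = @Arrow (fundamental_parcel B) x y (dpath_class p) /\ traverses p 0 1 w.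

Definition parcel_functors (B : set X) (C : parcel Gamma2) :
    set (functor (fundamental_parcel B) C) :=
  [set F : functor (fundamental_parcel B) C |
     (forall x : fundamental_parcel B, parcel_map C (F x) = structure_ob (sval x)) /\
     forall f w, structure_graph f w -> map_arrow (parcel_map C) (map_arrow F f) = w].

End FundamentalParcel.

Definition simplicial_complex (m : nat) (K : {set {set 'I_m}}) : Prop :=
  finset.set0 \notin K /\
  forall s t : {set 'I_m}, s \in K -> t \subset s -> t != finset.set0 -> t \in K.

(* The closed simplex spanned by the basis vectors of R^m with indices in s. *)
Definition standard_simplex (R : realType) (m : nat) (s : {set 'I_m}) : set 'rV[R]_m :=
  [set v | [/\ forall i, 0 <= v ord0 i, \sum_i v ord0 i = 1 &
               forall i, v ord0 i != 0 -> i \in s]].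

Record triangulation (R : realType) (X : topologicalType) := Triangulation {
  nvertices : nat;
  simplices : {set {set 'I_nvertices}};
  triangulation_map : 'rV[R]_nvertices -> X;
  simplicesP : simplicial_complex simplices;
  simplices1 : forall v, [set v]%SET \in simplices;
  triangulationP :
    homeo_on (\bigcup_(s in [set` simplices]) standard_simplex s) [set: X]
      triangulation_map }.

Arguments nvertices {R X} t.
Arguments simplices {R X} t.
Arguments triangulation_map {R X} t _.

Section Triangulations.
Variables (R : realType) (d : nat) (X : manifold_with_defect R d).

Definition simplex (T : triangulation R X) (s : {set 'I_(nvertices T)}) : set X :=
  triangulation_map T @` standard_simplex s.

Definition vertex_point (T : triangulation R X) (v : 'I_(nvertices T)) : X :=
  triangulation_map T (delta_mx ord0 v).

Definition edge_path (T : triangulation R X) (u v : 'I_(nvertices T)) : R -> X :=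
  fun t => triangulation_map T ((1 - t) *: delta_mx ord0 u + t *: delta_mx ord0 v).

Definition is_subcomplex (T : triangulation R X) (A : set X) : Prop :=
  exists L : {set {set 'I_(nvertices T)}},
    [/\ L \subset simplices T, simplicial_complex L &
        A = \bigcup_(s in [set` L]) simplex s].

Definition flag_like (T : triangulation R X) : Prop :=
  [/\ is_subcomplex T (defect X),
      (forall x : X, is_subcomplex T (closure (stratum x))) &
      (forall s : {set 'I_(nvertices T)}, s \in simplices T ->
         simplex s `&` defect X = set0 \/
         exists t : {set 'I_(nvertices T)},
           [/\ t \in simplices T, t \subset s & simplex s `&` defect X = simplex t])].

Record directed_triangulation := DirectedTriangulation {
  underlying :> triangulation R X;
  underlying_flag_like : flag_like underlying;
  vertex_lt : rel 'I_(nvertices underlying);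
  vertex_lt_irr : irreflexive vertex_lt;
  vertex_lt_trans : forall u v w,
    stratum (vertex_point u) (vertex_point v) ->
    stratum (vertex_point v) (vertex_point w) ->
    vertex_lt u v -> vertex_lt v w -> vertex_lt u w;
  vertex_lt_total : forall u v, u != v ->
    stratum (vertex_point u) (vertex_point v) -> vertex_lt u v || vertex_lt v u;
  (* [edge_dir u v]: there is an edge between u and v, oriented from u to v. *)
  edge_dir : rel 'I_(nvertices underlying);
  edge_dirP : forall u v, edge_dir u v ->
    u != v /\ [set u; v]%SET \in simplices underlying;
  edge_dir_total : forall u v, u != v -> [set u; v]%SET \in simplices underlying ->
    edge_dir u v (+) edge_dir v u;
  edge_dir_stratum : forall u v, edge_dir u v ->
    simplex [set u; v]%SET `<=` stratum (vertex_point u) -> vertex_lt u v;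
  edge_dir_directed : forall u v, edge_dir u v ->
    ~ simplex [set u; v]%SET `<=` stratum (vertex_point u) ->
    directed_path (edge_path u v) }.

Definition bulk_vertices (T : triangulation R X) : set 'I_(nvertices T) :=
  [set v | ~ defect X (vertex_point v)].
Definition defect_vertices (T : triangulation R X) : set 'I_(nvertices T) :=
  [set v | defect X (vertex_point v)].
Arguments bulk_vertices : clear implicits.
Arguments defect_vertices : clear implicits.

Definition oriented_edge (T : directed_triangulation) :=
  {e : 'I_(nvertices T) * 'I_(nvertices T) | edge_dir e.1 e.2}.

Definition initial (T : directed_triangulation) (e : oriented_edge T) := (sval e).1.
Definition terminal (T : directed_triangulation) (e : oriented_edge T) := (sval e).2.
Definition edge_simplex (T : directed_triangulation) (e : oriented_edge T) : set X :=
  simplex [set initial e; terminal e]%SET.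

Definition colorings (C : parcel Gamma2) (T : directed_triangulation) :
    set (oriented_edge T -> arrow C) :=
  [set c | [/\
    (forall e, edge_simplex e `<=` ~` defect X -> above C Id_beta (c e)),
    (forall e, edge_simplex e `<=` defect X -> above C Id_delta (c e)),
    (forall e, bulk_vertices T (initial e) -> defect_vertices T (terminal e) ->
       above C arrow_iota (c e)),
    (forall e, defect_vertices T (initial e) -> bulk_vertices T (terminal e) ->
       above C arrow_omega (c e)) &
    (forall e f g, terminal e = initial f -> initial e = initial g ->
       terminal f = terminal g ->
       [set initial e; terminal e; terminal f]%SET \in simplices T ->
       composes (c e) (c f) (c g))]].

End Triangulations.

Arguments bulk_vertices {R d X} T.
Arguments defect_vertices {R d X} T.
Arguments colorings {R d X} C T.
Arguments parcel_functors {R d X} B C.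

(* Main.v *)
Require Import Defs.
From mathcomp Require Import all_boot all_order all_algebra.
From mathcomp Require Import all_classical all_reals all_analysis.
From mathcomp Require Import ring lra.
From Stdlib Require Import Relation_Operators.

(** A coloring of the triangulation is the same thing as a functor to C, over the path
    category, from the full subcategory of the fundamental category on the vertices.  Such a
    functor amounts to a functor on the base points together with a change of trivialization
    at each vertex, that is, an arrow above the identity of beta or of delta according to
    the kind of the vertex, these changes being normalized at one root vertex in each
    stratum.  Counting both sides gives the formula: v_beta - sigma_beta of the arrows above
    the identity of beta and v_delta - sigma_delta of those above the identity of delta are
    free.

    From colorings to functors: parallel transport.  All the edges of a simplex that join
    the bulk to the defect cross the defect in the same direction, because near its defect
    face the interior of the simplex lies on one side of the collar ([simplex_leads]).  Call
    carrier of a point the simplex whose relative interior contains it; then a bulk point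
    whose carrier meets the defect faces inwards or outwards, and a path is directed if and
    only if it enters the defect from inward-facing points and leaves it to outward-facing
    ones ([directed_pathP]).  Each point has a nearby vertex, in its carrier and in its
    stratum.  The colors, inverted where needed along the edges inside a stratum, give
    transition arrows between nearby vertices that satisfy the cocycle identity in each
    simplex ([transition_cocycle]); inverses exist because the structure functor is
    conservative.  Along a directed path the transition arrows compose to a holonomy
    ([exists_parallel], [holonomyP]), which for a short arc near a point y is the product of
    the transition to y and the transition from y ([holonomy_through]).  Hence both boundary
    paths of a small rectangle in a directed homotopy have the same holonomy, and pasting
    rectangles shows that the holonomy depends only on the class of the path
    ([holonomy_dequiv]).

    From functors to colorings: restriction to the edges.  The identity for a triangle holds
    because the triangle is the cone over one of its edges and cones are directed homotopies
    ([cone_in], [cone_out], [transport_color_triangle]).  A functor is determined by the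
    values on the edges: a short arc of a directed path is contracted by two cones to a
    segment between vertices ([transport_into], [transport_out_of]), so that the values of
    the functor on the initial parts of the path form a parallel section
    ([transport_holonomy]).

    Change of base points: the points of a stratum are joined by invertible classes
    ([exists_stratum_class]), and conjugation by such classes compares functors on the
    vertices with functors on the base points ([ascend_descend], [descend_ascend],
    [comparison_ascend]).

    Arrows of C are composed as values of a partial associative operation on
    [option (arrow C)].  By regularity C has one object over each of beta and delta, so
    arrows compose as soon as their images in the path category do. *)

Set Implicit Arguments.
Unset Strict Implicit.
Unset Printing Implicit Defensive.

Import Order.TTheory GRing.Theory Num.Theory.
Import numFieldNormedType.Exports.

Local Open Scope classical_set_scope.
Local Open Scope ring_scope.

(** * Induction along an interval *)

(** Most inequalities between times follow by transitivity, which is far quicker to find than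
    a linear combination. *)
Ltac order_chain :=
  first [assumption | match goal with
  | |- is_true (?a <= ?a) => exact: lexx
  | H : is_true (?a < ?b) |- is_true (?a <= ?b) => exact: (ltW H)
  | H : is_true (?a <= ?b), H' : is_true (?b <= ?c) |- is_true (?a <= ?c) => exact: (le_trans H H')
  | H : is_true (?a < ?b), H' : is_true (?b <= ?c) |- is_true (?a <= ?c) =>
      exact: (ltW (lt_le_trans H H'))
  | H : is_true (?a <= ?b), H' : is_true (?b < ?c) |- is_true (?a <= ?c) =>
      exact: (ltW (le_lt_trans H H'))
  | H : is_true (?a < ?b), H' : is_true (?b < ?c) |- is_true (?a <= ?c) =>
      exact: (ltW (lt_trans H H'))
  | H : is_true (?a < ?b), H' : is_true (?b <= ?c) |- is_true (?a < ?c) => exact: (lt_le_trans H H')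
  | H : is_true (?a <= ?b), H' : is_true (?b < ?c) |- is_true (?a < ?c) => exact: (le_lt_trans H H')
  | H : is_true (?a < ?b), H' : is_true (?b < ?c) |- is_true (?a < ?c) => exact: (lt_trans H H')
  | H : is_true (?a <= ?b), H' : is_true (?b <= ?c), H'' : is_true (?c <= ?d) |-
      is_true (?a <= ?d) => exact: (le_trans H (le_trans H' H''))
  end].

Ltac lin := first [order_chain | split; order_chain | lra].

Section IntervalInduction.
Variable R : realType.
Implicit Types (a b s t x y e : R).

Lemma le_unit s t : 0 <= s -> s <= t -> t <= 1 -> 0 <= s <= 1 /\ 0 <= t <= 1.
Proof. by move=> s0 st t1; split; apply/andP; split; lra. Qed.

Lemma exists_smaller e e' : 0 < e -> 0 < e' -> exists k, [/\ 0 < k, k <= e & k <= e'].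
Proof.
move=> e0 e0'; by exists (Num.min e e'); rewrite lt_min e0 e0' !ge_min !lexx orbT.
Qed.

Lemma exists_before a t e : a < t -> 0 < e -> exists u, [/\ a <= u, u < t & t - u < e].
Proof.
move=> at_ e0; exists (Num.max a (t - e / 2)).
by case: (leP a (t - e / 2)) => ?; split; lra.
Qed.

Lemma exists_after t b e : t < b -> 0 < e -> exists u, [/\ t < u, u < b & u - t < e].
Proof.
move=> tb e0; exists (Num.min ((t + b) / 2) (t + e / 2)).
by case: (leP ((t + b) / 2) (t + e / 2)) => ?; split; lra.
Qed.

(** The supremum of the times t for which the property holds on [a, t] belongs to this set
    and cannot be smaller than b: this is how the compactness of [a, b] is used throughout. *)
Lemma interval_additive_induction (Q : R -> R -> Prop) a b : a <= b ->
  (forall x y z, a <= x -> x <= y -> y <= z -> z <= b -> Q x y -> Q y z -> Q x z) ->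
  (forall t, a <= t <= b -> exists2 e, 0 < e &
     forall x y, a <= x -> x <= t -> t <= y -> y <= b -> t - x < e -> y - t < e -> Q x y) ->
  Q a b.
Proof.
move=> ab Qadd Qloc.
pose S := [set t | a <= t <= b /\ Q a t].
have Sa : S a.
  split; first by rewrite lexx.
  have [|e e0 he] := Qloc a; first by rewrite lexx.
  by apply: he => //; rewrite subrr.
have supS : has_sup S.
  by split; [exists a|exists b => t [/andP[_ tb] _]].
pose c := sup S.
have ac : a <= c by apply: sup_upper_bound.
have cb : c <= b by apply: ge_sup; [exists a|move=> t [/andP[_ tb] _]].
have [|e e0 he] := Qloc c; first by rewrite ac cb.
have [t [/andP[at_ tb] Qat] ct] := sup_adherent e0 supS.
have tc : t <= c by apply: sup_upper_bound => //; split=> //; rewrite at_ tb.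
have Qy y : c <= y -> y <= b -> y - c < e -> S y.
  move=> cy yb yce; split; first by lra.
  apply: (Qadd a t y) => //; first by lra.
  by apply: he => //; rewrite /c in ct *; lra.
have [bc|cltb] := leP b c.
  have -> : b = c by lra.
  by have [_] : S c by apply: Qy; lra.
pose y := Num.min b (c + e / 2).
have ym : y <= b /\ y <= c + e / 2 by rewrite /y; case: (leP b (c + e / 2)); lra.
have cy : c < y by rewrite /y; case: (leP b (c + e / 2)); lra.
have : S y by apply: Qy; lra.
by move=> /(sup_upper_bound supS); rewrite -/c; lra.
Qed.

(** Induction along the interval: a property that propagates to the right of each time and
    to the limit of earlier times holds everywhere. *)
Lemma interval_continuous_induction (S : R -> Prop) a b :
  S a ->
  (forall t, a <= t -> t < b -> S t -> exists2 e, 0 < e &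
     forall y, t <= y -> y <= b -> y - t < e -> S y) ->
  (forall t, a < t -> t <= b -> (forall y, a <= y -> y < t -> S y) -> S t) ->
  forall t, a <= t -> t <= b -> S t.
Proof.
move=> Sa Sright Sleft.
have [ab|ba] := leP a b; last by move=> t; lra.
pose P := [set t | a <= t <= b /\ forall y, a <= y -> y <= t -> S y].
have Pa : P a.
  by split; [rewrite lexx|move=> y ay ya; rewrite (_ : y = a) //; lra].
have supP : has_sup P by split; [exists a|exists b => t [/andP[_ tb] _]].
pose c := sup P.
have ac : a <= c by apply: sup_upper_bound.
have cb : c <= b by apply: ge_sup; [exists a|move=> t [/andP[_ tb] _]].
have below y : a <= y -> y < c -> S y.
  move=> ay yc; have e0 : 0 < c - y by lra.
  have [t [_ Pt] ct] := sup_adherent e0 supP.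
  by apply: Pt => //; rewrite -/c in ct; lra.
have Sc : S c.
  have [ca|aLc] := leP c a; first by rewrite (_ : c = a) //; lra.
  exact: Sleft.
have upto y : a <= y -> y <= c -> S y.
  move=> ay; rewrite le_eqVlt => /predU1P[->//|]; exact: below.
have [bc|cltb] := leP b c; first by move=> t ta tb; apply: upto => //; lra.
have [e e0 he] := Sright c ac cltb Sc.
pose y := Num.min b (c + e / 2).
have ym : y <= b /\ y <= c + e / 2 by rewrite /y; case: (leP b (c + e / 2)); lra.
have cy : c < y by rewrite /y; case: (leP b (c + e / 2)); lra.
have : P y.
  split; first by lra.
  move=> z az zy; have [zc|cz] := leP z c; first exact: upto.
  by apply: he; lra.
by move=> /(sup_upper_bound supP); rewrite -/c; lra.
Qed.

Definition near_in a b t (P : R -> Prop) :=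
  exists2 e, 0 < e & forall y, a <= y -> y <= b -> `|y - t| < e -> P y.

Lemma near_inW a b t (P Q : R -> Prop) :
  (forall y, a <= y -> y <= b -> P y -> Q y) -> near_in a b t P -> near_in a b t Q.
Proof. by move=> PQ [e e0 he]; exists e => // y ay yb h; apply: PQ => //; exact: he. Qed.

Lemma near_inI a b t (P Q : R -> Prop) :
  near_in a b t P -> near_in a b t Q -> near_in a b t (fun y => P y /\ Q y).
Proof.
move=> [e e0 he] [f f0 hf]; exists (Num.min e f); first by rewrite lt_min e0.
by move=> y ay yb; rewrite lt_min => /andP[h1 h2]; split; [exact: he|exact: hf].
Qed.

Lemma near_in_sub a b a' b' t (P : R -> Prop) : a <= a' -> b' <= b ->
  near_in a b t P -> near_in a' b' t P.
Proof. by move=> aa bb [e e0 he]; exists e => // y ay yb; apply: he; lra. Qed.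

Lemma near_inT a b t (P : R -> Prop) : (forall y, a <= y -> y <= b -> P y) -> near_in a b t P.
Proof. by move=> h; exists 1 => // y ay yb _; exact: h. Qed.

Lemma near_in_window a b t (P : R -> Prop) : near_in a b t P ->
  exists2 e, 0 < e & forall y, a <= y -> y <= b -> t - y < e -> y - t < e -> P y.
Proof.
move=> [e e0 he]; exists e => // y ay yb h1 h2; apply: he => //.
by rewrite ltr_norml; lra.
Qed.

Lemma within_near_in (Y : topologicalType) (p : R -> Y) a b t (A : set Y) :
  {within `[a, b], continuous p} -> a <= t -> t <= b -> nbhs (p t) A ->
  near_in a b t (fun y => A (p y)).
Proof.
move=> /subspace_continuousP cp ta tb nA.
have It : `[a, b]%classic t by rewrite /= in_itv /= ta tb.
have := cp t It A nA; rewrite /nbhs /= /within /= => /nbhs_ballP[e /= e0 he].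
exists e => // y ay yb h; apply: (he y); last by rewrite /= in_itv /= ay yb.
by rewrite /ball /= distrC.
Qed.

End IntervalInduction.

(** * Barycentric coordinates *)

Section Coordinates.
Variables (R : realType) (X : topologicalType) (T : triangulation R X).
Local Notation m := (nvertices T).
Local Notation tau := (triangulation_map T).
Implicit Types (x y z : X) (s : {set 'I_m}) (r : R) (v : 'rV[R]_m) (i j : 'I_m).

Definition support v : {set 'I_m} := [set i | v ord0 i != 0]%SET.

Definition polyhedron : set 'rV[R]_m :=
  \bigcup_(s in [set` simplices T]) standard_simplex s.

Lemma support_neq0 v : \sum_i v ord0 i = 1 -> support v != finset.set0.
Proof.
move=> v1; apply/eqP => v0; have := oner_eq0 R; rewrite -v1 big1 ?eqxx // => i _.
by apply/eqP; move/setP: v0 => /(_ i); rewrite !inE => /negbFE.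
Qed.

Lemma standard_simplexP s v : standard_simplex s v <->
  [/\ forall i, 0 <= v ord0 i, \sum_i v ord0 i = 1 & support v \subset s].
Proof.
split=> -[h1 h2 h3]; split => //.
  by apply/fintype.subsetP => i; rewrite inE; exact: h3.
by move=> i vi; move/fintype.subsetP: h3; apply; rewrite inE.
Qed.

Lemma polyhedronP v : polyhedron v <->
  [/\ forall i, 0 <= v ord0 i, \sum_i v ord0 i = 1 & support v \in simplices T].
Proof.
have [_ Kface] := simplicesP T.
split=> [[s /= sK /standard_simplexP[h1 h2 h3]]|[h1 h2 h3]].
  by split => //; apply: Kface h3 _ => //; exact: support_neq0.
by exists (support v) => //=; apply/standard_simplexP; split.
Qed.

Definition coords : X -> 'rV[R]_m := projT1 (cid (triangulationP T)).

Lemma polyhedron_coords x : polyhedron (coords x).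
Proof.
by rewrite /coords; case: cid => g [_ _ _ h] /=; have [|] := h x.
Qed.

Lemma coordsK x : tau (coords x) = x.
Proof.
by rewrite /coords; case: cid => g [_ _ _ h] /=; have [|] := h x.
Qed.

Lemma triangulation_mapK v : polyhedron v -> coords (tau v) = v.
Proof.
by rewrite /coords; case: cid => g [_ _ h _] /= /h[].
Qed.

Lemma triangulation_map_continuous : {within polyhedron, continuous tau}.
Proof. by case: (triangulationP T) => g []. Qed.

Lemma coords_continuous : continuous coords.
Proof.
rewrite /coords; case: cid => g [_ cg _ _] /=.
exact/continuous_subspace_setT.
Qed.

Lemma coord_ge0 x i : 0 <= coords x ord0 i.
Proof. by have /polyhedronP[] := polyhedron_coords x. Qed.

Lemma coord_sum x : \sum_i coords x ord0 i = 1.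
Proof. by have /polyhedronP[] := polyhedron_coords x. Qed.

(** This is the simplex whose relative interior contains x. *)
Definition carrier_simplex x : {set 'I_m} := support (coords x).

Lemma carrier_in x : carrier_simplex x \in simplices T.
Proof. by have /polyhedronP[] := polyhedron_coords x. Qed.

Lemma carrier_neq0 x : exists i, i \in carrier_simplex x.
Proof. exact/set0Pn/support_neq0/coord_sum. Qed.

Lemma in_carrier x i : (i \in carrier_simplex x) = (0 < coords x ord0 i).
Proof. by rewrite inE lt_def coord_ge0 andbT. Qed.

Lemma near_in_carrier x i : i \in carrier_simplex x ->
  \forall y \near x, i \in carrier_simplex y.
Proof.
rewrite in_carrier => xi.
have c : continuous (fun y => coords y ord0 i).
  move=> y; apply: (@continuous_comp _ _ _ coords (fun v : 'rV[R]_m => v ord0 i)).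
    exact: coords_continuous.
  exact: coord_continuous.
have nx : nbhs (coords x ord0 i) [set r : R | 0 < r].
  by apply: open_nbhs_nbhs; split; first exact: open_gt.
have : \forall y \near x, 0 < coords y ord0 i by exact: c x _ nx.
by apply: filterS => y; rewrite in_carrier.
Qed.

Lemma near_carrier x : \forall y \near x, carrier_simplex x \subset carrier_simplex y.
Proof.
have : \forall y \near x, forall i, i \in carrier_simplex x -> i \in carrier_simplex y.
  apply: filter_forall => i; have [xi|nxi] := boolP (i \in carrier_simplex x).
    by move: (near_in_carrier xi); apply: filterS.
  by apply: nearW => y.
by apply: filterS => y h; apply/fintype.subsetP => i; exact: h.
Qed.

Definition joinable x y := carrier_simplex x :|: carrier_simplex y \in simplices T.

Lemma joinable_sub s x y : s \in simplices T -> carrier_simplex x \subset s ->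
  carrier_simplex y \subset s -> joinable x y.
Proof.
move=> sK xs ys; have [_ Kface] := simplicesP T; apply: (Kface s) => //.
  by rewrite finset.subUset xs.
by have [i xi] := carrier_neq0 x; apply/set0Pn; exists i; rewrite !inE in xi *; rewrite xi.
Qed.

Lemma joinable_sym x y : joinable x y -> joinable y x.
Proof. by rewrite /joinable finset.setUC. Qed.

Lemma joinable_subset x y : carrier_simplex x \subset carrier_simplex y -> joinable x y.
Proof. by move=> xy; apply: (joinable_sub (carrier_in y)). Qed.

Lemma simplex_edge s i j : s \in simplices T -> i \in s -> j \in s ->
  [set i; j]%SET \in simplices T.
Proof.
move=> sK is_ js; have [_ Kface] := simplicesP T; apply: (Kface s) => //.
  by apply/fintype.subsetP => k; rewrite finset.in_set2 => /orP[] /eqP->.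
by apply/set0Pn; exists i; rewrite !inE eqxx.
Qed.

Definition mix_coords x y r : 'rV[R]_m := (1 - r) *: coords x + r *: coords y.

(** Straight segments, in the coordinates of a closed simplex containing both ends; outside
    such a simplex the value is meaningless. *)
Definition mix x y r : X := tau (mix_coords x y r).

Lemma mix_coordsE x y r i :
  mix_coords x y r ord0 i = (1 - r) * coords x ord0 i + r * coords y ord0 i.
Proof. by rewrite !mxE. Qed.

Lemma support_mix x y r : 0 <= r <= 1 ->
  support (mix_coords x y r) =
  (if r == 1 then finset.set0 else carrier_simplex x) :|:
  (if r == 0 then finset.set0 else carrier_simplex y).
Proof.
move=> /andP[r0 r1]; apply/setP => i; rewrite !inE mix_coordsE.
have x0 := coord_ge0 x i; have y0 := coord_ge0 y i.
have [re|rn1] := eqVneq r 1.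
  by rewrite re oner_eq0 subrr mul0r mul1r add0r !inE.
have [re|rn0] := eqVneq r 0.
  by rewrite re subr0 mul1r mul0r addr0 !inE orbF.
have r0' : 0 < r by rewrite lt_def rn0.
have r1' : 0 < 1 - r by rewrite subr_gt0 lt_neqAle rn1.
rewrite paddr_eq0 ?mulr_ge0 ?(ltW r1') //.
by rewrite !mulf_eq0 negb_and !(gt_eqF r0') !(gt_eqF r1') /= !inE.
Qed.

Lemma polyhedron_mix x y r : joinable x y -> 0 <= r <= 1 -> polyhedron (mix_coords x y r).
Proof.
move=> jxy r01; have /andP[r0 r1] := r01.
have s1 : \sum_i mix_coords x y r ord0 i = 1.
  under eq_bigr do rewrite mix_coordsE.
  by rewrite big_split /= -!mulr_sumr !coord_sum; ring.
apply/polyhedronP; split => //.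
  by move=> i; rewrite mix_coordsE addr_ge0 ?mulr_ge0 ?coord_ge0 // subr_ge0.
have [_ Kface] := simplicesP T; apply: Kface jxy _ _; last exact: support_neq0.
rewrite support_mix //; apply: finset.setUSS; by case: ifP => _; rewrite ?finset.sub0set.
Qed.

Lemma coords_mix x y r : joinable x y -> 0 <= r <= 1 -> coords (mix x y r) = mix_coords x y r.
Proof. by move=> jxy r01; rewrite triangulation_mapK //; exact: polyhedron_mix. Qed.

Lemma carrier_mix x y r : joinable x y -> 0 <= r <= 1 ->
  carrier_simplex (mix x y r) =
  (if r == 1 then finset.set0 else carrier_simplex x) :|:
  (if r == 0 then finset.set0 else carrier_simplex y).
Proof. by move=> jxy r01; rewrite /carrier_simplex coords_mix // support_mix. Qed.

Lemma carrier_mix_sub x y r : joinable x y -> 0 <= r <= 1 ->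
  carrier_simplex (mix x y r) \subset carrier_simplex x :|: carrier_simplex y.
Proof.
by move=> jxy r01; rewrite carrier_mix //; apply: finset.setUSS;
  case: ifP => _; rewrite ?finset.sub0set.
Qed.

Lemma mix0 x y : mix x y 0 = x.
Proof. by rewrite /mix /mix_coords subr0 scale1r scale0r addr0 coordsK. Qed.

Lemma mix1 x y : mix x y 1 = y.
Proof. by rewrite /mix /mix_coords subrr scale1r scale0r add0r coordsK. Qed.

Lemma mix_same x r : mix x x r = x.
Proof. by rewrite /mix /mix_coords -scalerDl subrK scale1r coordsK. Qed.

Lemma mix_continuous (W : topologicalType) (A : set W) (f g : W -> X) (q : W -> R) :
  {within A, continuous f} -> {within A, continuous g} -> {within A, continuous q} ->
  (forall w, A w -> joinable (f w) (g w)) -> (forall w, A w -> 0 <= q w <= 1) ->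
  {within A, continuous (fun w => mix (f w) (g w) (q w))}.
Proof.
move=> cf cg cq jfg q01.
have ccoords h : {within A, continuous h} -> {within A, continuous (coords \o h)}.
  move=> ch; apply: (within_comp (B := setT) ch) => //.
  exact/continuous_subspaceT/coords_continuous.
apply: (@within_comp _ _ _ A polyhedron (fun w => mix_coords (f w) (g w) (q w)) tau _
  triangulation_map_continuous).
  move=> w; apply: cvgD.
    apply: cvgZ; last exact: ccoords.
    by apply: cvgB; [exact: cvg_cst|exact: cq].
  by apply: cvgZ; [exact: cq|exact: ccoords].
by move=> w Aw; apply: polyhedron_mix; [exact: jfg|exact: q01].
Qed.

End Coordinates.

(** * Strata *)

Section Strata.
Variables (R : realType) (d : nat) (X : manifold_with_defect R d).
Local Notation I := (`[(0 : R), 1]%classic).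
Implicit Types (x y z : X) (p q : R -> X) (a b t r : R).

Definition in_defect x : bool := `[< defect X x >].

Lemma in_defectP x : reflect (defect X x) (in_defect x).
Proof. exact: asboolP. Qed.

Lemma defect_closed : closed (defect X).
Proof. by apply: compact_closed; [exact: carrier_hausdorff|exact: defect_compact]. Qed.

Lemma near_bulk x : ~~ in_defect x -> \forall y \near x, ~~ in_defect y.
Proof.
move=> /in_defectP nx.
have : \forall y \near x, (~` defect X) y.
  by apply: open_nbhs_nbhs; split=> //; exact/closed_openC/defect_closed.
by apply: filterS => y ny; apply/in_defectP.
Qed.

Lemma stratum_in_defect x y : stratum x y -> in_defect y = in_defect x.
Proof.
rewrite /stratum /stratum_of -/(in_defect x).
by case: ifP => h /connected_component_sub => [/in_defectP|/= /in_defectP/negbTE].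
Qed.

Lemma stratum_sym x y : stratum x y -> stratum y x.
Proof.
move=> h; have := h; rewrite /stratum /stratum_of -/(in_defect x) -/(in_defect y).
by rewrite (stratum_in_defect h); exact: connected_component_sym.
Qed.

Lemma stratum_trans y x z : stratum x y -> stratum y z -> stratum x z.
Proof.
move=> h; have := h; rewrite /stratum /stratum_of -/(in_defect x) -/(in_defect y).
by rewrite (stratum_in_defect h); exact: connected_component_trans.
Qed.

Lemma stratum_eq x y : stratum x y -> stratum x = stratum y.
Proof.
by move=> h; apply/seteqP; split=> z; apply: stratum_trans => //; exact: stratum_sym.
Qed.

Lemma connected_stratum (A : set X) x y : connected A -> A x -> A y ->
  (forall z, A z -> in_defect z = in_defect x) -> stratum x y.
Proof.
move=> cA Ax Ay hA; rewrite /stratum /stratum_of -/(in_defect x).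
apply: (connected_component_max Ax) => // z /hA.
by case: (in_defect x) => /in_defectP.
Qed.

Lemma path_connected_image a b p (Y : set R) : {within `[a, b], continuous p} ->
  is_interval Y -> Y `<=` `[a, b]%classic -> connected (p @` Y).
Proof.
move=> cp iY Yab; apply: connected_continuous_connected.
  exact/connected_intervalP.
exact: within_sub Yab cp.
Qed.

Lemma is_interval_cc a b : is_interval `[a, b]%classic.
Proof. exact: interval_is_interval. Qed.

Lemma path_stratum a b p : {within `[a, b], continuous p} ->
  (forall t, a <= t <= b -> in_defect (p t) = in_defect (p a)) ->
  forall t u, a <= t <= b -> a <= u <= b -> stratum (p t) (p u).
Proof.
move=> cp hp t u tab uab.
apply: (@connected_stratum (p @` `[a, b]%classic)).
- by apply: path_connected_image cp _ _ => //; exact: is_interval_cc.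
- by exists t => //; rewrite /= in_itv.
- by exists u => //; rewrite /= in_itv.
- by move=> _ [v + <-]; rewrite /= in_itv /= => vab; rewrite !hp.
Qed.

Lemma single_stratum_directed p : {within I, continuous p} ->
  (forall t, 0 <= t <= 1 -> in_defect (p t) = in_defect (p 0)) -> directed_path p.
Proof.
move=> cp hp; apply/directedE; split => //.
apply: (@dir_on_step _ _ _ _ _ 1) => //; last exact: dir_on_nil.
left; split.
  apply: (@subspace_eq_continuous _ _ _ p) => // t _.
  by congr (p _); ring.
exists 1 => // t u; rewrite /= !in_itv /= => It Iu _ _; left.
by rewrite /path_restriction subr0 !mulr1 !add0r; exact: path_stratum.
Qed.

End Strata.

Section DefectCoordinates.
Variables (R : realType) (d : nat) (X : manifold_with_defect R d).
Variable T : directed_triangulation X.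
Local Notation I := (`[(0 : R), 1]%classic).
Local Notation m := (nvertices T).
Local Notation car := (carrier_simplex T).
Implicit Types (x y z : X) (p q : R -> X) (t r : R) (s : {set 'I_m}) (i j u v : 'I_m).

Lemma simplexP s x : s \in simplices T -> simplex s x <-> car x \subset s.
Proof.
move=> sK; split=> [[v /standard_simplexP[v0 v1 vs] <-]|xs].
  rewrite /carrier_simplex triangulation_mapK //.
  by exists s => //=; apply/standard_simplexP.
exists (coords T x); last exact: coordsK.
by apply/standard_simplexP; split=> //; [exact: coord_ge0|exact: coord_sum].
Qed.

Local Notation vpt := (@vertex_point _ _ X T).

Lemma coords_vertex v : coords T (vpt v) = delta_mx ord0 v.
Proof.
rewrite /vertex_point triangulation_mapK //; apply/polyhedronP; split.
- by move=> i; rewrite mxE eqxx /= ler0n.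
- rewrite (bigD1 v) //= big1 ?addr0 ?mxE ?eqxx // => i iv.
  by rewrite mxE eqxx /= (negbTE iv).
suff -> : support (delta_mx ord0 v : 'rV[R]_m) = [set v]%SET by exact: simplices1.
by apply/setP => i; rewrite !inE mxE eqxx /=; case: (i == v); rewrite ?oner_eq0 ?eqxx.
Qed.

Lemma carrier_vertex v : car (vpt v) = [set v]%SET.
Proof.
apply/setP => i; rewrite inE coords_vertex !inE mxE eqxx /=.
by case: (i == v); rewrite ?oner_eq0 ?eqxx.
Qed.

Lemma joinable_vertex x v : v \in car x -> joinable T x (vpt v).
Proof.
move=> vx; apply/joinable_sym/joinable_subset.
by rewrite carrier_vertex finset.sub1set.
Qed.

Lemma joinable_vertices u v : joinable T (vpt u) (vpt v) = ([set u; v]%SET \in simplices T).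
Proof. by rewrite /joinable !carrier_vertex. Qed.

Lemma edge_pathE u v t : edge_path u v t = mix T (vpt u) (vpt v) t.
Proof. by rewrite /mix /mix_coords !coords_vertex. Qed.

(** A simplex meets the defect in the empty set or in a face, so a simplex whose vertices
    lie in the defect lies in the defect. *)
Lemma in_defectE x : in_defect x = [forall i in car x, in_defect (vpt i)].
Proof.
have [[L [LK Lcplx defL]] _ flag] := underlying_flag_like T.
apply/in_defectP/forall_inP => [|hx].
  rewrite defL => -[s /= sL].
  have sK := fintype.subsetP LK _ sL.
  move=> /(simplexP _ sK) xs i ix; apply/in_defectP; rewrite defL; exists s => //=.
  by apply/(simplexP _ sK); rewrite carrier_vertex finset.sub1set (fintype.subsetP xs).
have xK := carrier_in T x.
case: (flag _ xK) => [e|[t [tK tx e]]].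
  have [i ix] := carrier_neq0 T x.
  have : (simplex (car x) `&` defect X) (vpt i).
    split; last exact/in_defectP/hx.
    by apply/(simplexP _ xK); rewrite carrier_vertex finset.sub1set.
  by rewrite e.
suff : (simplex (car x) `&` defect X) x by case.
rewrite e; apply/(simplexP _ tK)/fintype.subsetP => i ix.
have : (simplex (car x) `&` defect X) (vpt i).
  split; last exact/in_defectP/hx.
  by apply/(simplexP _ xK); rewrite carrier_vertex finset.sub1set.
by rewrite e => /(simplexP _ tK); rewrite carrier_vertex finset.sub1set.
Qed.

Lemma carrier_in_defect x i : in_defect x -> i \in car x -> in_defect (vpt i).
Proof. by rewrite in_defectE => /forall_inP; exact. Qed.

Lemma bulk_carrier x : ~~ in_defect x -> exists2 i, i \in car x & ~~ in_defect (vpt i).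
Proof. by rewrite in_defectE negb_forall_in => /exists_inP[i ix ni]; exists i. Qed.

Lemma carrier_bulk x i : i \in car x -> ~~ in_defect (vpt i) -> ~~ in_defect x.
Proof. by move=> ix ni; apply: contra ni => /carrier_in_defect; exact. Qed.

Lemma in_defect_mix x y r : joinable T x y -> 0 <= r <= 1 ->
  in_defect (mix T x y r) = ((r == 1) || in_defect x) && ((r == 0) || in_defect y).
Proof.
move=> jxy r01; rewrite !in_defectE carrier_mix //.
apply/forall_inP/andP => [h|[hx hy] i].
  split.
    have [//|rn] := eqVneq r 1; apply/forall_inP => i ix.
    by apply: h; rewrite (negbTE rn) inE ix.
  have [//|rn] := eqVneq r 0; apply/forall_inP => i iy.
  by apply: h; rewrite (negbTE rn) inE iy orbT.
rewrite inE; case/orP.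
  case: eqVneq hx => [_ _|_ /forall_inP]; [by rewrite inE|exact].
case: eqVneq hy => [_ _|_ /forall_inP]; [by rewrite inE|exact].
Qed.

Lemma exists_nearby_vertex x : exists i, i \in car x /\ in_defect (vpt i) = in_defect x.
Proof.
have [hx|hx] := boolP (in_defect x).
  by have [i ix] := carrier_neq0 T x; exists i; rewrite (carrier_in_defect hx).
by have [i ix /negbTE ni] := bulk_carrier hx; exists i.
Qed.

(** Points are moved to this vertex to compare them with the triangulation; the segment to
    it stays in the stratum. *)
Definition nearby_vertex x : 'I_m := projT1 (cid (exists_nearby_vertex x)).
Local Notation vtx := nearby_vertex.

Lemma nearby_vertex_in x : vtx x \in car x.
Proof. by rewrite /nearby_vertex; case: cid => i []. Qed.

Lemma nearby_vertex_in_defect x : in_defect (vpt (vtx x)) = in_defect x.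
Proof. by rewrite /nearby_vertex; case: cid => i []. Qed.

Lemma nearby_vertexK v : vtx (vpt v) = v.
Proof.
by have := nearby_vertex_in (vpt v); rewrite carrier_vertex inE => /eqP.
Qed.

Lemma mix_path_continuous x y : joinable T x y -> {within I, continuous (mix T x y)}.
Proof.
move=> jxy; apply: mix_continuous => //.
- by apply: continuous_subspaceT; exact: cst_continuous.
- by apply: continuous_subspaceT; exact: cst_continuous.
- by apply: continuous_subspaceT => ?; exact: cvg_id.
Qed.

Lemma in_defect_mix_same x y r : joinable T x y -> in_defect x = in_defect y -> 0 <= r <= 1 ->
  in_defect (mix T x y r) = in_defect y.
Proof.
move=> jxy xy r01; rewrite in_defect_mix // xy.
case: (in_defect y); rewrite ?orbT // !orbF.
by have [->|//] := eqVneq r 1; rewrite oner_eq0.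
Qed.

Lemma mix_stratum x y r : joinable T x y -> in_defect x = in_defect y -> 0 <= r <= 1 ->
  stratum x (mix T x y r).
Proof.
move=> jxy xy r01; rewrite -{1}(mix0 T x y).
apply: (@path_stratum _ _ _ 0 1 _ (mix_path_continuous jxy)) => //.
  by move=> t t01; rewrite !in_defect_mix_same ?lexx ?ler01.
by rewrite lexx ler01.
Qed.

Lemma joinable_stratum x y : joinable T x y -> in_defect x = in_defect y -> stratum x y.
Proof. by move=> jxy xy; rewrite -[X in stratum _ X](mix1 T x y); apply: mix_stratum; rewrite ?ler01 ?lexx. Qed.

Lemma nearby_vertex_stratum x : stratum x (vpt (vtx x)).
Proof.
apply: joinable_stratum; first exact/joinable_vertex/nearby_vertex_in.
by rewrite nearby_vertex_in_defect.
Qed.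

(** Points of the open star of z in the stratum of z are joined to z by a segment in that
    stratum, so the points reached from x by paths form an open and closed part of its
    stratum. *)
Lemma stratum_path x y : stratum x y -> exists p : R -> X,
  [/\ {within I, continuous p}, p 0 = x, p 1 = y &
      forall t, 0 <= t <= 1 -> in_defect (p t) = in_defect x].
Proof.
pose reach := [set z | exists p : R -> X,
  [/\ {within I, continuous p}, p 0 = x, p 1 = z &
      forall t, 0 <= t <= 1 -> in_defect (p t) = in_defect x]].
have join z w : reach z -> joinable T z w -> in_defect z = in_defect w -> reach w.
  move=> [p [cp p0 p1 hp]] jzw zw.
  exists (path_concat p (mix T z w)); split.
  - have dp : directed_path p by apply: single_stratum_directed => // t /hp ->; rewrite p0.
    have dm : directed_path (mix T z w).
      apply: single_stratum_directed; first exact: mix_path_continuous.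
      by move=> t t01; rewrite !in_defect_mix_same ?lexx ?ler01.
    by case: (directed_concat dp dm) => //; rewrite mix0.
  - by rewrite /path_concat invr_ge0 ler0n mulr0.
  - rewrite /path_concat (_ : (1 <= 2^-1 :> R) = false); last by apply/negbTE; lin.
    by rewrite (_ : 2 * 1 - 1 = 1 :> R) ?mix1 //; ring.
  - move=> t t01; rewrite /path_concat; case: leP => t2; first by apply: hp; lin.
    rewrite in_defect_mix_same //; last by lin.
    by rewrite -zw -p1 hp // ler01 lexx.
have near_join z : \forall w \near z, joinable T z w.
  by move: (near_carrier T z); apply: filterS => w; exact: joinable_subset.
pose same (w : X) := in_defect w = in_defect x.
have reach_sub z : reach z -> stratum x z.
  move=> [p [cp p0 p1 hp]]; rewrite -p0 -p1.
  apply: (@path_stratum _ _ _ 0 1) => //; rewrite ?lexx ?ler01 //.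
  by move=> t t01; rewrite !hp ?lexx ?ler01.
have reach_x : reach x.
  by exists (fun=> x); split=> //; apply: continuous_subspaceT; exact: cst_continuous.
have same_sub z : stratum x z -> same z by exact: stratum_in_defect.
suff -> : stratum x = reach by [].
have cx : connected (stratum x) by exact: component_connected.
apply/esym/cx; first by exists x.
- exists (interior [set w | same w -> reach w]); first exact: open_interior.
  apply/seteqP; split=> z.
    move=> rz; split; first exact: reach_sub.
    move: (near_join z); apply: filterS => w jzw sw; apply: join jzw _ => //.
    by rewrite sw; exact/same_sub/reach_sub.
  by move=> [/same_sub sz /interior_subset]; exact.
- exists (~` interior [set w | same w -> ~ reach w]).
    exact/open_closedC/open_interior.
  apply/seteqP; split=> z.
    move=> rz; split; first exact: reach_sub.
    by move=> /interior_subset /(_ (same_sub _ (reach_sub _ rz))).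
  move=> [sz nz]; apply: contrapT => nrz; apply: nz.
  move: (near_join z); apply: filterS => w jzw sw rw; apply: nrz.
  by apply: join (joinable_sym jzw) _ => //; rewrite sw; apply/esym/same_sub.
Qed.

End DefectCoordinates.

(** * The two sides of the defect *)

Section Sides.
Variables (R : realType) (d : nat) (X : manifold_with_defect R d).
Local Notation I := (`[(0 : R), 1]%classic).
Implicit Types (x y z : X) (p q : R -> X) (a b t r : R) (c : bool).

Definition side c y : set X :=
  if c then positive_side (stratum y) else negative_side (stratum y).

Definition tube y : set X := collar X @` (stratum y `*` `](-1 : R), 1[%classic).

Lemma tube_open y : in_defect y -> open (tube y).
Proof. by move=> /in_defectP /collarP[]. Qed.

Lemma stratum_tube y z : in_defect y -> stratum y z -> tube y z.
Proof.
move=> yD yz; exists (z, 0) => /=.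
  by split=> //=; rewrite in_itv /= oppr_lt0 ltr01.
by apply/collar0/in_defectP; rewrite (stratum_in_defect yz).
Qed.

Lemma side_tube c y : side c y `<=` tube y.
Proof.
by rewrite /side; case: c => z [[w r] [yw /=]]; rewrite in_itv /= => /andP[r1 r2] <-;
  exists (w, r) => //; split=> //=; rewrite in_itv /=; lin.
Qed.

Lemma tube_stratum y z : in_defect y -> tube y z -> in_defect z -> stratum y z.
Proof.
move=> /in_defectP yD Uz /in_defectP zD; have [_ _ _ /(_ z Uz)] := collarP yD.
by case=> [//|[]].
Qed.

Lemma side_bulk c y z : in_defect y -> side c y z -> ~~ in_defect z.
Proof.
move=> yD sz; apply/negP => zD.
have yz := tube_stratum yD (side_tube sz) zD.
have [[g [_ _ gK _]] _ _ _] := collarP (elimT (in_defectP y) yD).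
have zz : (stratum y `*` `](-1 : R), 1[) (z, 0).
  by split=> //=; rewrite in_itv /= oppr_lt0 ltr01.
have [_ g0] := gK _ zz; rewrite collar0 in g0; last exact/in_defectP.
have [r [w [yw rn0 r1 wz]]] : exists r w, [/\ stratum y w, r != 0, -1 < r < 1 &
    collar X (w, r) = z].
  move: sz; rewrite /side; case: c => -[[w r] [yw /=]]; rewrite in_itv /= => /andP[r1 r2] wz;
  by exists r, w; split=> //; [apply/negP => /eqP|]; lin.
have ww : (stratum y `*` `](-1 : R), 1[) (w, r) by split=> //=; rewrite in_itv.
have [_] := gK _ ww; rewrite wz g0 => -[_ r0].
by rewrite -r0 eqxx in rn0.
Qed.

Lemma tube_sides y z : in_defect y -> tube y z -> ~~ in_defect z -> exists c, side c y z.
Proof.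
move=> yD [[w r] [/= yw]]; rewrite in_itv /= => /andP[r1 r2] <- nz.
have [rlt|rgt|re] := ltgtP r 0.
- by exists true; exists (w, r) => //; split=> //=; rewrite in_itv /= r1 rlt.
- by exists false; exists (w, r) => //; split=> //=; rewrite in_itv /= r2 rgt.
- case/negP: nz; rewrite re collar0; last first.
    by apply/in_defectP; rewrite (stratum_in_defect yw).
  by rewrite (stratum_in_defect yw).
Qed.

(** On the tube, the sign of the collar coordinate decides the side, and the coordinate is
    continuous there. *)
Lemma side_open c y : in_defect y -> open (side c y).
Proof.
move=> yD; have [[g [_ cg gK Kg]] oU _ _] := collarP (elimT (in_defectP y) yD).
have gside z : tube y z -> (side c y z <-> if c then (g z).2 < 0 else 0 < (g z).2).
  move=> Uz; have [/= gz gzK] := Kg _ Uz; case: gz => yg; rewrite /= in_itv /= => /andP[h1 h2].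
  split; last first.
    by rewrite /side; case: c => h; exists (g z) => //; split=> //=; rewrite in_itv /= ?h1 ?h2 h.
  rewrite /side; case: c => -[[w r] [yw /=]]; rewrite in_itv /= => /andP[r1 r2] wz;
  (have [|_] := gK (w, r); first by split=> //=; rewrite in_itv /=; lin);
  by rewrite -wz => ->.
rewrite openE => z sz; have Uz := side_tube sz.
pose A := [set v : X * R | if c then v.2 < 0 else 0 < v.2].
have oA : open A.
  rewrite /A; case: c {gside sz A} => /=.
    rewrite (_ : [set v : X * R | v.2 < 0] = snd @^-1` [set r : R | r < 0]) //.
    by apply: open_comp => [v _|]; [exact: cvg_snd|exact: open_lt].
  rewrite (_ : [set v : X * R | 0 < v.2] = snd @^-1` [set r : R | 0 < r]) //.
  by apply: open_comp => [v _|]; [exact: cvg_snd|exact: open_gt].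
have /subspace_continuousP/(_ z Uz A) := cg.
rewrite /nbhs /= /within /= => h.
have nA : nbhs (g z) A by apply: open_nbhs_nbhs; split=> //; exact/gside.
have nU : nbhs z (tube y) by apply: open_nbhs_nbhs; split.
by move: (h nA) nU; apply: filterS2 => w hw Uw; apply/gside => //; exact: hw.
Qed.

Lemma side_disjoint y z : in_defect y -> side true y z -> side false y z -> False.
Proof.
move=> yD sp sn.
have [[g [_ _ gK _]] _ _ _] := collarP (elimT (in_defectP y) yD).
move: sp sn; rewrite /side => -[[w r] [/= yw]]; rewrite in_itv /= => /andP[r1 r2] wz.
move=> [[w' r'] [/= yw']]; rewrite in_itv /= => /andP[r1' r2'] wz'.
have [|_ g1] := gK (w, r); first by split=> //=; rewrite in_itv /=; lin.
have [|_ g2] := gK (w', r'); first by split=> //=; rewrite in_itv /=; lin.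
by move: g1 g2; rewrite wz wz' => -> [_ e]; lin.
Qed.

Lemma connected_side c y (A : set X) z z' : in_defect y -> connected A -> A `<=` tube y ->
  (forall w, A w -> ~~ in_defect w) -> A z -> A z' -> side c y z -> side c y z'.
Proof.
move=> yD cA AU nA Az Az' sz.
suff e : A `&` side c y = A by have [] : (A `&` side c y) z' by rewrite e.
have cover w : A w -> side c y w \/ side (~~ c) y w.
  move=> Aw; have [c' h] := tube_sides yD (AU _ Aw) (nA _ Aw).
  by case: (eqVneq c c') => [->|cc']; [left|right; rewrite (_ : ~~ c = c') //;
    case: (c) (c') cc' => -[]].
have disj w : side c y w -> side (~~ c) y w -> False.
  by case: (c) => h1 h2; exact: (side_disjoint yD) h1 h2 || exact: (side_disjoint yD) h2 h1.
apply: cA; first by exists z.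
- by exists (side c y) => //; exact: side_open.
- exists (~` side (~~ c) y); first exact/open_closedC/side_open.
  apply/seteqP; split=> w [Aw sw]; split=> //; first by move=> /(disj _ sw).
  by have [//|] := cover _ Aw.
Qed.

(** A continuous family of compact arcs stays in an open set if it starts there. *)
Lemma tube_lemma (S : topologicalType) (A : set S) (f : R * S -> X) (U : set X) s0 :
  open U -> {within I `*` A, continuous f} -> A s0 -> (forall t, I t -> U (f (t, s0))) ->
  \forall s \near s0, A s -> forall t, I t -> U (f (t, s)).
Proof.
move=> oU cf As0 hU.
have /compact_near_coveringP := @segment_compact R 0 1.
move=> /(_ _ (nbhs s0) (fun s t => I t -> A s -> U (f (t, s))) _) h.
have : \forall s \near s0, I `<=` (fun t => I t -> A s -> U (f (t, s))).
  apply: h => t It.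
  have /subspace_continuousP/(_ (t, s0) (conj It As0) U) := cf.
  rewrite /nbhs /= /within /= => /(_ _)[].
    by apply: open_nbhs_nbhs; split=> //; exact: hU.
  move=> B hB BU; exists B => // -[w1 w2] Bw Iw Aw; exact: (BU _ Bw (conj Iw Aw)).
by apply: filterS => s hs As t It; apply: hs.
Qed.

Lemma piece_window p a b : a < b -> piece p a b -> exists2 e, 0 < e &
  (forall x y : R, a <= x -> x <= y -> y <= b -> y - x < e -> prec_plus (p x) (p y)) \/
  (forall x y : R, a <= x -> x <= y -> y <= b -> y - x < e -> prec_minus (p x) (p y)).
Proof.
move=> ab pc.
have main prec : locally_increasing prec (path_restriction p a b) -> exists2 e, 0 < e &
    forall x y : R, a <= x -> x <= y -> y <= b -> y - x < e -> prec (p x) (p y).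
  move=> [_ [e e0 he]]; exists (e * (b - a)); first by rewrite mulr_gt0 // subr_gt0.
  move=> x y ax xy yb yx.
  have re u : path_restriction p a b ((u - a) / (b - a)) = p u.
    by rewrite /path_restriction divfK ?subrKC // subr_eq0 gt_eqF.
  have ba : 0 < b - a by lin.
  rewrite -(re x) -(re y); apply: he.
  - by rewrite /= in_itv /= divr_ge0 ?ler_pdivrMr ?mul1r; lin.
  - by rewrite /= in_itv /= divr_ge0 ?ler_pdivrMr ?mul1r; lin.
  - by rewrite ler_pM2r ?invr_gt0 //; lin.
  rewrite -mulrBl normrM (gtr0_norm (_ : 0 < (b - a)^-1)) ?invr_gt0 // ltr_pdivrMr //.
  by rewrite ltr_norml; lin.
by case: pc => /main[e e0 he]; exists e => //; [left|right].
Qed.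

Lemma dir_on_left p a b t : dir_on p a b -> a < t -> t <= b -> exists2 e, 0 < e &
  (forall x y : R, a <= x -> t - e < x -> x <= y -> y <= t -> prec_plus (p x) (p y)) \/
  (forall x y : R, a <= x -> t - e < x -> x <= y -> y <= t -> prec_minus (p x) (p y)).
Proof.
elim=> [u ut tu|u v w uv pc vw IH ut tw]; first by lin.
have [tv|vt] := leP t v.
  have uv' : u < v by lin.
  have [e e0 he] := piece_window uv' pc; exists e => //.
  by case: he => he; [left|right] => x y *; apply: he; lin.
have [e e0 he] := IH vt tw; have tv0 : 0 < t - v by rewrite subr_gt0.
have [k [k0 ke kt]] := exists_smaller e0 tv0; exists k => //.
by case: he => he; [left|right] => x y *; apply: he; lin.
Qed.

Lemma dir_on_right p a b t : dir_on p a b -> a <= t -> t < b -> exists2 e, 0 < e &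
  (forall x y : R, t <= x -> x <= y -> y < t + e -> y <= b -> prec_plus (p x) (p y)) \/
  (forall x y : R, t <= x -> x <= y -> y < t + e -> y <= b -> prec_minus (p x) (p y)).
Proof.
elim=> [u ut tu|u v w uv pc vw IH ut tw]; first by lin.
have [vt|tv] := leP v t; first exact: IH.
have uv' : u < v by lin.
have [e e0 he] := piece_window uv' pc.
have tv0 : 0 < v - t by rewrite subr_gt0.
have [k [k0 ke kt]] := exists_smaller e0 tv0; exists k => //.
by case: he => he; [left|right] => x y *; apply: he; lin.
Qed.

End Sides.

(** * A combinatorial description of directed paths *)

Section Facing.
Variables (R : realType) (d : nat) (X : manifold_with_defect R d).
Variable T : directed_triangulation X.
Local Notation I := (`[(0 : R), 1]%classic).
Local Notation car := (carrier_simplex T).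
Local Notation vpt := (@vertex_point _ _ X T).
Local Notation dv i := (in_defect (vpt i)).
Implicit Types (x y z : X) (p q : R -> X) (a b t r : R) (c : bool).
Implicit Types (i j u w : 'I_(nvertices T)).

(** For u in the bulk and w in the defect, c tells whether the edge leads into the defect or
    out of it. *)
Definition leads c u w : bool := if c then edge_dir u w else edge_dir w u.

Lemma leads_total c u w : u != w -> [set u; w]%SET \in simplices T ->
  leads c u w (+) leads (~~ c) u w.
Proof. by move=> uw /(edge_dir_total uw); case: c => //=; rewrite addbC. Qed.

Lemma mix_sym x y r : mix T x y r = mix T y x (1 - r).
Proof. by rewrite /mix /mix_coords subKr addrC. Qed.

Lemma edge_directed i j : edge_dir i j -> directed_path (mix T (vpt i) (vpt j)).
Proof.
move=> eij; have [_ ijK] := edge_dirP eij.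
have [same|ij] := eqVneq (dv i) (dv j).
  apply: single_stratum_directed; first by apply: mix_path_continuous; rewrite joinable_vertices.
  by move=> t t01; rewrite !in_defect_mix_same ?joinable_vertices ?lexx ?ler01.
apply: (@directed_path_ext _ _ _ (edge_path i j)) => [t _|]; first exact: edge_pathE.
apply: edge_dir_directed eij _ => /(_ (vpt j)) h; case/eqP: ij.
apply/esym/stratum_in_defect/h/(simplexP _ ijK).
by rewrite carrier_vertex finset.sub1set !inE eqxx orbT.
Qed.

(** A mixed edge is a directed path, so its last bulk points lie on the positive side when
    it enters the defect and on the negative side when it leaves it. *)
Lemma edge_leads_side c u w : leads c u w -> ~~ dv u -> dv w ->
  exists2 e, 0 < e & forall r, 1 - e < r -> r < 1 -> 0 <= r ->
    side c (vpt w) (mix T (vpt u) (vpt w) r).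
Proof.
move=> cuw nu dw.
have sD D : defect_strata X D -> D (vpt w) -> D = stratum (vpt w).
  by move=> [z zD <-] /stratum_eq.
move: cuw; rewrite /leads; case: c => euw.
  have [_ juw] := edge_dirP euw; rewrite -joinable_vertices in juw.
  have nm r : r < 1 -> 0 <= r -> ~~ in_defect (mix T (vpt u) (vpt w) r).
    by move=> r1 r0; rewrite in_defect_mix ?r0 ?ltW // (negbTE nu) (lt_eqF r1).
  have /directedE[_ dp] := edge_directed euw.
  have [e e0 he] := dir_on_left dp ltr01 (lexx 1); exists e => // r r1 rlt r0.
  have {he} : prec_plus (mix T (vpt u) (vpt w) r) (mix T (vpt u) (vpt w) 1) \/
         prec_minus (mix T (vpt u) (vpt w) r) (mix T (vpt u) (vpt w) 1).
    by case: he => he; [left|right]; apply: he; lin.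
  have nst : ~ stratum (mix T (vpt u) (vpt w) r) (mix T (vpt u) (vpt w) 1).
    by move=> /stratum_in_defect; rewrite (negbTE (nm _ rlt r0)) mix1 dw.
  case=> -[//|[D DS []]]; rewrite mix1.
    by move=> h Dw; rewrite /side -(sD D).
  move=> Dr; have [z zD zE] := DS; move: Dr; rewrite -zE => /stratum_in_defect.
  by rewrite (negbTE (nm _ rlt r0)) => /esym/in_defectP.
have [_ juw] := edge_dirP euw; rewrite -joinable_vertices in juw.
have nm r : 0 < r -> r <= 1 -> ~~ in_defect (mix T (vpt w) (vpt u) r).
  by move=> r0 r1; rewrite in_defect_mix ?r1 ?ltW // (negbTE nu) (gt_eqF r0) andbF.
have /directedE[_ dp] := edge_directed euw.
have [e e0 he] := dir_on_right dp (lexx 0) ltr01; exists e => // r r1 rlt r0.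
have {he} : prec_plus (mix T (vpt w) (vpt u) 0) (mix T (vpt w) (vpt u) (1 - r)) \/
       prec_minus (mix T (vpt w) (vpt u) 0) (mix T (vpt w) (vpt u) (1 - r)).
  by case: he => he; [left|right]; apply: he; lin.
rewrite -mix_sym mix0.
have nr : ~~ in_defect (mix T (vpt u) (vpt w) r) by rewrite mix_sym; apply: nm; lin.
have nst : ~ stratum (vpt w) (mix T (vpt u) (vpt w) r).
  by move=> /stratum_in_defect; rewrite (negbTE nr) dw.
case=> -[//|[D DS []]]; last by move=> Dw; rewrite /side -(sD D).
move=> _ Dr; have [z zD zE] := DS; move: Dr; rewrite -zE => /stratum_in_defect.
by rewrite (negbTE nr) => /esym/in_defectP.
Qed.

Lemma near_segment_tube y w : in_defect y -> w \in car y ->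
  \forall x \near y, w \in car x -> forall t, I t -> tube y (mix T x (vpt w) t).
Proof.
move=> yD wy.
pose A := [set x | w \in car x].
pose f (v : R * X) := mix T v.2 (vpt w) v.1.
suff : \forall x \near y, A x -> forall t, I t -> tube y (f (t, x)) by [].
apply: tube_lemma => //.
- exact: tube_open.
- apply: mix_continuous.
  + by apply: continuous_subspaceT => v; exact: cvg_snd.
  + by apply: continuous_subspaceT; exact: cst_continuous.
  + by apply: continuous_subspaceT => v; exact: cvg_fst.
  + by move=> v [_ /= /joinable_vertex].
  + by move=> v [] /=; rewrite in_itv.
- move=> t /=; rewrite in_itv /= => It; apply: stratum_tube => //.
  apply: mix_stratum => //; first exact: joinable_vertex.
  by rewrite yD (carrier_in_defect yD).
Qed.

(** Pushing x towards a vertex w of the carrier of y, and then the carrier of x towards w,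
    does not leave the side on which x lies, and by [edge_leads_side] the end of the edge
    from u to w lies on the side that corresponds to its direction. *)
Lemma side_leads y : in_defect y -> \forall x \near y, forall c, side c y x ->
  forall u w, u \in car x -> ~~ dv u -> w \in car y -> leads c u w.
Proof.
move=> yD.
have : \forall x \near y, forall w, w \in car y ->
    w \in car x /\ forall t, I t -> tube y (mix T x (vpt w) t).
  apply: filter_forall => w; have [wy|nwy] := boolP (w \in car y); last exact: nearW.
  move: (near_in_carrier wy) (near_segment_tube yD wy).
  by apply: filterS2 => x wx h _; split=> //; exact: h.
apply: filterS => x hx c sx u w ux nu wy.
have [wx segU] := hx w wy.
have xn := side_bulk yD sx.
have jxw := joinable_vertex wx; have jxu := joinable_vertex ux.
have dw := carrier_in_defect yD wy.
have yw : stratum y (vpt w).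
  by apply: joinable_stratum (joinable_vertex wy) _; rewrite yD.
have toward t : 0 <= t -> t < 1 -> side c y (mix T x (vpt w) t).
  move=> t0 t1.
  apply: (@connected_side _ _ _ c y (mix T x (vpt w) @` `[0, t]%classic) x) => //.
  - apply: path_connected_image (mix_path_continuous jxw) _ _.
      exact: is_interval_cc.
    by move=> v /=; rewrite !in_itv /=; lin.
  - by move=> _ [v + <-]; rewrite /= in_itv /= => ?; apply: segU; rewrite /= in_itv /=; lin.
  - move=> _ [v + <-]; rewrite /= in_itv /= => ?.
    by rewrite in_defect_mix //; [rewrite (negbTE xn) (lt_eqF (_ : v < 1)) //|]; lin.
  - by exists 0; rewrite ?mix0 //= in_itv /= lexx.
  - by exists t => //=; rewrite in_itv /= lexx t0.
(* the segment from x to u, coned towards w *)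
pose f (v : R * R) := mix T (mix T x (vpt u) v.1) (vpt w) v.2.
have jf r : 0 <= r <= 1 -> joinable T (mix T x (vpt u) r) (vpt w).
  move=> r01; apply: (joinable_sub (carrier_in T x)).
    apply: (fintype.subset_trans (carrier_mix_sub jxu r01)).
    by rewrite finset.subUset carrier_vertex finset.sub1set fintype.subxx.
  by rewrite carrier_vertex finset.sub1set.
have cf : {within I `*` I, continuous f}.
  apply: mix_continuous.
  - apply: mix_continuous.
    + by apply: continuous_subspaceT; exact: cst_continuous.
    + by apply: continuous_subspaceT; exact: cst_continuous.
    + by apply: continuous_subspaceT => v; exact: cvg_fst.
    + by [].
    + by move=> v [] /=; rewrite in_itv.
  - by apply: continuous_subspaceT; exact: cst_continuous.
  - by apply: continuous_subspaceT => v; exact: cvg_snd.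
  - by move=> v [] /=; rewrite in_itv => h _; exact: jf.
  - by move=> v [_] /=; rewrite in_itv.
have I1 : I 1 by rewrite /= in_itv /= ler01 lexx.
have : \forall s \near (1 : R), I s -> forall t, I t -> tube y (f (t, s)).
  apply: tube_lemma cf I1 _; first exact: tube_open.
  by move=> t _; rewrite /f mix1; exact: stratum_tube.
move=> /nbhs_ballP[e /= e0 he].
have side_u s : 1 - e < s -> s < 1 -> 0 <= s -> side c y (mix T (vpt u) (vpt w) s).
  move=> s1 slt s0.
  have Is : I s by rewrite /= in_itv /= s0 ltW.
  have {}he : forall t, I t -> tube y (f (t, s)).
    by apply: he => //; rewrite /ball /= ltr_norml; apply/andP; split; lin.
  pose g t := f (t, s).
  apply: (@connected_side _ _ _ c y (g @` I) (mix T x (vpt w) s)) => //.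
  - apply: (path_connected_image _ (@is_interval_cc R 0 1)) => //.
    apply: (@within_comp _ _ _ I (I `*` I) (fun t => (t, s)) f) => //.
    by apply: within_pair; apply: continuous_subspaceT => t; [exact: cvg_id|exact: cvg_cst].
    exact: subset_refl.
  - by move=> _ [t It <-]; exact: (he t It).
  - move=> _ [t + <-]; rewrite /= in_itv /= => It; have s01 : 0 <= s <= 1 by lin.
    rewrite /g /f /= in_defect_mix ?jf //.
    rewrite (lt_eqF slt) in_defect_mix //= (negbTE xn) (negbTE nu) !orbF.
    by have [->|] := eqVneq t 1; rewrite ?oner_eq0.
  - by exists 0; rewrite /g /f ?mix0 //= in_itv /= lexx ler01.
  - by exists 1; rewrite /g /f ?mix1.
  - exact: toward.
have uw : u != w by apply: contraNneq nu => ->.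
have uwK := simplex_edge (carrier_in T x) ux wx.
apply: contraT => ncuw; exfalso.
have cuw : leads (~~ c) u w by move: (leads_total c uw uwK); rewrite (negbTE ncuw).
have [e' e'0 he'] := edge_leads_side cuw nu dw.
have [k [k0 ke ke']] := exists_smaller e0 e'0.
have [s [h1 h2 sk]] := exists_before (@ltr01 R) k0.
have h3 : 1 - e < s by rewrite ltrBlDr -ltrBlDl (lt_le_trans sk).
have h4 : 1 - e' < s by rewrite ltrBlDr -ltrBlDl (lt_le_trans sk).
have s1 := side_u s h3 h2 h1; have := he' s h4 h2 h1.
rewrite /side -(stratum_eq yw) -/(side _ _) => s2.
by move: s1 s2; case: (c) => s1 s2; [exact: side_disjoint yD s1 s2|exact: side_disjoint yD s2 s1].
Qed.

End Facing.

Section DirectedCriterion.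
Variables (R : realType) (d : nat) (X : manifold_with_defect R d).
Variable T : directed_triangulation X.
Local Notation I := (`[(0 : R), 1]%classic).
Local Notation car := (carrier_simplex T).
Local Notation vpt := (@vertex_point _ _ X T).
Local Notation dv i := (in_defect (vpt i)).
Implicit Types (x y z : X) (p q : R -> X) (a b t r : R) (c : bool).
Implicit Types (i j u v w : 'I_(nvertices T)).

Lemma leads_exclusive c u w : leads c u w -> leads (~~ c) u w -> False.
Proof.
move=> h1 h2.
have [uw uwK] : u != w /\ [set u; w]%SET \in simplices T.
  move: h1; rewrite /leads; case: (c) => /edge_dirP[//].
  by rewrite eq_sym finset.setUC.
by have := leads_total c uw uwK; rewrite h1 h2.
Qed.

(** A point of the simplex close to the middle y of w and w', in the direction of the middle
    of u and u', lies on one side of the defect, and by [side_leads] that side determines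
    the direction of both edges. *)
Lemma simplex_leads c s u u' w w' : s \in simplices T ->
  u \in s -> u' \in s -> w \in s -> w' \in s -> ~~ dv u -> ~~ dv u' -> dv w -> dv w' ->
  leads c u w -> leads c u' w'.
Proof.
move=> sK us us' ws ws' nu nu' dw dw' cuw.
have half01 : 0 <= (2^-1 : R) <= 1 by lin.
have half_neq : (2^-1 == 1 :> R) = false /\ (2^-1 == 0 :> R) = false.
  by split; apply/negbTE/eqP; lin.
have jv i j : i \in s -> j \in s -> joinable T (vpt i) (vpt j).
  by move=> is_ js; apply: (joinable_sub sK); rewrite carrier_vertex finset.sub1set.
have car_half i j : i \in s -> j \in s -> car (mix T (vpt i) (vpt j) 2^-1) = [set i; j]%SET.
  move=> is_ js; rewrite carrier_mix ?jv //.
  by rewrite (proj1 half_neq) (proj2 half_neq) !carrier_vertex.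
pose y := mix T (vpt w) (vpt w') 2^-1.
pose z := mix T (vpt u) (vpt u') 2^-1.
have cy : car y = [set w; w']%SET by exact: car_half.
have cz : car z = [set u; u']%SET by exact: car_half.
have yD : in_defect y.
  by rewrite (in_defectE T) cy; apply/forall_inP => i; rewrite finset.in_set2 => /orP[] /eqP->.
have jyz : joinable T y z.
  apply: (joinable_sub sK); [rewrite cy|rewrite cz];
  by apply/fintype.subsetP => i; rewrite finset.in_set2 => /orP[] /eqP->.
have nU : nbhs y (tube y).
  apply: open_nbhs_nbhs; split; [exact: tube_open|].
  by apply: stratum_tube => //; exact: stratum_refl.
have I0 : (0 : R) <= 1 by lin.
have := within_near_in (mix_path_continuous jyz) (lexx 0) I0.
rewrite mix0 => near_y.
have [e e0 he] := near_inI (near_y _ nU) (near_y _ (side_leads T yD)).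
have [r [r0 r1 re]] := exists_after (@ltr01 R) e0.
have re' : `|r - 0| < e by rewrite gtr0_norm ?subr0 // -[r]subr0.
have := he r (ltW r0) (ltW r1) re'.
have r01 : 0 <= r <= 1 by rewrite !ltW.
have xn : ~~ in_defect (mix T y z r).
  rewrite in_defect_mix // (gt_eqF r0) /= negb_and; apply/orP; right.
  by apply: (@carrier_bulk _ _ _ T _ u) => //; rewrite cz !inE eqxx.
have uz i : i \in car z -> i \in car (mix T y z r).
  by move=> iz; rewrite carrier_mix // (gt_eqF r0) inE iz orbT.
move=> [/(tube_sides yD) /(_ xn) [c' sx] /(_ _ sx) hl].
have cuw' : leads c' u w.
  by apply: hl => //; [apply: uz; rewrite cz|rewrite cy]; rewrite finset.in_set2 eqxx.
have -> : c = c'.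
  have [//|ne] := eqVneq c c'; exfalso; apply: (leads_exclusive cuw).
  by rewrite (_ : ~~ c = c') //; case: (c) (c') ne => -[].
by apply: hl => //; [apply: uz; rewrite cz|rewrite cy]; rewrite finset.in_set2 eqxx orbT.
Qed.

(** By [simplex_leads], a bulk point whose carrier meets the defect faces inwards (c true)
    or outwards (c false), but not both. *)
Definition facing c x : bool :=
  [exists u in car x, exists w in car x, [&& ~~ dv u, dv w & leads c u w]].

Lemma facingP c x : reflect
  (exists u w, [/\ u \in car x, w \in car x, ~~ dv u, dv w & leads c u w]) (facing c x).
Proof.
apply: (iffP exists_inP) => [[u ux /exists_inP[w wx /and3P[nu dw cuw]]]|].
  by exists u, w.
by move=> [u [w [ux wx nu dw cuw]]]; exists u => //; apply/exists_inP; exists w => //; rewrite nu dw.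
Qed.

Lemma facing_leads c x u w : facing c x -> u \in car x -> ~~ dv u -> w \in car x -> dv w ->
  leads c u w.
Proof.
move=> /facingP[u' [w' [ux' wx' nu' dw' cuw']]] ux nu wx dw.
exact: (simplex_leads (carrier_in T x)) cuw'.
Qed.

Lemma facing_exclusive x : facing true x -> facing false x -> False.
Proof.
move=> /facingP[u [w [ux wx nu dw cuw]]] fx.
exact: leads_exclusive cuw (facing_leads fx ux nu wx dw).
Qed.

Lemma facing_bulk c x : facing c x -> ~~ in_defect x.
Proof. by move=> /facingP[u [w [ux _ nu _ _]]]; exact: carrier_bulk nu. Qed.

Lemma facing_le c x z : car x \subset car z -> facing c x -> facing c z.
Proof.
move=> /fintype.subsetP xz /facingP[u [w [ux wx nu dw cuw]]].
by apply/facingP; exists u, w; split=> //; exact: xz.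
Qed.

Lemma facing_ge c x z w : car x \subset car z -> facing c z -> ~~ in_defect x ->
  w \in car x -> dv w -> facing c x.
Proof.
move=> /fintype.subsetP xz fz /(bulk_carrier T)[u ux nu] wx dw.
apply/facingP; exists u, w; split=> //.
by apply: facing_leads fz _ _ _ _ => //; exact: xz.
Qed.

Lemma facing_dir x w : ~~ in_defect x -> w \in car x -> dv w -> exists c, facing c x.
Proof.
move=> /(bulk_carrier T)[u ux nu] wx dw.
have uw : u != w by apply: contraNneq nu => ->.
have uwK := simplex_edge (carrier_in T x) ux wx.
have := leads_total true uw uwK; case: (boolP (leads true u w)) => [h _|_ h].
  by exists true; apply/facingP; exists u, w.
by exists false; apply/facingP; exists u, w.
Qed.

Lemma side_facing y : in_defect y ->
  \forall x \near y, ~~ in_defect x -> forall c, facing c x -> side c y x.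
Proof.
move=> yD.
have nU : nbhs y (tube y).
  apply: open_nbhs_nbhs; split; [exact: tube_open|].
  by apply: stratum_tube => //; exact: stratum_refl.
move: nU (side_leads T yD) (near_carrier T y).
apply: filterS3 => x Ux sx /fintype.subsetP xy xn c fx.
have [c' s'] := tube_sides yD Ux xn.
have [-> //|ne] := eqVneq c c'; exfalso.
have [u ux nu] := bulk_carrier T xn.
have [w wy] := carrier_neq0 T y.
apply: (@leads_exclusive c u w).
  exact: facing_leads fx ux nu (xy _ wy) (carrier_in_defect yD wy).
by rewrite (_ : ~~ c = c'); [exact: sx|case: (c) (c') ne => -[]].
Qed.

Lemma near_facing y : in_defect y ->
  \forall x \near y, forall c, side c y x -> facing c x.
Proof.
move=> yD; move: (side_leads T yD) (near_carrier T y).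
apply: filterS2 => x sx /fintype.subsetP xy c scx.
have [u ux nu] := bulk_carrier T (side_bulk yD scx).
have [w wy] := carrier_neq0 T y.
apply/facingP; exists u, w; split=> //; first exact: xy.
  exact: carrier_in_defect wy.
exact: sx scx _ _ ux nu wy.
Qed.

(** The trace of directedness at time t: the defect is entered from inward-facing bulk
    points and left to outward-facing ones. *)
Definition crosses_well p t :=
  near_in 0 1 t (fun s => in_defect (p t) -> ~~ in_defect (p s) ->
    (s < t -> facing true (p s)) /\ (t < s -> facing false (p s))).

Lemma directed_crosses_well p t : directed_path p -> 0 <= t -> t <= 1 -> crosses_well p t.
Proof.
move=> dp t0 t1; have [cp /directedE[_ don]] := (proj1 dp, dp).
have [yD|yn] := boolP (in_defect (p t)); last first.
  by apply: near_inT => s _ _ h; rewrite h in yn.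
have left_ : near_in 0 1 t (fun s => s < t ->
    prec_plus (p s) (p t) \/ prec_minus (p s) (p t)).
  have [tpos|tneg] := ltP 0 t; last by apply: near_inT => s; lin.
  have [e e0 he] := dir_on_left don tpos t1; exists e => // s s0 s1.
  by rewrite ltr_norml => /andP[h1 h2] st; case: he => he; [left|right]; apply: he; lin.
have right_ : near_in 0 1 t (fun s => t < s ->
    prec_plus (p t) (p s) \/ prec_minus (p t) (p s)).
  have [tlt|tge] := ltP t 1; last by apply: near_inT => s; lin.
  have [e e0 he] := dir_on_right don t0 tlt; exists e => // s s0 s1.
  by rewrite ltr_norml => /andP[h1 h2] st; case: he => he; [left|right]; apply: he; lin.
have nearf := within_near_in cp t0 t1 (near_facing yD).
have strD D : defect_strata X D -> D (p t) -> D = stratum (p t).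
  by move=> [z zD <-] /stratum_eq.
have DD D z : defect_strata X D -> D z -> in_defect z.
  by move=> [w wD <-] /stratum_in_defect ->; exact/in_defectP.
apply: near_inW (near_inI (near_inI left_ right_) nearf) => s s0 s1 [[hl hr] hf] _ sn.
split=> st.
  case: (hl st) => -[/stratum_in_defect|[D DS []]].
  - by rewrite yD (negbTE sn).
  - by move=> ps Dt; apply: hf; rewrite /side -(strD D).
  - by rewrite yD (negbTE sn).
  - by move=> /(DD _ _ DS); rewrite (negbTE sn).
case: (hr st) => -[/stratum_in_defect|[D DS []]].
- by rewrite yD (negbTE sn).
- by move=> _ /(DD _ _ DS); rewrite (negbTE sn).
- by rewrite yD (negbTE sn).
- by move=> Dt ns; apply: hf; rewrite /side -(strD D).
Qed.

Section Persistence.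
Variable p : R -> X.
Hypothesis cp : {within I, continuous p}.
Hypothesis wp : forall t, 0 <= t -> t <= 1 -> crosses_well p t.

(** Points that follow a visit to the defect closely face outwards, so an arc whose bulk
    points all face inwards cannot leave the defect. *)
Lemma stays_in_defect a b : 0 <= a -> b <= 1 ->
  (forall t, a <= t -> t <= b -> ~~ in_defect (p t) -> facing true (p t)) ->
  in_defect (p a) -> forall t, a <= t -> t <= b -> in_defect (p t).
Proof.
move=> a0 b1 hf aD; apply: interval_continuous_induction => //.
  move=> t ta tb tD; have [||e e0 he] := wp (t := t); [lin|lin|].
  exists e => // y ty yb yt; apply/negPn/negP => yn.
  have yt' : t < y.
    by rewrite lt_neqAle ty andbT; apply: contraNneq yn => <-.
  have [|||_ /(_ yt')] := he y _ _ _ tD yn; [lin|lin|by rewrite ltr_norml; lin|].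
  by apply: facing_exclusive; apply: hf => //; lin.
move=> t ta tb hS; apply/negPn/negP => tn.
have [||e e0 he] := within_near_in cp _ _ (near_bulk tn); [lin|lin|].
have [y [y1 y2 y3]] := exists_before ta e0.
have := hS y y1 y2; apply/negP/he; [lin|lin|].
by rewrite ltr_norml; lin.
Qed.

Lemma stayed_in_defect a b : 0 <= a -> b <= 1 ->
  (forall t, a <= t -> t <= b -> ~~ in_defect (p t) -> facing false (p t)) ->
  in_defect (p b) -> forall t, a <= t -> t <= b -> in_defect (p t).
Proof.
move=> a0 b1 hf bD t ta tb.
suff h : forall s, - b <= s -> s <= - a -> in_defect (p (- s)).
  by have := h (- t); rewrite opprK; apply; lin.
apply: interval_continuous_induction; first by rewrite opprK.
  move=> s sb sa sD; have [||e e0 he] := wp (t := - s); [lin|lin|].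
  exists e => // y sy ya ys; apply/negPn/negP => yn.
  have sy' : - y < - s.
    by rewrite ltrN2 lt_neqAle sy andbT; apply: contraNneq yn => <-.
  have [|||/(_ sy') + _] := he (- y) _ _ _ sD yn; [lin|lin|by rewrite ltr_norml; lin|].
  by move=> /facing_exclusive; apply; apply: hf => //; lin.
move=> s sb sa hS; apply/negPn/negP => sn.
have [||e e0 he] := within_near_in cp _ _ (near_bulk sn); [lin|lin|].
have [y [y1 y2 y3]] := exists_before sb e0.
have := hS y y1 y2; apply/negP/he; [lin|lin|].
by rewrite ltr_norml; lin.
Qed.

End Persistence.

End DirectedCriterion.

Section DirectedCriterionConverse.
Variables (R : realType) (d : nat) (X : manifold_with_defect R d).
Variable T : directed_triangulation X.
Local Notation I := (`[(0 : R), 1]%classic).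
Implicit Types (x y z : X) (p q : R -> X) (a b t r : R) (c : bool).

Lemma increasing_piece c p a b : {within I, continuous p} -> 0 <= a -> a <= b -> b <= 1 ->
  (forall s t, a <= s -> s <= t -> t <= b ->
     if c then prec_plus (p s) (p t) else prec_minus (p s) (p t)) -> piece p a b.
Proof.
move=> cp a0 ab b1 hp.
have within_ab r : 0 <= r <= 1 -> a <= a + r * (b - a) <= b.
  by move=> ?; apply/andP; split; nra.
have cr : {within I, continuous (path_restriction p a b)}.
  apply: (@within_comp _ _ _ I I (fun t => a + t * (b - a)) p _ cp).
    apply: continuous_subspaceT => t; apply: cvgD; first exact: cvg_cst.
    by apply: cvgM; [exact: cvg_id|exact: cvg_cst].
  by move=> t; rewrite /= !in_itv /= => /within_ab; lin.
have mono r s : r <= s -> a + r * (b - a) <= a + s * (b - a) by move=> rs; nra.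
rewrite /piece; case: c hp => hp; [left|right]; (split; first exact: cr);
  exists 1 => // r s; rewrite /= !in_itv /= => /within_ab/andP[r0 r1] /within_ab/andP[s0 s1] rs _;
  by apply: hp => //; exact: mono.
Qed.

(** Just before a time spent in the defect the path enters the defect at most once, from the
    positive side, so it increases for the first relation; just after, it leaves the defect
    at most once, and increases for the second one. *)
Lemma crosses_well_directed p : {within I, continuous p} ->
  (forall t, 0 <= t -> t <= 1 -> crosses_well T p t) -> directed_path p.
Proof.
move=> cp wp; apply/directedE; split => //.
have pst a b s t : 0 <= a -> b <= 1 -> a <= s -> s <= t -> t <= b ->
    (forall r, a <= r -> r <= b -> in_defect (p r) = in_defect (p a)) -> stratum (p s) (p t).
  move=> a0 b1 as_ st tb h; apply: (@path_stratum _ _ _ a b); last 2 first.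
  - by apply/andP; split; lin.
  - by apply/andP; split; lin.
  - by apply: within_sub cp => r; rewrite /= !in_itv /=; lin.
  - by move=> r /andP[]; exact: h.
apply: (@interval_additive_induction _ (dir_on p) 0 1) => //.
  by move=> x y z _ _ _ _; exact: dir_on_cat.
move=> t /andP[t0 t1].
suff [e e0 [hl hr]] : exists2 e, 0 < e &
    (forall a, 0 <= a -> a <= t -> t - a < e -> piece p a t) /\
    (forall b, t <= b -> b <= 1 -> b - t < e -> piece p t b).
  exists e => // a b a0 at_ tb b1 ha hb.
  apply: (dir_on_step at_ (hl _ a0 at_ ha)); apply: (dir_on_step tb (hr _ tb b1 hb)).
  exact: dir_on_nil.
have [yD|yn] := boolP (in_defect (p t)); last first.
  have [e e0 he] := near_in_window (within_near_in cp t0 t1 (near_bulk yn)).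
  exists e => //; split=> [a a0 at_ ha|b tb b1 hb].
    apply: (@increasing_piece true) => // r s ar rs st; left.
    apply: (pst a t) => // u au ut.
    by rewrite !(negbTE (he _ _ _ _ _)); lin.
  apply: (@increasing_piece true) => // r s ar rs st; left.
  apply: (pst t b) => // u au ut.
  by rewrite !(negbTE (he _ _ _ _ _)); lin.
have nf := near_inI (wp _ t0 t1) (within_near_in cp t0 t1 (side_facing T yD)).
have [e e0 he] := near_in_window nf.
have DS : defect_strata X (stratum (p t)) by exists (p t) => //; exact/in_defectP.
exists e => //; split=> [a a0 at_ ha|b tb b1 hb].
  have facing_in r : a <= r -> r <= t -> ~~ in_defect (p r) -> facing T true (p r).
    move=> ar rt rn; have [||||h _] := he r; try lin.
    have [] := h yD rn; move=> + _; apply.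
    by rewrite lt_neqAle rt andbT; apply: contraNneq rn => ->.
  have stay r s : a <= r -> r <= s -> s <= t -> in_defect (p r) -> in_defect (p s).
    move=> ar rs st rD; apply: (stays_in_defect cp wp (a := r) (b := t)) => //; try lin.
    by move=> u ru ut; apply: facing_in; lin.
  apply: (@increasing_piece true) => // r s ar rs st.
  have [rD|rn] := boolP (in_defect (p r)).
    left; apply: (pst r t) => //; try lin.
    by move=> u ru ut; rewrite rD (stay r) //; lin.
  have [sD|sn] := boolP (in_defect (p s)); last first.
    left; apply: (pst r s) => //; try lin.
    move=> u ru us; rewrite (negbTE rn); apply: contraNF sn; apply: stay => //; lin.
  right; exists (stratum (p t)) => //; split.
    have [||||_ h] := he r; try lin.
    by have := h rn true; rewrite /side; apply; exact: facing_in ar (le_trans rs st) rn.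
  apply/stratum_sym/(pst s t) => //; try lin.
  by move=> u su ut; rewrite sD (stay s) //; lin.
have facing_out r : t <= r -> r <= b -> ~~ in_defect (p r) -> facing T false (p r).
  move=> tr rb rn; have [||||h _] := he r; try lin.
  have [] := h yD rn; move=> _; apply.
  by rewrite lt_neqAle tr andbT; apply: contraNneq rn => <-.
have stay r s : t <= r -> r <= s -> s <= b -> in_defect (p s) -> in_defect (p r).
  move=> tr rs sb sD; apply: (stayed_in_defect cp wp (a := t) (b := s)) => //; try lin.
  by move=> u tu us; apply: facing_out; lin.
apply: (@increasing_piece false) => // r s tr rs sb.
have [sD|sn] := boolP (in_defect (p s)).
  left; apply: (pst t s) => //; try lin.
  by move=> u tu us; rewrite yD (stay u s) //; lin.
have [rD|rn] := boolP (in_defect (p r)); last first.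
  left; apply: (pst r s) => //; try lin.
  move=> u ru us; rewrite (negbTE rn); apply: contraNF rn; apply: stay => //; lin.
right; exists (stratum (p t)) => //; split.
  apply: (pst t r) => //; try lin.
  by move=> u tu ur; rewrite yD (stay u r) //; lin.
have [||||_ h] := he s; try lin.
by have := h sn false; rewrite /side; apply; exact: facing_out (le_trans tr rs) sb sn.
Qed.

(** This makes directedness a condition on the simplices through which a path runs. *)
Lemma directed_pathP p : directed_path p <->
  {within I, continuous p} /\ (forall t, 0 <= t -> t <= 1 -> crosses_well T p t).
Proof.
split=> [dp|[cp wp]]; last exact: crosses_well_directed.
by split; [case: dp|move=> t; exact: directed_crosses_well].
Qed.

End DirectedCriterionConverse.

(** * Partial composition of arrows *)

Section PartialComposition.
Variable D : category.
Implicit Types (f g h : arrow D).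

Definition arrow_comp f g : option (arrow D) :=
  match pselect (tgt f = src g) with
  | left e => Some (Arrow (mcomp (eq_rect _ (fun b => mor (src f) b) (arr f) _ e) (arr g)))
  | right _ => None
  end.

Lemma arrow_compE (a b c : D) (f : mor a b) (g : mor b c) :
  arrow_comp (Arrow f) (Arrow g) = Some (Arrow (mcomp f g)).
Proof.
rewrite /arrow_comp; case: pselect => //= e.
by rewrite (Prop_irrelevance e erefl).
Qed.

Lemma composesE f g h : composes f g h <-> arrow_comp f g = Some h.
Proof.
split=> [[a b c f' g']|]; first exact: arrow_compE.
case: f g => [a b f] [b' c g]; rewrite /arrow_comp; case: pselect => //= e.
by case: b' / e g => g /= [<-].
Qed.

(** The value None propagates failures of composability, so that associativity holds without
    side conditions and arrows never have to be moved along equalities of objects. *)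
Definition pcomp (f g : option (arrow D)) : option (arrow D) :=
  if f is Some f' then if g is Some g' then arrow_comp f' g' else None else None.

Lemma pcompA : associative pcomp.
Proof.
have typed a b c e (f : @mor D a b) (g : mor b c) (h : mor c e) :
    pcomp (Some (Arrow f)) (pcomp (Some (Arrow g)) (Some (Arrow h))) =
    pcomp (pcomp (Some (Arrow f)) (Some (Arrow g))) (Some (Arrow h)).
  by rewrite /pcomp !arrow_compE mcompA.
case=> [[a b f]|] // [[b' c g]|] // [[c' e h]|] //; last first.
  by rewrite /pcomp; case: arrow_comp.
have [eb|nb] := pselect (b = b'); have [ec|nc] := pselect (c = c').
- by case: b' / eb g => g; case: c' / ec h => h; exact: typed.
- have gh : arrow_comp (Arrow g) (Arrow h) = None by rewrite /arrow_comp; case: pselect.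
  case: b' / eb g gh => g gh.
  by rewrite /= gh arrow_compE /= /arrow_comp; case: pselect.
- have fg : arrow_comp (Arrow f) (Arrow g) = None by rewrite /arrow_comp; case: pselect.
  case: c' / ec h => h.
  by rewrite /= fg arrow_compE /= /arrow_comp; case: pselect.
- have fg : arrow_comp (Arrow f) (Arrow g) = None by rewrite /arrow_comp; case: pselect.
  have gh : arrow_comp (Arrow g) (Arrow h) = None by rewrite /arrow_comp; case: pselect.
  by rewrite /= fg gh.
Qed.

Lemma arrow_comp1f f : arrow_comp (id_arrow (src f)) f = Some f.
Proof. by case: f => a b f; rewrite arrow_compE mcomp1f. Qed.

Lemma arrow_compf1 f : arrow_comp f (id_arrow (tgt f)) = Some f.
Proof. by case: f => a b f; rewrite arrow_compE mcompf1. Qed.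

Lemma composes_src f g h : composes f g h -> src h = src f.
Proof. by case. Qed.

Lemma composes_tgt f g h : composes f g h -> tgt h = tgt g.
Proof. by case. Qed.

Lemma composes_middle f g h : composes f g h -> tgt f = src g.
Proof. by case. Qed.

Lemma exists_composes f g : tgt f = src g -> exists h, composes f g h.
Proof.
case: f g => [a b f] [b' c g] /= e; case: b' / e g => g.
by exists (Arrow (mcomp f g)).
Qed.

Lemma arrow_inj (a b : D) (f g : mor a b) : Arrow f = Arrow g -> f = g.
Proof.
move=> e.
have k (x y : arrow D) (h : x = y) :
    eq_rect _ (fun b => mor (src y) b)
      (eq_rect _ (fun a => mor a (tgt x)) (arr x) _ (congr1 (@src D) h)) _
      (congr1 (@tgt D) h) = arr y by case: y / h.
have := k _ _ e; rewrite /=.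
by rewrite (Prop_irrelevance (congr1 (@src D) e) (erefl a)) (Prop_irrelevance (congr1 (@tgt D) e) (erefl b)).
Qed.

End PartialComposition.

Notation "f ** g" := (pcomp f g) (at level 40, left associativity).

(** * Regular parcels over Gamma2 *)

Section RegularParcel.
Variables (C : parcel Gamma2).
Hypothesis C_regular : regular_parcel C.
Local Notation gam := (parcel_map C).
Implicit Types (f g h : option (arrow C)) (w : arrow (path_category Gamma2)) (v : gamma2_vertex).

Lemma exists_object v : exists a : C, gam a = v.
Proof.
have [f fE] := parcel_surjective C (@id_arrow (path_category Gamma2) v).
by exists (src f); rewrite -[LHS]/(src (map_arrow gam f)) fE.
Qed.

(** Regularity leaves one object over each vertex. *)
Definition object_over v : C := projT1 (cid (exists_object v)).

Lemma object_overK v : gam (object_over v) = v.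
Proof. by rewrite /object_over; case: cid. Qed.

Lemma object_over_uniq (a : C) : a = object_over (gam a).
Proof. by apply: C_regular; rewrite object_overK. Qed.

Definition lies_above w f : Prop := exists2 a, f = Some a & above C w a.

Definition unit_over v : option (arrow C) := Some (id_arrow (object_over v)).

Notation idw v := (@id_arrow (path_category Gamma2) v).

Lemma lies_above_unit v : lies_above (idw v) (unit_over v).
Proof.
exists (id_arrow (object_over v)) => //.
by rewrite /above /= /map_arrow /= fmor_id /id_arrow object_overK.
Qed.

Lemma above_src w (a : arrow C) : above C w a -> src a = object_over (src w).
Proof. by move=> <-; exact: object_over_uniq. Qed.

Lemma above_tgt w (a : arrow C) : above C w a -> tgt a = object_over (tgt w).
Proof. by move=> <-; exact: object_over_uniq. Qed.

Lemma above_composes w w' u (a b e : arrow C) : composes w w' u -> composes a b e ->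
  above C w a -> above C w' b -> above C u e.
Proof.
move=> /composesE ww' ab; rewrite /above /= => wa wb.
apply: Some_inj; rewrite -ww' -wa -wb.
by case: ab => x y z f g; rewrite /map_arrow /= fmor_comp arrow_compE.
Qed.

Lemma lies_above_comp w w' u f g : composes w w' u ->
  lies_above w f -> lies_above w' g -> lies_above u (f ** g).
Proof.
move=> ww' [a -> wa] [b -> wb].
have ab : tgt a = src b.
  by rewrite (above_tgt wa) (above_src wb) (composes_middle ww').
have [e abe] := exists_composes ab.
by exists e; [exact/composesE|exact: (above_composes ww' abe wa wb)].
Qed.

Lemma unit_comp w f v : src w = v -> lies_above w f -> unit_over v ** f = f.
Proof. by move=> <- [a -> wa]; rewrite /= -(above_src wa) arrow_comp1f. Qed.

Lemma comp_unit w f v : tgt w = v -> lies_above w f -> f ** unit_over v = f.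
Proof. by move=> <- [a -> wa]; rewrite /= -(above_tgt wa) arrow_compf1. Qed.

(** Conservativity makes the arrows above an identity invertible. *)
Lemma lies_above_inv v f : lies_above (idw v) f ->
  exists g, [/\ lies_above (idw v) g, f ** g = unit_over v & g ** f = unit_over v].
Proof.
move=> [a -> va].
have [b [ab ba]] : exists b : mor (tgt a) (src a),
    mcomp (arr a) b = idm _ /\ mcomp b (arr a) = idm _.
  have : is_iso (arr (map_arrow gam a)).
    by rewrite va; exists (@idm (path_category Gamma2) v); rewrite mcomp1f.
  exact: (@parcel_conservative _ C).
have sa := above_src va; have ta := above_tgt va; move: sa ta => /= sa ta.
have ab' : arrow_comp a (Arrow b) = unit_over v.
  transitivity (Some (id_arrow (src a))); last by rewrite sa.
  by case: a {va sa ta} b ab ba => x y f' /= b ab ba; rewrite arrow_compE ab.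
have ba' : arrow_comp (Arrow b) a = unit_over v.
  transitivity (Some (id_arrow (tgt a))); last by rewrite ta.
  by case: a {va sa ta ab'} b ab ba => x y f' /= b ab ba; rewrite arrow_compE ba.
exists (Some (Arrow b)); split=> //.
exists (Arrow b) => //; rewrite /above /=.
have [e2 _ e1] := lies_above_unit v.
have : composes a (Arrow b) (id_arrow (object_over v)) by apply/composesE.
move=> h.
have : composes (map_arrow gam a) (map_arrow gam (Arrow b))
    (map_arrow gam (id_arrow (object_over v))).
  by case: h => x y z f' g'; rewrite /map_arrow /= fmor_comp.
have ev : src (map_arrow gam (Arrow b)) = v by rewrite /= ta object_overK.
rewrite va [X in composes _ _ X]/map_arrow /= fmor_id => /composesE.
have -> : idw v = id_arrow (src (map_arrow gam (Arrow b))) by rewrite ev.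
rewrite arrow_comp1f => /Some_inj.
by rewrite /id_arrow object_overK ev => ->.
Qed.

Definition inverses f g : Prop :=
  exists v, [/\ lies_above (idw v) g, f ** g = unit_over v & g ** f = unit_over v].

Definition pinv f : option (arrow C) :=
  if pselect (exists g, inverses f g) is left h then projT1 (cid h) else f.

Lemma pinvP v f : lies_above (idw v) f ->
  [/\ lies_above (idw v) (pinv f), f ** pinv f = unit_over v & pinv f ** f = unit_over v].
Proof.
move=> vf; rewrite /pinv; case: pselect => [h|[]]; last first.
  by have [g [h1 h2 h3]] := lies_above_inv vf; exists g, v.
case: cid => g [v' [h1 h2 h3]] /=.
suff -> : v = v' by [].
have [a fa va] := vf; have [b gb vb] := h1.
move: h2; rewrite fa gb /= => /composesE /composes_src /= e.
by rewrite -(object_overK v) -(object_overK v') e -(above_src va).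
Qed.

Lemma pinv_uniq v f g : lies_above (idw v) f -> lies_above (idw v) g ->
  f ** g = unit_over v -> g = pinv f.
Proof.
move=> vf vg fg; have [vi fi if_] := pinvP vf.
rewrite -[LHS](@unit_comp (idw v) _ v) // -if_ -pcompA fg.
exact: (@comp_unit (idw v)).
Qed.

Lemma pinv_unit v : pinv (unit_over v) = unit_over v.
Proof.
have v1 := lies_above_unit v.
by apply/esym/(pinv_uniq v1 v1)/(unit_comp _ v1).
Qed.

End RegularParcel.

(** * Transition arrows of a coloring *)

Section Transitions.
Variables (R : realType) (d : nat) (X : manifold_with_defect R d).
Variable T : directed_triangulation X.
Variable C : parcel Gamma2.
Hypothesis C_regular : regular_parcel C.
Local Notation vpt := (@vertex_point _ _ X T).
Local Notation dv i := (in_defect (vpt i)).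
Implicit Types (u v w : 'I_(nvertices T)) (b : bool).
Local Notation K := (simplices T).
Notation idw v := (@id_arrow (path_category Gamma2) v).

Definition kind b : gamma2_vertex := if b then delta else beta.

Definition step_arrow b b' : arrow (path_category Gamma2) :=
  match b, b' with
  | false, false => Id_beta
  | true, true => Id_delta
  | false, true => arrow_iota
  | true, false => arrow_omega
  end.

Lemma step_arrow_same b : step_arrow b b = idw (kind b).
Proof. by case: b. Qed.

Lemma src_step b b' : src (step_arrow b b') = kind b.
Proof. by case: b b' => -[]. Qed.

Lemma tgt_step b b' : tgt (step_arrow b b') = kind b'.
Proof. by case: b b' => -[]. Qed.

Lemma composes_step b1 b2 b3 : b1 = b2 \/ b2 = b3 ->
  composes (step_arrow b1 b2) (step_arrow b2 b3) (step_arrow b1 b3).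
Proof.
case=> [->|<-]; apply/composesE; rewrite step_arrow_same.
  by rewrite -(src_step b2 b3) arrow_comp1f.
by rewrite -(tgt_step b1 b2) arrow_compf1.
Qed.

Section EdgeColors.
Variable col : 'I_(nvertices T) -> 'I_(nvertices T) -> option (arrow C).
Hypothesis col_above : forall u v, edge_dir u v -> lies_above (step_arrow (dv u) (dv v)) (col u v).
Hypothesis col_triangle : forall u v w, edge_dir u v -> edge_dir v w -> edge_dir u w ->
  [set u; v; w]%SET \in K -> col u v ** col v w = col u w.

Local Notation one u := (unit_over C (kind (dv u))).

(** Along an edge directed backwards the color is inverted; this is meaningful inside a
    stratum only, where colors lie above identities. *)
Definition transition u v : option (arrow C) :=
  if u == v then one u else if edge_dir u v then col u v else pinv (col v u).
Local Notation g := transition.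

(** A step from u to v that directed paths can make. *)
Definition passable u v := (dv u == dv v) || edge_dir u v.

Lemma edge_dir_neg u v : u != v -> [set u; v]%SET \in K -> ~~ edge_dir u v -> edge_dir v u.
Proof. by move=> uv uvK; have := edge_dir_total uv uvK; case: edge_dir. Qed.

Lemma edge_dir_asym u v : edge_dir u v -> ~~ edge_dir v u.
Proof.
move=> uv; have [ne uvK] := edge_dirP uv.
by have := edge_dir_total ne uvK; rewrite uv.
Qed.

Lemma edge_neq u v : edge_dir u v -> u != v.
Proof. by move=> /edge_dirP[]. Qed.

Lemma transition_refl u : g u u = one u.
Proof. by rewrite /g eqxx. Qed.

Lemma transition_edge u v : edge_dir u v -> g u v = col u v.
Proof. by move=> uv; rewrite /g uv (negbTE (edge_neq uv)). Qed.

Lemma transition_rev u v : edge_dir v u -> g u v = pinv (col v u).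
Proof.
move=> vu; rewrite /g eq_sym (negbTE (edge_neq vu)).
by rewrite (negbTE (edge_dir_asym vu)).
Qed.

Lemma transition_above u v : [set u; v]%SET \in K -> passable u v ->
  lies_above (step_arrow (dv u) (dv v)) (g u v).
Proof.
move=> uvK; have [->|ne] := eqVneq u v.
  by rewrite transition_refl step_arrow_same => _; exact: lies_above_unit.
rewrite /passable; have [uv|/(edge_dir_neg ne uvK) vu] := boolP (edge_dir u v).
  by rewrite transition_edge // => _; exact: col_above.
rewrite orbF transition_rev // => /eqP same.
have := col_above vu; rewrite -same step_arrow_same => h.
by have [] := pinvP C_regular h.
Qed.

Lemma transition_one u v : [set u; v]%SET \in K -> passable u v -> g u v ** one v = g u v.
Proof.
by move=> uvK /(transition_above uvK); apply: comp_unit; rewrite // tgt_step.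
Qed.

Lemma one_transition u v : [set u; v]%SET \in K -> passable u v -> one u ** g u v = g u v.
Proof.
by move=> uvK /(transition_above uvK); apply: unit_comp; rewrite // src_step.
Qed.

Lemma transitionK u v : [set u; v]%SET \in K -> dv u = dv v -> g u v ** g v u = one u.
Proof.
move=> uvK same; have [->|ne] := eqVneq u v.
  rewrite !transition_refl; apply: (unit_comp C_regular (w := idw (kind (dv v)))) => //.
  exact: lies_above_unit.
have [uv|/(edge_dir_neg ne uvK) vu] := boolP (edge_dir u v).
  rewrite transition_edge // (transition_rev uv).
  have := col_above uv; rewrite -same step_arrow_same => h.
  by have [] := pinvP C_regular h.
rewrite (transition_edge vu) transition_rev //.
have := col_above vu; rewrite -same step_arrow_same => h.
by have [] := pinvP C_regular h.
Qed.

Let cocycle u v w := g u v ** g v w = g u w.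

Let cocycle_swap12 u v w : [set u; v]%SET \in K -> dv u = dv v ->
  [set v; w]%SET \in K -> passable v w -> cocycle u v w -> cocycle v u w.
Proof.
move=> uvK same vwK okvw; rewrite /cocycle => <-.
by rewrite pcompA transitionK ?(finset.setUC [set v]%SET) // one_transition.
Qed.

Let cocycle_swap23 u v w : [set v; w]%SET \in K -> dv v = dv w ->
  [set u; v]%SET \in K -> passable u v -> cocycle u v w -> cocycle u w v.
Proof.
move=> vwK same uvK okuv; rewrite /cocycle => <-.
by rewrite -pcompA transitionK // transition_one.
Qed.

(** The edges inside a stratum follow the order of its vertices. *)
Lemma edge_dir_acyclic u v w : [set u; v; w]%SET \in K -> dv u = dv v -> dv v = dv w ->
  edge_dir u v -> edge_dir v w -> ~~ edge_dir w u.
Proof.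
move=> sK uv vw e1 e2; apply/negP => e3.
have inu : u \in [set u; v; w]%SET by rewrite !inE eqxx.
have inv_ : v \in [set u; v; w]%SET by rewrite !inE eqxx orbT.
have inw : w \in [set u; v; w]%SET by rewrite !inE eqxx orbT.
have st i j : i \in [set u; v; w]%SET -> j \in [set u; v; w]%SET -> dv i = dv j ->
    stratum (vpt i) (vpt j).
  by move=> is_ js; apply: (@joinable_stratum _ _ _ T); rewrite joinable_vertices; exact: simplex_edge sK _ _.
have lt i j : i \in [set u; v; w]%SET -> j \in [set u; v; w]%SET -> dv i = dv j ->
    edge_dir i j -> vertex_lt i j.
  move=> is_ js same ij; apply: edge_dir_stratum ij _ => x.
  have ijK := simplex_edge sK is_ js.
  move=> /(simplexP _ ijK) /fintype.subsetP xs.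
  have [k kx] := carrier_neq0 T x.
  have sameij l : l \in [set i; j]%SET -> dv l = dv i.
    by rewrite finset.in_set2 => /orP[] /eqP->.
  have : stratum x (vpt (nearby_vertex T x)) by exact: nearby_vertex_stratum.
  have := xs _ (nearby_vertex_in T x); set k' := nearby_vertex T x => k's xk'.
  apply: (stratum_trans _ (stratum_sym xk')); apply: (@joinable_stratum _ _ _ T).
    by rewrite joinable_vertices; apply: (simplex_edge ijK) => //; rewrite !inE eqxx.
  by rewrite sameij.
have l1 := lt _ _ inu inv_ uv e1; have l2 := lt _ _ inv_ inw vw e2.
have l3 := lt _ _ inw inu (esym (etrans uv vw)) e3.
have l12 := vertex_lt_trans (st _ _ inu inv_ uv) (st _ _ inv_ inw vw) l1 l2.
have := vertex_lt_trans (st _ _ inu inw (etrans uv vw))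
  (st _ _ inw inu (esym (etrans uv vw))) l12 l3.
by rewrite vertex_lt_irr.
Qed.

(** Sorting the vertices reduces this to the identity for triangles: exchanging two vertices
    of one stratum multiplies both sides by the same invertible arrow. *)
Lemma transition_cocycle u v w : [set u; v; w]%SET \in K ->
  dv u = dv v \/ dv v = dv w -> passable u v -> passable v w -> passable u w ->
  g u v ** g v w = g u w.
Proof.
move=> sK types okuv okvw okuw.
have inu : u \in [set u; v; w]%SET by rewrite !inE eqxx.
have inv_ : v \in [set u; v; w]%SET by rewrite !inE eqxx orbT.
have inw : w \in [set u; v; w]%SET by rewrite !inE eqxx orbT.
have uvK := simplex_edge sK inu inv_; have vwK := simplex_edge sK inv_ inw.
have uwK := simplex_edge sK inu inw; have vuK := simplex_edge sK inv_ inu.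
have wvK := simplex_edge sK inw inv_; have wuK := simplex_edge sK inw inu.
have [<-|uv] := eqVneq u v; first by rewrite transition_refl one_transition.
have [<-|vw] := eqVneq v w; first by rewrite transition_refl transition_one.
have perm_face (x y z : 'I_(nvertices T)) : x \in [set u; v; w]%SET -> y \in [set u; v; w]%SET ->
    z \in [set u; v; w]%SET -> [set x; y; z]%SET \in K.
  move=> xs ys zs; have [_ Kface] := simplicesP T; apply: (Kface _ _ sK).
    by apply/fintype.subsetP => i; rewrite finset.in_setU finset.in_set2 finset.in_set1;
      case/orP => [/orP[]|] /eqP->.
  by apply/set0Pn; exists x; rewrite !inE eqxx.
have base x y z : x \in [set u; v; w]%SET -> y \in [set u; v; w]%SET ->
    z \in [set u; v; w]%SET -> edge_dir x y -> edge_dir y z -> edge_dir x z -> cocycle x y z.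
  move=> xs ys zs xy yz xz; rewrite /cocycle !transition_edge //.
  by apply: col_triangle => //; exact: perm_face.
have swap12 x y z : x \in [set u; v; w]%SET -> y \in [set u; v; w]%SET ->
    z \in [set u; v; w]%SET -> dv x = dv y -> passable y z -> cocycle x y z -> cocycle y x z.
  by move=> xs ys zs xy; apply: cocycle_swap12 => //; apply: simplex_edge sK _ _.
have swap23 x y z : x \in [set u; v; w]%SET -> y \in [set u; v; w]%SET ->
    z \in [set u; v; w]%SET -> dv y = dv z -> passable x y -> cocycle x y z -> cocycle x z y.
  by move=> xs ys zs yz; apply: cocycle_swap23 => //; apply: simplex_edge sK _ _.
rewrite -/(cocycle u v w).
have ok x y : dv x = dv y -> passable x y by move=> xy; rewrite /passable xy eqxx.
have [suw|nuw] := eqVneq (dv u) (dv w).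
  (* all three vertices lie in one stratum: sort them *)
  have [suv svw] : dv u = dv v /\ dv v = dv w by case: types => h; rewrite -?suw ?h.
  have [uw|uw] := eqVneq u w.
    by rewrite /cocycle -uw transitionK // transition_refl.
  have [euv|/(edge_dir_neg uv uvK) evu] := boolP (edge_dir u v);
  have [evw|/(edge_dir_neg vw vwK) ewv] := boolP (edge_dir v w);
  have [euw|/(edge_dir_neg uw uwK) ewu] := boolP (edge_dir u w).
  - exact: base.
  - by have := edge_dir_acyclic sK suv svw euv evw; rewrite ewu.
  - by apply: (swap23); rewrite ?ok //; exact: base.
  - apply: (swap23); rewrite ?ok //; apply: (swap12); rewrite ?ok //; exact: base.
  - by apply: (swap12); rewrite ?ok //; exact: base.
  - apply: (swap12); rewrite ?ok //; apply: (swap23); rewrite ?ok //; exact: base.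
  - have := edge_dir_acyclic (perm_face _ _ _ inv_ inu inw) (esym suv) suw evu euw.
    by rewrite ewv.
  - apply: (swap12); rewrite ?ok //; apply: (swap23); rewrite ?ok //; apply: (swap12); rewrite ?ok //.
    exact: base.
have euw : edge_dir u w by move: okuw; rewrite /passable (negbTE nuw).
case: types => [suv|svw].
  have evw : edge_dir v w by move: okvw; rewrite /passable -suv (negbTE nuw).
  have [euv|/(edge_dir_neg uv uvK) evu] := boolP (edge_dir u v); first exact: base.
  by apply: (swap12) => //; exact: base.
have euv : edge_dir u v by move: okuv; rewrite /passable svw (negbTE nuw).
have [evw|/(edge_dir_neg vw vwK) ewv] := boolP (edge_dir v w); first exact: base.
by apply: (swap23) => //; exact: base.
Qed.

End EdgeColors.

End Transitions.

(** A coloring read as a function of pairs of vertices, in the form in which it determines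
    transition arrows. *)
Record edge_system (R : realType) (d : nat) (X : manifold_with_defect R d)
    (T : directed_triangulation X) (C : parcel Gamma2) := EdgeSystem {
  system_regular : regular_parcel C;
  system_color :> 'I_(nvertices T) -> 'I_(nvertices T) -> option (arrow C);
  system_above : forall u v, edge_dir u v ->
    lies_above (step_arrow (in_defect (vertex_point u)) (in_defect (vertex_point v)))
      (system_color u v);
  system_triangle : forall u v w, edge_dir u v -> edge_dir v w -> edge_dir u w ->
    [set u; v; w]%SET \in simplices T ->
    system_color u v ** system_color v w = system_color u w }.

(** * Holonomy of a coloring along directed paths *)

(** Removes the equations between arrows, which [lra] would try to read as equations between
    numbers. *)
Ltac rlra :=
  lazymatch goal with
  | |- @eq (option _) _ _ => fail
  | |- _ => first [order_chain | repeat match goal with H : ?A |- _ =>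
      lazymatch type of A with Prop =>
        lazymatch A with is_true _ => fail | _ => clear H end
      end
    end; lra]
  end.

Section Holonomy.
Variables (R : realType) (d : nat) (X : manifold_with_defect R d).
Variable T : directed_triangulation X.
Variable C : parcel Gamma2.
Variable L : edge_system T C.
Local Notation vpt := (@vertex_point _ _ X T).
Local Notation dv i := (in_defect (vpt i)).
Local Notation car := (carrier_simplex T).
Local Notation vtx := (nearby_vertex T).
Local Notation K := (simplices T).
Let C_regular := system_regular L.
Let col_above := @system_above _ _ _ _ _ L.
Let col_triangle := @system_triangle _ _ _ _ _ L.
Implicit Types (x y z : X) (p q : R -> X) (a b t r : R) (s : R -> option (arrow C)).
Implicit Types (f : option (arrow C)).

Definition point_transition x y := transition L (vtx x) (vtx y).
Local Notation G := point_transition.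
Definition point_passable x y := passable (vtx x) (vtx y).
Local Notation pass := point_passable.
Local Notation one x := (unit_over C (kind (in_defect x))).

Lemma point_passableE x y : pass x y = (in_defect x == in_defect y) || edge_dir (vtx x) (vtx y).
Proof. by rewrite /pass /passable !nearby_vertex_in_defect. Qed.

Lemma pass_refl x : pass x x.
Proof. by rewrite point_passableE eqxx. Qed.

Lemma same_pass x y : in_defect x = in_defect y -> pass x y.
Proof. by move=> xy; rewrite point_passableE xy eqxx. Qed.

Lemma facing_in_pass x y : car y \subset car x -> in_defect y -> facing T true x -> pass x y.
Proof.
move=> /fintype.subsetP yx yD fx; rewrite point_passableE; apply/orP; right.
apply: (facing_leads fx).
- exact: nearby_vertex_in.
- by rewrite nearby_vertex_in_defect; exact: facing_bulk fx.
- exact/yx/nearby_vertex_in.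
- by rewrite nearby_vertex_in_defect.
Qed.

Lemma facing_out_pass x y : car y \subset car x -> in_defect y -> facing T false x -> pass y x.
Proof.
move=> /fintype.subsetP yx yD fx; rewrite point_passableE; apply/orP; right.
apply: (facing_leads fx).
- exact: nearby_vertex_in.
- by rewrite nearby_vertex_in_defect; exact: facing_bulk fx.
- exact/yx/nearby_vertex_in.
- by rewrite nearby_vertex_in_defect.
Qed.

Lemma point_transition_refl x : G x x = one x.
Proof. by rewrite /G transition_refl nearby_vertex_in_defect. Qed.

Lemma point_transition_above k x y : k \in K -> vtx x \in k -> vtx y \in k -> pass x y ->
  lies_above (step_arrow (in_defect x) (in_defect y)) (G x y).
Proof.
move=> sK xs ys xy; rewrite -(nearby_vertex_in_defect T x) -(nearby_vertex_in_defect T y).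
by apply: transition_above => //; exact: simplex_edge sK _ _.
Qed.

(** Steps into the defect and out of it do not occur in the same simplex, by
    [simplex_leads]. *)
Lemma point_transition_cocycle k x y z : k \in K -> vtx x \in k -> vtx y \in k -> vtx z \in k ->
  pass x y -> pass y z -> pass x z -> G x y ** G y z = G x z.
Proof.
move=> sK xs ys zs xy yz xz; apply: transition_cocycle => //.
  have [_ Kface] := simplicesP T; apply: (Kface k) => //.
    by apply/fintype.subsetP => i; rewrite finset.in_setU finset.in_set2 finset.in_set1;
      case/orP => [/orP[]|] /eqP->.
  by apply/set0Pn; exists (vtx x); rewrite !inE eqxx.
rewrite !nearby_vertex_in_defect.
have [->|nxy] := eqVneq (in_defect x) (in_defect y); first by left.
have [->|nyz] := eqVneq (in_defect y) (in_defect z); first by right.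
exfalso; move: xy yz; rewrite !point_passableE (negbTE nxy) (negbTE nyz) /= => exy eyz.
have dvE x' : dv (vtx x') = in_defect x' by exact: nearby_vertex_in_defect.
have [yD|yn] := boolP (in_defect y).
  have [xn zn] : ~~ in_defect x /\ ~~ in_defect z.
    by move: nxy nyz; rewrite yD; case: (in_defect x) (in_defect z) => -[].
  apply: (@leads_exclusive _ _ _ T true (vtx x) (vtx y)) => //=.
  by apply: (simplex_leads (c := false) sK zs xs ys ys); rewrite ?dvE.
have [xn zn] : in_defect x /\ in_defect z.
  by move: nxy nyz; rewrite (negbTE yn); case: (in_defect x) (in_defect z) => -[].
apply: (@leads_exclusive _ _ _ T true (vtx y) (vtx z)) => //=.
by apply: (simplex_leads (c := false) sK ys ys xs zs); rewrite ?dvE.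
Qed.

Lemma point_transitionK k x y : k \in K -> vtx x \in k -> vtx y \in k ->
  in_defect x = in_defect y -> G x y ** G y x = one x.
Proof.
move=> sK xs ys xy; rewrite -point_transition_refl.
by apply: (point_transition_cocycle sK) => //; apply: same_pass.
Qed.

Lemma point_transition_one k x y : k \in K -> vtx x \in k -> vtx y \in k -> pass x y ->
  G x y ** one y = G x y.
Proof.
move=> sK xs ys xy; rewrite -point_transition_refl.
by apply: (point_transition_cocycle sK) => //; exact: pass_refl.
Qed.

Lemma one_point_transition k x y : k \in K -> vtx x \in k -> vtx y \in k -> pass x y ->
  one x ** G x y = G x y.
Proof.
move=> sK xs ys xy; rewrite -point_transition_refl.
by apply: (point_transition_cocycle sK) => //; exact: pass_refl.
Qed.

Lemma one_one x : one x ** one x = one x.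
Proof.
rewrite -!point_transition_refl.
by apply: (point_transition_cocycle (carrier_in T x)); rewrite ?nearby_vertex_in ?pass_refl.
Qed.

(** When p t lies in the defect this is [crosses_well]; otherwise p stays in the bulk for a
    while, where every step is allowed. *)
Lemma near_pass p t : directed_path p -> 0 <= t -> t <= 1 ->
  near_in 0 1 t (fun u => [/\ car (p t) \subset car (p u),
    u <= t -> pass (p u) (p t) & t <= u -> pass (p t) (p u)]).
Proof.
move=> dp t0 t1; have [cp _] := dp.
have nc := within_near_in cp t0 t1 (near_carrier T (p t)).
have [yD|yn] := boolP (in_defect (p t)).
  have wp := directed_crosses_well T dp t0 t1.
  apply: near_inW (near_inI nc wp) => u u0 u1 [cu /(_ yD) hu]; split=> // ut.
    have [uD|un] := boolP (in_defect (p u)); first by apply: same_pass; rewrite uD.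
    have [h _] := hu un; apply: (facing_in_pass cu yD (h _)).
    by rewrite lt_neqAle ut andbT; apply: contraNneq un => ->.
  have [uD|un] := boolP (in_defect (p u)); first by apply: same_pass; rewrite uD.
  have [_ h] := hu un; apply: (facing_out_pass cu yD (h _)).
  by rewrite lt_neqAle ut andbT; apply: contraNneq un => <-.
have nb := within_near_in cp t0 t1 (near_bulk yn).
apply: near_inW (near_inI nc nb) => u u0 u1 [cu nu].
by split=> // _; apply: same_pass; rewrite (negbTE yn) (negbTE nu).
Qed.

(** The local condition that makes s a parallel section over p for the connection given by
    the transition arrows. *)
Definition parallel p a b s : Prop := forall t, a <= t -> t <= b ->
  near_in a b t (fun u => (u <= t -> s t = s u ** G (p u) (p t)) /\
                          (t <= u -> s u = s t ** G (p t) (p u))).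

Lemma parallel_sub p a b a' b' s : a <= a' -> b' <= b -> parallel p a b s -> parallel p a' b' s.
Proof. by move=> aa bb ps t ta tb; apply: near_in_sub (ps t _ _) => //; rlra. Qed.

Lemma parallel_ext p q a b s s' : (forall t, a <= t -> t <= b -> p t = q t) ->
  (forall t, a <= t -> t <= b -> s t = s' t) -> parallel p a b s -> parallel q a b s'.
Proof.
move=> pq ss ps t ta tb; apply: near_inW (ps t ta tb) => u ua ub.
by rewrite !ss // !pq.
Qed.

Lemma parallel_one p a b s t : parallel p a b s -> a <= t -> t <= b -> s t ** one (p t) = s t.
Proof.
move=> ps ta tb; have [e e0 he] := ps t ta tb.
have [||//|h _] := he t; rewrite ?subrr ?normr0 //.
by rewrite {2}h // point_transition_refl.
Qed.

Lemma parallel_glue p a b c s : a <= c -> c <= b ->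
  parallel p a c s -> parallel p c b s -> parallel p a b s.
Proof.
move=> ac cb ps1 ps2 t ta tb.
have [tc|ct|->] := ltgtP t c.
- have [e e0 he] := ps1 t ta (ltW tc).
  exists (Num.min e (c - t)); first by rewrite lt_min e0 subr_gt0.
  move=> u ua ub; rewrite lt_min => /andP[h1]; rewrite ltr_norml => /andP[h2 h3].
  by apply: he => //; rlra.
- have [e e0 he] := ps2 t (ltW ct) tb.
  exists (Num.min e (t - c)); first by rewrite lt_min e0 subr_gt0.
  move=> u ua ub; rewrite lt_min => /andP[h1]; rewrite ltr_norml => /andP[h2 h3].
  by apply: he => //; rlra.
have [e e0 he] := ps1 c ac (lexx c); have [e' e0' he'] := ps2 c (lexx c) cb.
exists (Num.min e e'); first by rewrite lt_min e0.
move=> u ua ub; rewrite lt_min => /andP[h1 h2]; split=> h.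
  by have [] := he u ua h h1; move=> + _; apply.
by have [] := he' u h ub h2; move=> _; apply.
Qed.

Lemma parallel_translate p a b s f : parallel p a b s -> parallel p a b (fun t => f ** s t).
Proof.
move=> ps t ta tb; apply: near_inW (ps t ta tb) => u ua ub [h1 h2].
by split=> [/h1|/h2] ->; rewrite pcompA.
Qed.

Lemma parallel_uniq p a b s s' : parallel p a b s -> parallel p a b s' -> s a = s' a ->
  forall t, a <= t -> t <= b -> s t = s' t.
Proof.
move=> ps ps' ssa t ta tb.
apply: (@interval_additive_induction _ (fun u v => s u = s' u -> s v = s' v) a t) => //.
  by move=> x y z _ _ _ _ h1 h2 /h1 /h2.
move=> u /andP[au ut].
have [||||e e0 he] := near_in_window (near_inI (ps u _ _) (ps' u _ _)); try rlra.
exists e => // x y ax xu uy yt xue yue ssx.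
have [||||[hx _] [hx' _]] := he x; try rlra.
have [||||[_ hy] [_ hy']] := he y; try rlra.
by rewrite hy // hy' // hx // hx' // ssx.
Qed.

Section AlongDirectedPath.
Variable p : R -> X.
Hypothesis dp : directed_path p.

(** By the cocycle identity, each short part of the transport is absorbed in the step to
    y. *)
Lemma parallel_to y a b s : 0 <= a -> b <= 1 -> parallel p a b s ->
  (forall t, a <= t -> t <= b -> car y \subset car (p t) /\ pass (p t) y) ->
  forall t, a <= t -> t <= b -> s t ** G (p t) y = s a ** G (p a) y.
Proof.
move=> a0 b1 ps hy t ta tb; apply: esym.
apply: (@interval_additive_induction _
  (fun u v => s u ** G (p u) y = s v ** G (p v) y) a t) => //.
  by move=> u v w _ _ _ _ -> ->.
move=> u /andP[au ut].
have [||||e e0 he] := near_in_window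
  (near_inI (ps u _ _) (near_in_sub a0 b1 (near_pass dp (t := u) _ _))); try rlra.
exists e => // v w av vu uw wt vue wue.
have vyt v' : a <= v' -> v' <= b -> vtx y \in car (p v').
  by move=> h1 h2; apply: (fintype.subsetP (proj1 (hy v' h1 h2))); exact: nearby_vertex_in.
transitivity (s u ** G (p u) y).
  have [||||[sv _] [cv pv _]] := he v; try rlra.
  have pvu := pv vu.
  have [||_ pvy] := hy v; try rlra; have [||_ puy] := hy u; try rlra.
  rewrite (sv vu) -pcompA (point_transition_cocycle (carrier_in T (p v)) (y := p u)) //.
  - exact: nearby_vertex_in.
  - exact: (fintype.subsetP cv) (nearby_vertex_in _ _).
  - by apply: vyt; rlra.
have [||||[_ sw] [cw _ pw]] := he w; try rlra.
have puw := pw uw.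
have [||_ pwy] := hy w; try rlra; have [||_ puy] := hy u; try rlra.
rewrite (sw uw) -pcompA (point_transition_cocycle (carrier_in T (p w)) (y := p w)) //.
- exact: (fintype.subsetP cw) (nearby_vertex_in _ _).
- exact: nearby_vertex_in.
- by apply: vyt; rlra.
Qed.

Lemma parallel_from y f a b s : 0 <= a -> b <= 1 -> parallel p a b s ->
  (forall t, a <= t -> t <= b -> car y \subset car (p t) /\ pass y (p t)) ->
  s a = f ** G y (p a) ->
  forall t, a <= t -> t <= b -> s t = f ** G y (p t).
Proof.
move=> a0 b1 ps hy sa t ta tb.
apply: (@interval_additive_induction _
  (fun u v => s u = f ** G y (p u) -> s v = f ** G y (p v)) a t) => //.
  by move=> u v w _ _ _ _ h1 h2 /h1 /h2.
move=> u /andP[au ut].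
have [||||e e0 he] := near_in_window
  (near_inI (ps u _ _) (near_in_sub a0 b1 (near_pass dp (t := u) _ _))); try rlra.
exists e => // v w av vu uw wt vue wue sv.
have vyt v' : a <= v' -> v' <= b -> vtx y \in car (p v').
  by move=> h1 h2; apply: (fintype.subsetP (proj1 (hy v' h1 h2))); exact: nearby_vertex_in.
have su : s u = f ** G y (p u).
  have [||||[svu _] [cv pv _]] := he v; try rlra.
  have pvu := pv vu.
  have [||_ pyv] := hy v; try rlra; have [||_ pyu] := hy u; try rlra.
  rewrite (svu vu) sv -pcompA (point_transition_cocycle (carrier_in T (p v)) (y := p v)) //.
  - by apply: vyt; rlra.
  - exact: nearby_vertex_in.
  - exact: (fintype.subsetP cv) (nearby_vertex_in _ _).
have [||||[_ sw] [cw _ pw]] := he w; try rlra.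
have puw := pw uw.
have [||_ pyw] := hy w; try rlra; have [||_ pyu] := hy u; try rlra.
rewrite (sw uw) su -pcompA (point_transition_cocycle (carrier_in T (p w)) (y := p u)) //.
- by apply: vyt; rlra.
- exact: (fintype.subsetP cw) (nearby_vertex_in _ _).
- exact: nearby_vertex_in.
Qed.

Lemma parallel_star f a b : 0 <= a -> b <= 1 ->
  (forall t, a <= t -> t <= b -> car (p a) \subset car (p t) /\ pass (p a) (p t)) ->
  parallel p a b (fun t => f ** G (p a) (p t)).
Proof.
move=> a0 b1 hy t ta tb.
have [t0 t1] : 0 <= t /\ t <= 1 by rlra.
apply: near_inW (near_in_sub a0 b1 (near_pass dp t0 t1)) => u ua ub [cu pu1 pu2].
have [tin tpass] := hy t ta tb; have [uin upass] := hy u ua ub.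
have au : vtx (p a) \in car (p u) by apply: (fintype.subsetP uin); exact: nearby_vertex_in.
have tu : vtx (p t) \in car (p u) by apply: (fintype.subsetP cu); exact: nearby_vertex_in.
have uu : vtx (p u) \in car (p u) by exact: nearby_vertex_in.
split=> h; rewrite -pcompA.
  by rewrite (point_transition_cocycle (carrier_in T (p u)) (y := p u)) //; exact: pu1.
by rewrite (point_transition_cocycle (carrier_in T (p u)) (y := p t)) //; exact: pu2.
Qed.

(** A section over [a, t] extends beyond t by one step from p t, and sections over all [a, u]
    with u < t, which agree, extend to t by one step to p t. *)
Lemma exists_parallel a b f : 0 <= a -> a <= b -> b <= 1 -> f ** one (p a) = f ->
  exists s, parallel p a b s /\ s a = f.
Proof.
move=> a0 ab b1 f1.
apply: (@interval_continuous_induction _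
  (fun t => exists s, parallel p a t s /\ s a = f) a b) => //.
- exists (fun=> f); split=> // t ta at_; apply: near_inT => u ua ub.
  have -> : u = a by rlra.
  have -> : t = a by rlra.
  by rewrite point_transition_refl f1.
- move=> t at_ tb [s [ps sa]].
  have [t0 t1] : 0 <= t /\ t <= 1 by rlra.
  have [e e0 he] := near_in_window (near_pass dp t0 t1).
  exists e => // y ty yb yt.
  pose s' u := if u <= t then s u else s t ** G (p t) (p u).
  have st : s t ** G (p t) (p t) = s t.
    by rewrite point_transition_refl (parallel_one ps).
  exists s'; split; last by rewrite /s' at_.
  apply: (parallel_glue at_ ty).
    by apply: parallel_ext ps => // u ua ut; rewrite /s' ut.
  apply: (@parallel_ext p p t y (fun u => s t ** G (p t) (p u))) => //.
    move=> u tu uy; rewrite /s'; case: leP => // ut.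
    by have -> : u = t by [rlra]; rewrite st.
  apply: parallel_star => //; first by rlra.
  move=> u tu uy; have [||||cu _ pu] := he u; try rlra.
  by split=> //; exact: pu.
move=> t at_ tb hS.
have [t0 t1] : 0 <= t /\ t <= 1 by rlra.
have [e e0 he] := near_in_window (near_pass dp t0 t1).
have [u0 [u1 u2 u3]] := exists_before at_ e0.
have /choice[S SP] : forall u, exists s, a <= u -> u < t -> parallel p a u s /\ s a = f.
  move=> u; have [au|ua] := leP a u; last by exists (fun=> f) => h; exfalso; rlra.
  have [ut|tu] := ltP u t; last by exists (fun=> f) => _ h; exfalso; rlra.
  by have [s hs] := hS u au ut; exists s.
have Suv u v : a <= u -> u <= v -> v < t -> S u u = S v u.
  move=> au uv vt.
  have [||pu su] := SP u; try rlra; have [||pv sv] := SP v; try rlra.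
  apply: (parallel_uniq pu) => //; last by rewrite su sv.
  by apply: parallel_sub pv.
pose s' u := if u < t then S u u else S u0 u0 ** G (p u0) (p t).
have s'S v u : a <= u -> u <= v -> v < t -> S v u = s' u.
  by move=> au uv vt; rewrite /s' ifT ?(le_lt_trans uv) // (Suv u v).
have pass_t u : u0 <= u -> u <= t -> [/\ car (p t) \subset car (p u) & pass (p u) (p t)].
  by move=> uu ut; have [||||cu pu _] := he u; try rlra; split=> //; exact: pu.
have s't : s' t = s' u0 ** G (p u0) (p t) by rewrite /s' ltxx u2.
exists s'; split; last first.
  by rewrite /s' at_; have [||_ ->] := SP a; try rlra.
move=> v av vt; have [vlt|vge] := ltP v t.
  pose y := (v + t) / 2.
  have [vy yt] : v < y /\ y < t by rewrite /y; rlra.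
  have [||py _] := SP y; try rlra.
  have [e' e0' he'] := py v av (ltW vy).
  exists (Num.min e' (y - v)); first by rewrite lt_min e0' subr_gt0.
  move=> u ua ut; rewrite lt_min => /andP[h1]; rewrite ltr_norml => /andP[h2 h3].
  have uy : u <= y by rlra.
  by have := he' u ua uy h1; rewrite !(s'S y) //; rlra.
have -> : v = t by rlra.
exists (t - u0); first by rlra.
move=> u ua ut; rewrite ltr_norml => /andP[h1 h2].
have key : s' t = s' u ** G (p u) (p t).
  have [ult|uge] := ltP u t; last first.
    have -> : u = t by rlra.
    rewrite s't -pcompA; have [||cu0 pu0] := pass_t u0; try rlra.
    rewrite (point_transition_cocycle (carrier_in T (p u0)) (y := p t)) //.
    - exact: nearby_vertex_in.
    - exact: (fintype.subsetP cu0) (nearby_vertex_in _ _).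
    - exact: (fintype.subsetP cu0) (nearby_vertex_in _ _).
    - exact: pass_refl.
  rewrite s't -!(s'S u) //; try rlra.
  have [||pu _] := SP u; try rlra.
  apply/esym/(@parallel_to (p t) u0 u (S u)); try rlra.
  - by apply: parallel_sub pu; rlra.
  - by move=> w uw wu; have [||cw pw] := pass_t w; try rlra; split.
split=> // h; have e' : u = t by rlra.
by move: key; rewrite e'.
Qed.

Definition holonomy a b : option (arrow C) :=
  if pselect (exists s, parallel p a b s /\ s a = one (p a)) is left h
  then projT1 (cid h) b else None.

Lemma holonomyP a b s : 0 <= a -> a <= b -> b <= 1 -> parallel p a b s ->
  s b = s a ** holonomy a b.
Proof.
move=> a0 ab b1 ps; rewrite /holonomy; case: pselect => [h|[]]; last first.
  by apply: exists_parallel => //; exact: one_one.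
case: cid => s' [ps' s'a] /=.
apply: (parallel_uniq ps (parallel_translate (s a) ps')) => //.
by rewrite s'a (parallel_one ps).
Qed.

Lemma exists_holonomy a b : 0 <= a -> a <= b -> b <= 1 ->
  exists s, [/\ parallel p a b s, s a = one (p a) & s b = holonomy a b].
Proof.
move=> a0 ab b1; have [s [ps sa]] := exists_parallel a0 ab b1 (one_one (p a)).
exists s; split=> //; rewrite /holonomy; case: pselect => [h|[]]; last by exists s.
case: cid => s' [ps' s'a] /=; apply: (parallel_uniq ps ps') => //.
by rewrite sa s'a.
Qed.

Lemma holonomy_cat a b c : 0 <= a -> a <= b -> b <= c -> c <= 1 ->
  holonomy a b ** holonomy b c = holonomy a c.
Proof.
move=> a0 ab bc c1.
have [|s [ps sa sc]] := @exists_holonomy a c a0 _ c1; first by rlra.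
have [|s' [ps' s'a s'b]] := @exists_holonomy a b a0 ab; first by rlra.
have sb : s b = holonomy a b.
  rewrite -s'b; apply: (parallel_uniq _ ps') => //; last by rewrite sa s'a.
  by apply: parallel_sub ps => //; rlra.
rewrite -sc -sb; apply/esym/holonomyP => //; first by rlra.
by apply: parallel_sub ps => //; rlra.
Qed.

Lemma one_holonomy a b : 0 <= a -> a <= b -> b <= 1 -> one (p a) ** holonomy a b = holonomy a b.
Proof.
move=> a0 ab b1; have [s [ps sa sb]] := exists_holonomy a0 ab b1.
by rewrite -sa -holonomyP.
Qed.

End AlongDirectedPath.

End Holonomy.

Section HolonomyAlongPaths.
Variables (R : realType) (d : nat) (X : manifold_with_defect R d).
Variable T : directed_triangulation X.
Variable C : parcel Gamma2.
Variable L : edge_system T C.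
Local Notation I := (`[(0 : R), 1]%classic).
Local Notation holonomy := (holonomy L).
Local Notation parallel := (parallel L).
Local Notation vpt := (@vertex_point _ _ X T).
Local Notation dv i := (in_defect (vpt i)).
Local Notation car := (carrier_simplex T).
Local Notation vtx := (nearby_vertex T).
Implicit Types (x y z : X) (p q : R -> X) (a b t r : R) (s : R -> option (arrow C)).
Implicit Types (f : option (arrow C)).

Local Notation G := (point_transition L).
Local Notation pass := (point_passable T).
Local Notation one x := (unit_over C (kind (in_defect x))).

Lemma holonomy_one p a b : directed_path p -> 0 <= a -> a <= b -> b <= 1 ->
  holonomy p a b ** one (p b) = holonomy p a b.
Proof.
move=> dp a0 ab b1; have [s [ps sa <-]] := exists_holonomy L dp a0 ab b1.
exact: parallel_one ps ab (lexx b).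
Qed.

Lemma holonomy_to p a b : directed_path p -> 0 <= a -> a <= b -> b <= 1 ->
  (forall t, a <= t -> t <= b -> car (p b) \subset car (p t) /\ pass (p t) (p b)) ->
  holonomy p a b = G (p a) (p b).
Proof.
move=> dp a0 ab b1 hy; have [s [ps sa sb]] := exists_holonomy L dp a0 ab b1.
have := parallel_to dp a0 b1 ps hy ab (lexx b).
rewrite point_transition_refl sb holonomy_one // => ->; rewrite sa.
have [cy py] := hy a (lexx a) ab.
rewrite (one_point_transition L (carrier_in T (p a))) ?nearby_vertex_in //.
exact: (fintype.subsetP cy) (nearby_vertex_in _ _).
Qed.

Lemma holonomy_from p a b : directed_path p -> 0 <= a -> a <= b -> b <= 1 ->
  (forall t, a <= t -> t <= b -> car (p a) \subset car (p t) /\ pass (p a) (p t)) ->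
  holonomy p a b = G (p a) (p b).
Proof.
move=> dp a0 ab b1 hy.
have ps := parallel_star L dp (one (p a)) a0 b1 hy.
have := holonomyP dp a0 ab b1 ps; rewrite point_transition_refl (one_one L) one_holonomy // => <-.
have [cy py] := hy b ab (lexx b).
rewrite (one_point_transition L (carrier_in T (p b))) ?nearby_vertex_in //.
exact: (fintype.subsetP cy) (nearby_vertex_in _ _).
Qed.

Lemma near_holonomy p t : directed_path p -> 0 <= t -> t <= 1 -> exists2 e, 0 < e &
  (forall a, 0 <= a -> a <= t -> t - a < e ->
     [/\ holonomy p a t = G (p a) (p t), car (p t) \subset car (p a) & pass (p a) (p t)]) /\
  (forall b, t <= b -> b <= 1 -> b - t < e ->
     [/\ holonomy p t b = G (p t) (p b), car (p t) \subset car (p b) & pass (p t) (p b)]).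
Proof.
move=> dp t0 t1; have [e e0 he] := near_in_window (near_pass T dp t0 t1).
exists e => //; split=> [a a0 at_ ae|b tb b1 be].
  have [||||h1 h2 _] := he a; try rlra.
  split=> //; last exact: h2.
  apply: holonomy_to => // u au ut; have [||||h3 h4 _] := he u; try rlra.
  by split=> //; exact: h4.
have [||||h1 _ h2] := he b; try rlra.
split=> //; last exact: h2.
apply: holonomy_from => // u au ut; have [||||h3 _ h4] := he u; try rlra.
by split=> //; exact: h4.
Qed.

Lemma holonomy_ext p q a b : directed_path p -> directed_path q -> 0 <= a -> a <= b -> b <= 1 ->
  (forall t, a <= t -> t <= b -> p t = q t) -> holonomy p a b = holonomy q a b.
Proof.
move=> dp dq a0 ab b1 pq; have [s [ps sa <-]] := exists_holonomy L dp a0 ab b1.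
have qs : parallel q a b s by apply: parallel_ext ps.
rewrite (holonomyP dq a0 ab b1 qs) sa pq ?lexx // one_holonomy //.
Qed.

Lemma holonomy_reparam p (sigma : R -> R) a b : directed_path p -> weakly_increasing sigma ->
  0 <= a -> a <= b -> b <= 1 ->
  holonomy (p \o sigma) a b = holonomy p (sigma a) (sigma b).
Proof.
move=> dp ms a0 ab b1; have [cs Is mono] := ms.
have IE t : I t <-> 0 <= t <= 1 by rewrite /= in_itv.
have sI t : 0 <= t <= 1 -> 0 <= sigma t <= 1 by move=> /IE /Is /IE.
have smono t u : 0 <= t -> t <= u -> u <= 1 -> sigma t <= sigma u.
  by move=> t0 tu u1; apply: mono => //; apply/IE; rlra.
have /andP[sa0 sa1] : 0 <= sigma a <= 1 by apply: sI; rlra.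
have /andP[sb0 sb1] : 0 <= sigma b <= 1 by apply: sI; rlra.
have sab : sigma a <= sigma b by exact: smono.
have [s [ps sa sb]] := exists_holonomy L dp sa0 sab sb1.
have dps : directed_path (p \o sigma) by exact: directed_path_comp.
have pss : parallel (p \o sigma) a b (s \o sigma).
  move=> t ta tb.
  have [||e e0 he] := ps (sigma t); [by apply: smono; rlra|by apply: smono; rlra|].
  have [t0 t1] : 0 <= t /\ t <= 1 by rlra.
  have nb : nbhs (sigma t) [set u | `|u - sigma t| < e].
    by apply/nbhs_ballP; exists e => //= u; rewrite /ball /= distrC.
  have := near_in_sub a0 b1 (within_near_in cs t0 t1 nb).
  apply: near_inW => u ua ub /= hu.
  have [|||h1 h2] := he (sigma u); [by apply: smono; rlra|by apply: smono; rlra|by []|].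
  by split=> h; [apply: h1|apply: h2]; apply: smono; rlra.
have := holonomyP dps a0 ab b1 pss; rewrite /= sa sb => ->.
by rewrite one_holonomy.
Qed.

Lemma affine_increasing a b : 0 <= a -> a <= b -> b <= 1 ->
  weakly_increasing (fun t : R => a + t * (b - a)).
Proof.
move=> a0 ab b1; apply: weakly_increasing_continuous.
- move=> t; apply: cvgD; first exact: cvg_cst.
  by apply: cvgM; [exact: cvg_id|exact: cvg_cst].
- by move=> t; rewrite /= !in_itv /= => /andP[t0 t1]; apply/andP; split; nra.
- by move=> t u _ _ tu; nra.
Qed.

Lemma holonomy_restriction p a b : directed_path p -> 0 <= a -> a <= b -> b <= 1 ->
  holonomy (path_restriction p a b) 0 1 = holonomy p a b.
Proof.
move=> dp a0 ab b1.
rewrite -[path_restriction p a b]/(p \o (fun t => a + t * (b - a))).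
rewrite holonomy_reparam ?ler01 ?lexx //; last exact: affine_increasing.
by congr holonomy; ring.
Qed.

Lemma holonomy_concat p q : directed_path p -> directed_path q -> p 1 = q 0 ->
  holonomy (path_concat p q) 0 1 = holonomy p 0 1 ** holonomy q 0 1.
Proof.
move=> dp dq pq; have dpq := directed_concat dp dq pq.
have [h0 h1] : 0 <= (2^-1 : R) /\ (2^-1 : R) <= 1 by rlra.
rewrite -(holonomy_cat L dpq (lexx 0) h0 h1 (lexx 1)).
rewrite -(holonomy_restriction dpq (lexx 0) h0 h1) -(holonomy_restriction dpq h0 h1 (lexx 1)).
have r1 := directed_path_comp dpq (affine_increasing (lexx 0) h0 h1).
have r2 := directed_path_comp dpq (affine_increasing h0 h1 (lexx 1)).
congr (_ ** _); apply: holonomy_ext => // t t0 t1; rewrite /path_restriction /path_concat.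
  by rewrite ifT; [congr p; field|rlra].
case: leP => h; last by congr q; field.
have -> : t = 0 by rlra.
by rewrite -pq; congr p; field.
Qed.

(** The way a bulk point of the star of y faces is locally constant, and the defect is only
    entered from inward-facing points. *)
Lemma before_defect_facing p y a b : directed_path p -> in_defect y -> 0 <= a -> a <= b -> b <= 1 ->
  (forall t, a <= t -> t <= b -> car y \subset car (p t)) ->
  in_defect (p b) -> ~~ in_defect (p a) -> facing T true (p a).
Proof.
move=> dp yD a0 ab b1 hy bD an; have [cp _] := dp.
have yt t : a <= t -> t <= b -> vtx y \in car (p t).
  by move=> ta tb; apply: (fintype.subsetP (hy t ta tb)); exact: nearby_vertex_in.
have dy : dv (vtx y) by rewrite nearby_vertex_in_defect.
have [[] fa] := facing_dir an (yt a (lexx a) ab) dy; first exact: fa.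
suff : facing T false (p b) by move=> /facing_bulk; rewrite bD.
apply: (@interval_continuous_induction _ (fun t => facing T false (p t)) a b) => //.
  move=> t ta tb ft; have [t0 t1] : 0 <= t /\ t <= 1 by rlra.
  have [e e0 he] := near_in_window (within_near_in cp t0 t1 (near_carrier T (p t))).
  by exists e => // u tu ub ue; apply: facing_le ft; apply: he; rlra.
move=> t ta tb hS; have [t0 t1] : 0 <= t /\ t <= 1 by rlra.
have [e e0 he] := near_in_window (near_inI
  (within_near_in cp t0 t1 (near_carrier T (p t))) (directed_crosses_well T dp t0 t1)).
have [u [u1 u2 u3]] := exists_before ta e0.
have fu := hS u u1 u2; have [||||cu wu] := he u; try rlra.
have [tD|tn] := boolP (in_defect (p t)).
  have [/(_ u2) fu' _] := wu tD (facing_bulk fu).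
  by case: (facing_exclusive fu' fu).
exact: (facing_ge cu fu tn (yt t (ltW ta) tb) dy).
Qed.

Lemma after_defect_facing p y a b : directed_path p -> in_defect y -> 0 <= a -> a <= b -> b <= 1 ->
  (forall t, a <= t -> t <= b -> car y \subset car (p t)) ->
  in_defect (p a) -> ~~ in_defect (p b) -> facing T false (p b).
Proof.
move=> dp yD a0 ab b1 hy aD bn; have [cp _] := dp.
have yt t : a <= t -> t <= b -> vtx y \in car (p t).
  by move=> ta tb; apply: (fintype.subsetP (hy t ta tb)); exact: nearby_vertex_in.
have dy : dv (vtx y) by rewrite nearby_vertex_in_defect.
suff : in_defect (p b) \/ facing T false (p b) by case=> //; rewrite (negbTE bn).
apply: (@interval_continuous_induction _
  (fun t => in_defect (p t) \/ facing T false (p t)) a b) => //; first by left.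
  move=> t ta tb ft; have [t0 t1] : 0 <= t /\ t <= 1 by rlra.
  have [e e0 he] := near_in_window (near_inI
    (within_near_in cp t0 t1 (near_carrier T (p t))) (directed_crosses_well T dp t0 t1)).
  exists e => // u tu ub ue; have [||||cu wu] := he u; try rlra.
  case: ft => [tD|ft]; last by right; exact: facing_le ft.
  have [uD|un] := boolP (in_defect (p u)); [by left|right].
  have [_] := wu tD un; apply.
  by rewrite lt_neqAle tu andbT; apply: contraNneq un => <-.
move=> t ta tb hS; have [t0 t1] : 0 <= t /\ t <= 1 by rlra.
have [tD|tn] := boolP (in_defect (p t)); [by left|right].
have [e e0 he] := near_in_window (near_inI
  (within_near_in cp t0 t1 (near_carrier T (p t))) (within_near_in cp t0 t1 (near_bulk tn))).
have [u [u1 u2 u3]] := exists_before ta e0.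
have [||||cu un] := he u; try rlra.
case: (hS u u1 u2) => [|fu]; first by rewrite (negbTE un).
exact: (facing_ge cu fu tn (yt t (ltW ta) tb) dy).
Qed.

Lemma bulk_same_facing p y a b c : directed_path p -> in_defect y -> 0 <= a -> a <= b -> b <= 1 ->
  (forall t, a <= t -> t <= b -> car y \subset car (p t)) ->
  (forall t, a <= t -> t <= b -> ~~ in_defect (p t)) -> facing T c (p a) -> facing T c (p b).
Proof.
move=> dp yD a0 ab b1 hy hn; have [cp _] := dp.
have yt t : a <= t -> t <= b -> vtx y \in car (p t).
  by move=> ta tb; apply: (fintype.subsetP (hy t ta tb)); exact: nearby_vertex_in.
have dy : dv (vtx y) by rewrite nearby_vertex_in_defect.
apply: (@interval_additive_induction _
  (fun u v => facing T c (p u) -> facing T c (p v)) a b) => //.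
  by move=> u v w _ _ _ _ h1 h2 /h1.
move=> t /andP[ta tb]; have [t0 t1] : 0 <= t /\ t <= 1 by rlra.
have [e e0 he] := near_in_window (within_near_in cp t0 t1 (near_carrier T (p t))).
exists e => // u v au ut tv vb ue ve fu.
have cv : car (p t) \subset car (p v) by apply: he; rlra.
have cu : car (p t) \subset car (p u) by apply: he; rlra.
exact: (facing_le cv (facing_ge cu fu (hn t ta tb) (yt t ta tb) dy)).
Qed.

(** If y lies in the bulk, so does the arc, and all steps to y are invertible.  If y lies in
    the defect, the facing conditions at the ends force the arc to visit the defect, since
    otherwise it would face the same way at both ends; before that visit its points can step
    to y, and after it y can step to them. *)
Lemma holonomy_through p y a b : directed_path p -> 0 <= a -> a <= b -> b <= 1 ->
  (forall t, a <= t -> t <= b -> car y \subset car (p t)) ->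
  (in_defect y -> ~~ in_defect (p a) -> facing T true (p a)) ->
  (in_defect y -> ~~ in_defect (p b) -> facing T false (p b)) ->
  holonomy p a b = G (p a) y ** G y (p b).
Proof.
move=> dp a0 ab b1 hy fa fb.
have yin t : a <= t -> t <= b -> vtx y \in car (p t).
  by move=> ta tb; apply: (fintype.subsetP (hy t ta tb)); exact: nearby_vertex_in.
have [yD|yn] := boolP (in_defect y); last first.
  have tn t : a <= t -> t <= b -> in_defect (p t) = in_defect y.
    move=> ta tb; rewrite (negbTE yn); apply/negbTE/(carrier_bulk (yin t ta tb)).
    by rewrite nearby_vertex_in_defect.
  have [s [ps sa sb]] := exists_holonomy L dp a0 ab b1.
  have := parallel_to dp a0 b1 ps (y := y) _ ab (lexx b).
  rewrite sa sb (one_point_transition L (carrier_in T (p a))) ?nearby_vertex_in ?yin ?lexx //;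
    last by apply: same_pass; rewrite tn ?lexx.
  move=> <-; last by move=> t ta tb; split; [exact: hy|apply: same_pass; rewrite tn].
  have K1 : G (p b) y ** G y (p b) = one (p b).
    apply: (point_transitionK L (carrier_in T (p b))); first exact: nearby_vertex_in.
      exact: yin ab (lexx b).
    exact: tn ab (lexx b).
  by rewrite -pcompA K1 holonomy_one.
have [c [ac cb cD]] : exists c, [/\ a <= c, c <= b & in_defect (p c)].
  apply: contrapT => nc.
  have allb t : a <= t -> t <= b -> ~~ in_defect (p t).
    by move=> ta tb; apply/negP => tD; apply: nc; exists t.
  have f1 := fa yD (allb a (lexx a) ab); have f2 := fb yD (allb b ab (lexx b)).
  exact: facing_exclusive (bulk_same_facing dp yD a0 ab b1 hy allb f1) f2.
have [c0 c1] : 0 <= c /\ c <= 1 by rlra.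
have sameyc : in_defect (p c) = in_defect y by rewrite cD yD.
have pass_to t : a <= t -> t <= c -> pass (p t) y.
  move=> ta tc; have [tD|tn] := boolP (in_defect (p t)); first by apply: same_pass; rewrite tD yD.
  apply: facing_in_pass => //; first by apply: hy; rlra.
  apply: (before_defect_facing dp yD _ tc) => //; try rlra.
  by move=> u tu uc; apply: hy; rlra.
have pass_from t : c <= t -> t <= b -> pass y (p t).
  move=> ct tb; have [tD|tn] := boolP (in_defect (p t)); first by apply: same_pass; rewrite tD yD.
  apply: facing_out_pass => //; first by apply: hy; rlra.
  apply: (after_defect_facing dp yD c0 ct) => //; try rlra.
  by move=> u tu uc; apply: hy; rlra.
have cin : vtx (p c) \in car (p c) by exact: nearby_vertex_in.
have yc := yin c ac cb.
have hac : holonomy p a c = G (p a) y ** G y (p c).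
  have [s [ps sa sc]] := exists_holonomy L dp a0 ac c1.
  have h : forall t, a <= t -> t <= c -> car y \subset car (p t) /\ pass (p t) y.
    by move=> t ta tc; split; [apply: hy; rlra|exact: pass_to].
  have := parallel_to dp a0 c1 ps h ac (lexx c).
  rewrite sa sc (one_point_transition L (carrier_in T (p a))) ?nearby_vertex_in ?yin ?lexx ?pass_to ?lexx //.
  move=> <-; rewrite -pcompA (point_transitionK L (carrier_in T (p c))) //.
  by rewrite holonomy_one.
have hcb : holonomy p c b = G (p c) y ** G y (p b).
  have [s [ps sa sc]] := exists_holonomy L dp c0 cb b1.
  have h : forall t, c <= t -> t <= b -> car y \subset car (p t) /\ pass y (p t).
    by move=> t ta tc; split; [apply: hy; rlra|exact: pass_from].
  rewrite -sc; apply: (parallel_from dp c0 b1 ps h) => //.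
  by rewrite sa (point_transitionK L (carrier_in T (p c))).
rewrite -(holonomy_cat L dp a0 ac cb b1) hac hcb pcompA -(pcompA (G (p a) y)).
rewrite (point_transitionK L (carrier_in T (p c))) //.
by rewrite (point_transition_one L (carrier_in T (p a))) ?nearby_vertex_in ?yin ?lexx ?pass_to ?lexx.
Qed.

End HolonomyAlongPaths.

(** * Homotopy invariance of the holonomy *)

Section HolonomyInvariance.
Variables (R : realType) (d : nat) (X : manifold_with_defect R d).
Variable T : directed_triangulation X.
Variable C : parcel Gamma2.
Variable L : edge_system T C.
Local Notation I := (`[(0 : R), 1]%classic).
Local Notation holonomy := (holonomy L).
Local Notation parallel := (parallel L).
Local Notation car := (carrier_simplex T).
Implicit Types (x y z : X) (p q : R -> X) (a b t r : R).
Implicit Types (f : option (arrow C)).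

Local Notation G := (point_transition L).
Local Notation one x := (unit_over C (kind (in_defect x))).

Lemma holonomy_same p a b k : directed_path p -> 0 <= a -> a <= b -> b <= 1 ->
  (forall t, a <= t -> t <= b -> in_defect (p t) = k) ->
  lies_above (step_arrow k k) (holonomy p a b).
Proof.
move=> dp a0 ab b1 hk.
apply: (@interval_additive_induction _
  (fun u v => lies_above (step_arrow k k) (holonomy p u v)) a b) => //.
  move=> u v w au uv vw wb h1 h2; rewrite -(holonomy_cat L dp (b := v)) //; try rlra.
  apply: (lies_above_comp (system_regular L) _ h1 h2).
  by apply: composes_step; left.
move=> t /andP[ta tb]; have [t0 t1] : 0 <= t /\ t <= 1 by rlra.
have [e e0 [hl hr]] := near_holonomy L dp t0 t1.
exists e => // u v au ut tv vb ue ve.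
rewrite -(holonomy_cat L dp (b := t)) //; try rlra.
have [||| -> cu pu] := hl u; try rlra; have [||| -> cv pv] := hr v; try rlra.
apply: (lies_above_comp (system_regular L) (composes_step (or_introl erefl))).
  rewrite -{1}(hk u) -1?(hk t) //; last by rlra.
  apply: (point_transition_above L (carrier_in T (p u))) => //; first exact: nearby_vertex_in.
  exact: (fintype.subsetP cu) (nearby_vertex_in _ _).
rewrite -{1}(hk t) -1?(hk v) //; last by rlra.
apply: (point_transition_above L (carrier_in T (p v))) => //; last exact: nearby_vertex_in.
exact: (fintype.subsetP cv) (nearby_vertex_in _ _).
Qed.

Lemma traverses_le p a b w : traverses p a b w -> a <= b.
Proof.
elim=> // {a b w}.
- by move=> a c b /andP[ac cb] *; rlra.
- by move=> a c b /andP[ac cb] *; rlra.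
- by move=> a c b v w u _ ac _ cb _; exact: le_trans cb.
Qed.

Lemma holonomy_traverses p a b w : directed_path p -> traverses p a b w ->
  0 <= a -> b <= 1 -> lies_above w (holonomy p a b).
Proof.
move=> dp; elim=> {a b w}.
- move=> a b ab /in_defectP an h a0 b1.
  apply: (@holonomy_same _ _ _ false) => // t ta tb; rewrite (@stratum_in_defect _ _ _ (p a)).
    exact/negbTE.
  by apply: h; rewrite ta.
- move=> a b ab /in_defectP aD h a0 b1.
  apply: (@holonomy_same _ _ _ true) => // t ta tb; rewrite (@stratum_in_defect _ _ _ (p a)) //.
  by apply: h; rewrite ta.
- move=> a c b /andP[ac cb] /in_defectP an /in_defectP bD h1 h2 a0 b1.
  have k1 t : a <= t -> t < c -> in_defect (p t) = false.
    by move=> ta tc; rewrite (@stratum_in_defect _ _ _ (p a)); [exact/negbTE|apply: h1; rewrite ta].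
  have k2 t : c <= t -> t <= b -> in_defect (p t) = true.
    by move=> ta tc; rewrite (@stratum_in_defect _ _ _ (p b)) //; apply: h2; rewrite ta.
  have [c0 c1] : 0 <= c /\ c <= 1 by rlra.
  have [e e0 [hl _]] := near_holonomy L dp c0 c1.
  have [u [u1 u2 u3]] := exists_before ac e0.
  rewrite -(holonomy_cat L dp (b := c)) //; try rlra.
  rewrite -(holonomy_cat L dp (a := a) (b := u)) //; try rlra.
  have [||| -> cu pu] := hl u; try rlra.
  apply: (lies_above_comp (system_regular L) (@composes_step false true true (or_intror erefl))).
    apply: (lies_above_comp (system_regular L) (@composes_step false false true (or_introl erefl))).
      apply: holonomy_same => //; try rlra.
      by move=> t ta tu; apply: k1; rlra.
    rewrite -(k1 u) // -(k2 c) //.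
    apply: (point_transition_above L (carrier_in T (p u))) => //; first exact: nearby_vertex_in.
    exact: (fintype.subsetP cu) (nearby_vertex_in _ _).
  by apply: holonomy_same.
- move=> a c b /andP[ac cb] /in_defectP aD /in_defectP bn h1 h2 a0 b1.
  have k1 t : a <= t -> t <= c -> in_defect (p t) = true.
    by move=> ta tc; rewrite (@stratum_in_defect _ _ _ (p a)) //; apply: h1; rewrite ta.
  have k2 t : c < t -> t <= b -> in_defect (p t) = false.
    by move=> ta tc; rewrite (@stratum_in_defect _ _ _ (p b)); [exact/negbTE|apply: h2; rewrite ta].
  have [c0 c1] : 0 <= c /\ c <= 1 by rlra.
  have [e e0 [_ hr]] := near_holonomy L dp c0 c1.
  have [u [u2 /ltW u1 u3]] := exists_after cb e0.
  rewrite -(holonomy_cat L dp (b := c)) //; try rlra.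
  rewrite -(holonomy_cat L dp (a := c) (b := u)) //; try rlra.
  have [||| -> cu pu] := hr u; try rlra.
  apply: (lies_above_comp (system_regular L) (@composes_step true true false (or_introl erefl))).
    by apply: holonomy_same.
  apply: (lies_above_comp (system_regular L) (@composes_step true false false (or_intror erefl))).
    rewrite -(k2 u) // -(k1 c) //.
    apply: (point_transition_above L (carrier_in T (p u))) => //; last exact: nearby_vertex_in.
    exact: (fintype.subsetP cu) (nearby_vertex_in _ _).
  apply: holonomy_same => //; try rlra.
  by move=> t ta tu; apply: k2; rlra.
- move=> a c b v w u /traverses_le ac IH1 /traverses_le cb IH2 vwu a0 b1.
  rewrite -(holonomy_cat L dp (b := c)) //.
  by apply: (lies_above_comp (system_regular L) vwu); [apply: IH1|apply: IH2]; rlra.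
Qed.

Lemma constant_holonomy x a b : 0 <= a -> a <= b -> b <= 1 ->
  holonomy (fun=> x) a b = one x.
Proof.
move=> a0 ab b1; rewrite -[RHS](point_transition_refl L).
apply: (@holonomy_to _ _ _ _ _ L (fun=> x)) => //; first exact: directed_cst.
by move=> t _ _; split; [exact: fintype.subxx|exact: pass_refl].
Qed.

Lemma constant_increasing r : 0 <= r <= 1 -> weakly_increasing (fun _ : R => r).
Proof.
by move=> r01; apply: weakly_increasing_continuous => //; exact: cst_continuous.
Qed.

Section Homotopy.
Variable h : R * R -> X.
Hypothesis ch : {within I `*` I, continuous h}.
Hypothesis dh : forall a b : R -> R, weakly_increasing a -> weakly_increasing b ->
  directed_path (fun t => h (a t, b t)).

Let horizontal r : 0 <= r <= 1 -> directed_path (fun t => h (t, r)).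
Proof. by move=> r01; exact: (dh (@weakly_increasing_id R) (constant_increasing r01)). Qed.

Let vertical r : 0 <= r <= 1 -> directed_path (fun t => h (r, t)).
Proof. by move=> r01; exact: (dh (constant_increasing r01) (@weakly_increasing_id R)). Qed.

Definition rectangle_commutes t t' u u' : Prop :=
  holonomy (fun r => h (r, u)) t t' ** holonomy (fun r => h (t', r)) u u' =
  holonomy (fun r => h (t, r)) u u' ** holonomy (fun r => h (r, u')) t t'.

Lemma rectangle_paste_vertical t t' u v w : 0 <= t -> t <= t' -> t' <= 1 ->
  0 <= u -> u <= v -> v <= w -> w <= 1 ->
  rectangle_commutes t t' u v -> rectangle_commutes t t' v w -> rectangle_commutes t t' u w.
Proof.
move=> t0 tt t1 u0 uv vw w1 e1 e2; rewrite /rectangle_commutes.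
have [V V'] : directed_path (fun r => h (t, r)) /\ directed_path (fun r => h (t', r)).
  by split; apply: vertical; rlra.
rewrite -(holonomy_cat L V' u0 uv vw w1) -(holonomy_cat L V u0 uv vw w1).
by rewrite pcompA e1 -pcompA e2 pcompA.
Qed.

Lemma rectangle_paste_horizontal t t' t'' u u' : 0 <= t -> t <= t' -> t' <= t'' -> t'' <= 1 ->
  0 <= u -> u <= u' -> u' <= 1 ->
  rectangle_commutes t t' u u' -> rectangle_commutes t' t'' u u' -> rectangle_commutes t t'' u u'.
Proof.
move=> t0 tt tt' t1 u0 uv u1 e1 e2; rewrite /rectangle_commutes.
have [V V'] : directed_path (fun r => h (r, u)) /\ directed_path (fun r => h (r, u')).
  by split; apply: horizontal; rlra.
rewrite -(holonomy_cat L V' t0 tt tt' t1) -(holonomy_cat L V t0 tt tt' t1).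
by rewrite -pcompA e2 pcompA e1 pcompA.
Qed.

(** Both boundary paths of a small rectangle around (t, u) have the holonomy of the broken
    line through h (t, u): by [before_defect_facing] and [after_defect_facing], the corners
    are placed with respect to the defect as [holonomy_through] requires. *)
Lemma near_rectangle_commutes t u : 0 <= t <= 1 -> 0 <= u <= 1 -> exists2 e, 0 < e &
  forall a b c c', 0 <= a -> a <= t -> t <= b -> b <= 1 -> t - a < e -> b - t < e ->
    0 <= c -> c <= u -> u <= c' -> c' <= 1 -> u - c < e -> c' - u < e ->
    rectangle_commutes a b c c'.
Proof.
move=> t01 u01; set y := h (t, u).
have [e e0 he] : exists2 e, 0 < e & forall r s, 0 <= r <= 1 -> 0 <= s <= 1 ->
    `|r - t| < e -> `|s - u| < e -> car y \subset car (h (r, s)).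
  have Itu : (I `*` I) (t, u) by rewrite /setX /= !in_itv.
  have /subspace_continuousP/(_ (t, u) Itu) := ch.
  move=> /(_ _ (near_carrier T (h (t, u)))).
  rewrite /nbhs /= /within /= => -[[A B] /= [/nbhs_ballP[e1 /= e10 hA] /nbhs_ballP[e2 /= e20 hB]] AB].
  exists (Num.min e1 e2); first by rewrite lt_min e10.
  move=> r s r01 s01; rewrite !lt_min => /andP[r1 _] /andP[_ s2].
  apply: (AB (r, s)); last by rewrite /= !in_itv.
  by split; [apply: hA|apply: hB]; rewrite /ball /= distrC.
exists e => // a b c c' a0 at_ tb b1 ae be c0 cu uc' c1 ce ce'.
have star r s : a <= r -> r <= b -> c <= s -> s <= c' -> car y \subset car (h (r, s)).
  by move=> ? ? ? ?; apply: he; rewrite ?ltr_norml; apply/andP; split; rlra.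
have segment (a1 a2 c1' c2 : R) : 0 <= a1 -> a1 <= a2 -> a2 <= 1 -> 0 <= c1' -> c1' <= c2 -> c2 <= 1 ->
    directed_path (fun r => h (a1 + r * (a2 - a1), c1' + r * (c2 - c1'))).
  by move=> *; apply: dh; exact: affine_increasing.
have lower : in_defect y -> ~~ in_defect (h (a, c)) -> facing T true (h (a, c)).
  move=> yD acn; have dq : directed_path (fun r => h (a + r * (t - a), c + r * (u - c))).
    by apply: segment; rlra.
  have := before_defect_facing dq yD (lexx 0) ler01 (lexx 1); rewrite !mul0r !addr0 !mul1r !subrKC.
  by apply=> // r r0 r1; apply: star; nra.
have upper : in_defect y -> ~~ in_defect (h (b, c')) -> facing T false (h (b, c')).
  move=> yD acn; have dq : directed_path (fun r => h (t + r * (b - t), u + r * (c' - u))).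
    by apply: segment; rlra.
  have := after_defect_facing dq yD (lexx 0) ler01 (lexx 1); rewrite !mul0r !addr0 !mul1r !subrKC.
  by apply=> // r r0 r1; apply: star; nra.
have boundary q q' (r1 r2 s1 s2 : R) : directed_path q -> directed_path q' ->
    0 <= r1 -> r1 <= r2 -> r2 <= 1 -> 0 <= s1 -> s1 <= s2 -> s2 <= 1 ->
    q r2 = q' s1 -> q r1 = h (a, c) -> q' s2 = h (b, c') ->
    (forall r, r1 <= r -> r <= r2 -> car y \subset car (q r)) ->
    (forall s, s1 <= s -> s <= s2 -> car y \subset car (q' s)) ->
    holonomy q r1 r2 ** holonomy q' s1 s2 = G (h (a, c)) y ** G y (h (b, c')).
  move=> dq dq' r10 r12 r21 s10 s12 s21 qq q1 q2 sq sq'.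
  have d1 := directed_path_comp dq (affine_increasing r10 r12 r21).
  have d2 := directed_path_comp dq' (affine_increasing s10 s12 s21).
  rewrite -(holonomy_restriction L dq) // -(holonomy_restriction L dq') //.
  have glue : path_restriction q r1 r2 1 = path_restriction q' s1 s2 0.
    by rewrite /path_restriction mul1r subrKC mul0r addr0.
  rewrite -holonomy_concat // (@holonomy_through _ _ _ _ _ L _ y) ?ler01 //.
  - rewrite /path_concat invr_ge0 ler0n mulr0 /path_restriction mul0r addr0 q1.
    rewrite (_ : (1 <= 2^-1 :> R) = false); last by apply/negbTE; rlra.
    by rewrite (_ : 2 * 1 - 1 = 1 :> R) ?mul1r ?subrKC ?q2 //; ring.
  - exact: directed_concat.
  - move=> r r0 rle1; rewrite /path_concat /path_restriction; case: leP => hr.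
      by apply: sq; nra.
    by apply: sq'; nra.
  - rewrite /path_concat invr_ge0 ler0n mulr0 /path_restriction mul0r addr0 q1.
    exact: lower.
  rewrite /path_concat (_ : (1 <= 2^-1 :> R) = false); last by apply/negbTE; rlra.
  rewrite (_ : 2 * 1 - 1 = 1 :> R); last by ring.
  by rewrite /path_restriction mul1r subrKC q2.
rewrite /rectangle_commutes boundary //; try rlra.
- rewrite boundary //; try rlra.
  + by apply: vertical; rlra.
  + by apply: horizontal; rlra.
  + by move=> r r1 r2; apply: star; rlra.
  + by move=> r r1 r2; apply: star; rlra.
- by apply: horizontal; rlra.
- by apply: vertical; rlra.
- by move=> r r1 r2; apply: star; rlra.
- by move=> r r1 r2; apply: star; rlra.
Qed.

(** Small rectangles paste together, first along one coordinate and then along the other. *)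
Lemma square_commutes : rectangle_commutes 0 1 0 1.
Proof.
apply: (@interval_additive_induction _ (fun t t' => rectangle_commutes t t' 0 1) 0 1) => //.
  move=> x y z x0 xy yz z1; apply: rectangle_paste_horizontal; rlra.
move=> t /andP[t0 t1].
pose Q u u' := exists2 e, 0 < e & forall a b, 0 <= a -> a <= t -> t <= b -> b <= 1 ->
  t - a < e -> b - t < e -> rectangle_commutes a b u u'.
suff : Q 0 1 by case=> e e0 he; exists e => // a b; exact: he.
apply: (@interval_additive_induction _ Q 0 1) => //.
  move=> u v w u0 uv vw w1 [e e0 he] [e' e0' he'].
  exists (Num.min e e'); first by rewrite lt_min e0.
  move=> a b a0 at_ tb b1; rewrite !lt_min => /andP[ae ae'] /andP[be be'].
  apply: (rectangle_paste_vertical _ _ _ _ uv vw) => //; try rlra.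
    exact: he.
  exact: he'.
move=> u u01; have t01 : 0 <= t <= 1 by rewrite t0.
have [e e0 he] := near_rectangle_commutes t01 u01.
exists e => // c c' c0 cu uc c1 ce ce'; exists e => // a b a0 at_ tb b1 ae be.
exact: he.
Qed.

End Homotopy.

Lemma holonomy_homotopic x y (p q : dpath x y) : immediately_dhomotopic p q ->
  holonomy p 0 1 = holonomy q 0 1.
Proof.
move=> [h [ch hpq hxy dh]].
have I01 : 0 <= (0 : R) <= 1 /\ 0 <= (1 : R) <= 1 by rewrite !lexx ler01.
have Icc t : 0 <= t -> t <= 1 -> I t by move=> *; rewrite /= in_itv; apply/andP.
have hor r : 0 <= r <= 1 -> directed_path (fun t => h (t, r)).
  by move=> r01; exact: (dh _ _ (@weakly_increasing_id R) (constant_increasing r01)).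
have ver r : 0 <= r <= 1 -> directed_path (fun t => h (r, t)).
  by move=> r01; exact: (dh _ _ (constant_increasing r01) (@weakly_increasing_id R)).
have := square_commutes ch dh; rewrite /rectangle_commutes.
have ep : holonomy (fun r => h (r, 0)) 0 1 = holonomy p 0 1.
  apply: holonomy_ext; rewrite ?ler01 ?lexx //; first by apply: hor; case: I01.
    exact: dpath_directed.
  by move=> t t0 t1; have [] := hpq t (Icc t t0 t1).
have eq_ : holonomy (fun r => h (r, 1)) 0 1 = holonomy q 0 1.
  apply: holonomy_ext; rewrite ?ler01 ?lexx //; first by apply: hor; case: I01.
    exact: dpath_directed.
  by move=> t t0 t1; have [] := hpq t (Icc t t0 t1).
have e0 : holonomy (fun r => h (0, r)) 0 1 = one (p 0).
  rewrite dpath0 -(@constant_holonomy x 0 1) ?ler01 ?lexx //.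
  apply: holonomy_ext; rewrite ?ler01 ?lexx //; first by apply: ver; case: I01.
    exact: directed_cst.
  by move=> t t0 t1; have [] := hxy t (Icc t t0 t1).
have e1 : holonomy (fun r => h (1, r)) 0 1 = one (p 1).
  rewrite dpath1 -(@constant_holonomy y 0 1) ?ler01 ?lexx //.
  apply: holonomy_ext; rewrite ?ler01 ?lexx //; first by apply: ver; case: I01.
    exact: directed_cst.
  by move=> t t0 t1; have [] := hxy t (Icc t t0 t1).
rewrite ep eq_ e0 e1 holonomy_one ?lexx ?ler01 //; last exact: dpath_directed.
have -> : one (p 0) = one (q 0) by rewrite !dpath0.
by rewrite one_holonomy ?lexx ?ler01 //; exact: dpath_directed.
Qed.

Lemma holonomy_dequiv x y (p q : dpath x y) : dequiv p q -> holonomy p 0 1 = holonomy q 0 1.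
Proof.
elim=> {p q} [p q [[s [ms s0 s1 pq]]|]|//|p q _ -> //|p q r _ -> _ -> //].
  have dp := dpath_directed p.
  rewrite -[in LHS]s0 -[in LHS]s1 -holonomy_reparam ?ler01 ?lexx //.
  apply: holonomy_ext; rewrite ?lexx ?ler01 //; first exact: directed_path_comp.
    exact: dpath_directed.
  by move=> t t0 t1; rewrite pq //= in_itv /= t0.
exact: holonomy_homotopic.
Qed.

End HolonomyInvariance.

(** * Relations in the fundamental category *)

Section Clamp.
Variable R : realType.
Implicit Types (r t u : R).

Definition clamp r : R := Num.max 0 (Num.min 1 r).

Lemma clampE r : [\/ r <= 0 /\ clamp r = 0, 0 <= r <= 1 /\ clamp r = r | 1 <= r /\ clamp r = 1].
Proof.
rewrite /clamp; case: (leP 1 r) => h1.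
  by constructor 3; split=> //; case: (leP 0 1) => ?; lin.
case: (leP 0 r) => h2; first by constructor 2; split=> //; lin.
by constructor 1; split=> //; lin.
Qed.

Lemma clamp01 r : 0 <= clamp r <= 1.
Proof. by case: (clampE r) => -[h ->]; lin. Qed.

Lemma clamp_le r t : r <= t -> clamp r <= clamp t.
Proof. by case: (clampE r) => -[h ->]; case: (clampE t) => -[h' ->]; lin. Qed.

Lemma clamp_id r : 0 <= r <= 1 -> clamp r = r.
Proof. by case: (clampE r) => -[h ->]; lin. Qed.

Lemma clamp_continuous : continuous clamp.
Proof.
apply: continuous_maxr; first exact: cst_continuous.
apply: continuous_minr; first exact: cst_continuous.
by move=> t; exact: cvg_id.
Qed.

Lemma clamp_affine_continuous (k l : R) : continuous (fun t => clamp (k * t + l)).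
Proof.
move=> t; apply: (@continuous_comp _ _ _ (fun t => k * t + l) clamp).
  exact: continuous_affine.
exact: clamp_continuous.
Qed.

Lemma clamp_affine_increasing (k l : R) : 0 <= k -> weakly_increasing (fun t => clamp (k * t + l)).
Proof.
move=> k0; apply: weakly_increasing_continuous; first exact: clamp_affine_continuous.
  by move=> t _; rewrite /= in_itv /= clamp01.
by move=> t u _ _ tu; apply: clamp_le; rewrite lerD2r ler_wpM2l.
Qed.

Ltac clamp_cases :=
  repeat match goal with |- context [clamp ?e] => case: (clampE e) => -[? ->] end; lin.

Lemma clamp_late_first t : clamp (2 * t - 1) <= 2^-1 ->
  clamp (4 * t - 2) = clamp (2 * clamp (2 * t - 1)) /\ clamp (4 * t - 3) = 0.
Proof.
case: (clampE (2 * t - 1)) => -[? ->] ?; split; clamp_cases.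
Qed.

Lemma clamp_late_second t : 2^-1 <= clamp (2 * t - 1) ->
  clamp (4 * t - 2) = 1 /\ clamp (4 * t - 3) = clamp (2 * clamp (2 * t - 1) - 1).
Proof. by case: (clampE (2 * t - 1)) => -[? ->] ?; split; clamp_cases. Qed.

Lemma clamp_early_first t : clamp (2 * t) <= 2^-1 ->
  clamp (4 * t - 1) = 0 /\ clamp (4 * t + 0) = clamp (2 * clamp (2 * t)).
Proof. by case: (clampE (2 * t)) => -[? ->] ?; split; clamp_cases. Qed.

Lemma clamp_early_second t : 2^-1 <= clamp (2 * t) ->
  clamp (4 * t - 1) = clamp (2 * clamp (2 * t) - 1) /\ clamp (4 * t + 0) = 1.
Proof. by case: (clampE (2 * t)) => -[? ->] ?; split; clamp_cases. Qed.

Lemma interpolation01 (s x y : R) : 0 <= s <= 1 -> 0 <= x <= 1 -> 0 <= y <= 1 ->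
  0 <= (1 - s) * x + s * y <= 1.
Proof. by move=> *; nra. Qed.

Lemma interpolation_le (s s' x x' y y' : R) : 0 <= s -> s <= s' -> s' <= 1 ->
  x <= x' -> y <= y' -> x' <= y' -> (1 - s) * x + s * y <= (1 - s') * x' + s' * y'.
Proof. by move=> *; nra. Qed.

End Clamp.

Section Cells.
Variables (R : realType) (d : nat) (X : manifold_with_defect R d).
Local Notation I := (`[(0 : R), 1]%classic).
Implicit Types (x y z w : X) (p q : R -> X) (a b : R -> R) (r t s u : R).

Let IE t : I t <-> 0 <= t <= 1.
Proof. by rewrite /= in_itv. Qed.

Lemma path_concatE x y z (p : dpath x y) (q : dpath y z) t : 0 <= t <= 1 ->
  path_concat p q t = if t <= 2^-1 then p (clamp (2 * t)) else q (clamp (2 * t - 1)).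
Proof.
move=> t01; rewrite /path_concat; case: leP => h; rewrite clamp_id //; lin.
Qed.

(** The homotopy moves along straight lines of the square from the lower boundary, delayed
    until the upper boundary has been run through, to the upper boundary; with that delay
    both coordinates increase along the homotopy. *)
Lemma cell_dequiv x y z w (h : R * R -> X) (bot : dpath x y) (right_ : dpath y z)
    (left_ : dpath x w) (top_ : dpath w z) :
  {within I `*` I, continuous h} ->
  (forall a b, weakly_increasing a -> weakly_increasing b -> directed_path (fun t => h (a t, b t))) ->
  (forall t, 0 <= t <= 1 -> [/\ bot t = h (t, 0), right_ t = h (1, t),
     left_ t = h (0, t) & top_ t = h (t, 1)]) ->
  dequiv (dpath_concat bot right_) (dpath_concat left_ top_).
Proof.
move=> ch dh hE.
have h01 : 0 <= (0 : R) <= 1 /\ 0 <= (1 : R) <= 1 by rewrite !lexx ler01.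
have hx : h (0, 0) = x by have [<- _ _ _] := hE 0 (proj1 h01); rewrite dpath0.
have hz : h (1, 1) = z by have [_ <- _ _] := hE 1 (proj2 h01); rewrite dpath1.
pose late t := clamp (2 * t - 1); pose early t := clamp (2 * t).
have lateI : weakly_increasing late by apply: (@clamp_affine_increasing R 2 (-1)).
have earlyI : weakly_increasing early.
  have := @clamp_affine_increasing R 2 0 _; under eq_fun do rewrite addr0.
  by apply.
have late0 : late 0 = 0 by rewrite /late; case: (clampE (2 * 0 - 1 : R)) => -[? ->]; lin.
have late1 : late 1 = 1 by rewrite /late; case: (clampE (2 * 1 - 1 : R)) => -[? ->]; lin.
have early0 : early 0 = 0 by rewrite /early; case: (clampE (2 * 0 : R)) => -[? ->]; lin.
have early1 : early 1 = 1 by rewrite /early; case: (clampE (2 * 1 : R)) => -[? ->]; lin.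
pose lower := dpath_concat bot right_; pose upper := dpath_concat left_ top_.
have lower0 : (lower \o late) 0 = x by rewrite /= late0 dpath_concat0.
have lower1 : (lower \o late) 1 = z by rewrite /= late1 dpath_concat1.
have upper0 : (upper \o early) 0 = x by rewrite /= early0 dpath_concat0.
have upper1 : (upper \o early) 1 = z by rewrite /= early1 dpath_concat1.
pose p0 := DPath (directed_path_comp (dpath_directed lower) lateI) lower0 lower1.
pose p1 := DPath (directed_path_comp (dpath_directed upper) earlyI) upper0 upper1.
apply: (@rst_trans _ _ _ p0); first exact: (dequiv_reparam (s := late)).
apply: (@rst_trans _ _ _ p1); last by apply/rst_sym/(dequiv_reparam (s := early)).
apply: rst_step; right.
pose A s t : R := (1 - s) * clamp (4 * t - 2) + s * clamp (4 * t - 1).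
pose B s t : R := (1 - s) * clamp (4 * t - 3) + s * clamp (4 * t + 0).
have c01 := @clamp01 R.
have AI s t : 0 <= s <= 1 -> 0 <= A s t <= 1.
  by move=> ?; exact: interpolation01.
have BI s t : 0 <= s <= 1 -> 0 <= B s t <= 1.
  by move=> ?; exact: interpolation01.
have cAB (k l k' l' : R) : continuous (fun v : R * R =>
    (1 - v.2) * clamp (k * v.1 + l) + v.2 * clamp (k' * v.1 + l')).
  have ccl (m n : R) : continuous (fun v : R * R => clamp (m * v.1 + n)).
    move=> v; apply: (@continuous_comp _ _ _ fst (fun t => clamp (m * t + n))).
      exact: cvg_fst.
    exact: clamp_affine_continuous.
  move=> v; apply: cvgD; apply: cvgM; try exact: ccl; last exact: cvg_snd.
  by apply: cvgB; [exact: cvg_cst|exact: cvg_snd].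
exists (fun v => h (A v.2 v.1, B v.2 v.1)); split.
- apply: (@within_comp _ _ _ (I `*` I) (I `*` I) (fun v => (A v.2 v.1, B v.2 v.1)) h _ ch).
    by apply: within_pair; apply: continuous_subspaceT; exact: cAB.
  by move=> v [_ /IE v2]; split; apply/IE; [exact: AI|exact: BI].
- move=> t /IE t01; rewrite /= /A /B subr0 subrr !mul1r !mul0r !add0r !(addr0 (clamp _)).
  split; rewrite path_concatE ?c01 //; case: leP => ht.
  + have [e1 e2] := clamp_late_first ht.
    by have [-> _ _ _] := hE _ (c01 (2 * late t)); rewrite e1 e2.
  + have [e1 e2] := clamp_late_second (ltW ht).
    by have [_ -> _ _] := hE _ (c01 (2 * late t - 1)); rewrite e1 e2.
  + have [e1 e2] := clamp_early_first ht.
    by have [_ _ -> _] := hE _ (c01 (2 * early t)); rewrite e1 e2.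
  + have [e1 e2] := clamp_early_second (ltW ht).
    by have [_ _ _ ->] := hE _ (c01 (2 * early t - 1)); rewrite e1 e2.
- move=> s /IE s01; rewrite /= -hx -hz.
  have e0 (k l : R) : l <= 0 -> clamp (k * 0 + l) = 0 by move=> ?; rewrite mulr0 add0r; case: (clampE l) => -[? ->]; lin.
  have e1 (k l : R) : 1 <= k + l -> clamp (k * 1 + l) = 1 by move=> ?; rewrite mulr1; case: (clampE (k + l)) => -[? ->]; lin.
  rewrite /A /B; split; congr (h (_, _)); rewrite ?e0 ?e1; lin.
move=> a b [ca Ia ma] [cb Ib mb].
have incr (k l k' l' : R) : 0 <= k -> 0 <= k' -> (forall t, 0 <= t <= 1 -> k * t + l <= k' * t + l') ->
    weakly_increasing (fun t => (1 - b t) * clamp (k * a t + l) + b t * clamp (k' * a t + l')).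
  move=> k0 k0' hk; split.
  - apply: (@within_comp _ _ _ I (I `*` I) (fun t => (a t, b t)) (fun v : R * R =>
      (1 - v.2) * clamp (k * v.1 + l) + v.2 * clamp (k' * v.1 + l'))).
    + by apply: within_pair; [exact: ca|exact: cb].
    + by apply: continuous_subspaceT; exact: cAB.
    + by move=> t It; split; [exact: Ia|exact: Ib].
  - move=> t It; apply/IE; have /IE bt := Ib t It.
    exact: interpolation01.
  move=> t u It Iu tu.
  have /IE bt := Ib t It; have /IE bu := Ib u Iu.
  have /IE at_ := Ia t It; have /IE au := Ia u Iu.
  have atu := ma t u It Iu tu; have btu := mb t u It Iu tu.
  have l1 : clamp (k * a t + l) <= clamp (k * a u + l) by apply: clamp_le; nra.
  have l2 : clamp (k' * a t + l') <= clamp (k' * a u + l') by apply: clamp_le; nra.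
  have l3 : clamp (k * a u + l) <= clamp (k' * a u + l') by apply/clamp_le/hk.
  by case/andP: bt => b0 _; case/andP: bu => _ b1; exact: interpolation_le.
by apply: (dh (fun t => A (b t) (a t)) (fun t => B (b t) (a t))); apply: incr => // t t01; lin.
Qed.

(** A path inside one stratum may be travelled backwards, and the resulting loop shrinks
    through the loops that turn back earlier. *)
Lemma stratum_path_inverse x y (p : dpath x y) :
  (forall t, 0 <= t <= 1 -> in_defect (p t) = in_defect x) ->
  exists q : dpath y x, [/\ forall t, q t = p (1 - t),
    class_concat (dpath_class p) (dpath_class q) = dpath_class (dpath_id x) &
    class_concat (dpath_class q) (dpath_class p) = dpath_class (dpath_id y)].
Proof.
have half x' y' (p' : dpath x' y') (q : dpath y' x') :
    (forall t, 0 <= t <= 1 -> in_defect (p' t) = in_defect x') ->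
    (forall t, 0 <= t <= 1 -> q t = p' (1 - t)) ->
    class_concat (dpath_class p') (dpath_class q) = dpath_class (dpath_id x').
  move=> hp hq; rewrite -[RHS](class_concat1f (dpath_class (dpath_id x'))) !class_concatE.
  apply/dpath_classP; pose h (v : R * R) := p' (v.1 * (1 - v.2)).
  have vI (v : R * R) : (I `*` I) v -> 0 <= v.1 * (1 - v.2) <= 1.
    by move=> [/IE v1 /IE v2]; nra.
  have ch : {within I `*` I, continuous h}.
    apply: (@within_comp _ _ _ (I `*` I) I (fun v => v.1 * (1 - v.2)) p').
    - apply: continuous_subspaceT => v; apply: cvgM; first exact: cvg_fst.
      by apply: cvgB; [exact: cvg_cst|exact: cvg_snd].
    - exact: (proj1 (dpath_directed p')).
    - by move=> v /vI vv; apply/IE.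
  apply: (cell_dequiv ch).
    move=> a b [ca Ia ma] [cb Ib mb].
    have ab t : 0 <= t <= 1 -> (I `*` I) (a t, b t).
      by move=> /IE It; split; [exact: Ia|exact: Ib].
    apply: single_stratum_directed.
      apply: (@within_comp _ _ _ I (I `*` I) (fun t => (a t, b t)) h _ ch).
        by apply: within_pair.
      by move=> t /IE; exact: ab.
    by move=> t t01; rewrite /h !hp //; apply: vI; apply: ab => //; rewrite lexx ler01.
  move=> t t01; rewrite /h /= subr0 mulr1 mul1r mul0r subrr mulr0 dpath0; split=> //.
  exact: hq.
move=> hp; have [cp _] := dpath_directed p.
have cq : {within I, continuous (fun t => p (1 - t))}.
  apply: (@within_comp _ _ _ I I (fun t => 1 - t) p _ cp).
    by apply: continuous_subspaceT => t; apply: cvgB; [exact: cvg_cst|exact: cvg_id].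
  by move=> t /IE t01; apply/IE; lin.
have hq t : 0 <= t <= 1 -> in_defect (p (1 - t)) = in_defect x by move=> ?; apply: hp; lin.
have dq : directed_path (fun t => p (1 - t)).
  by apply: single_stratum_directed => // t t01; rewrite !hq // lexx ler01.
have q0 : p (1 - 0) = y by rewrite subr0 dpath1.
have q1 : p (1 - 1) = x by rewrite subrr dpath0.
exists (DPath dq q0 q1); split=> //; first exact: half.
apply: half => [t t01 /=|t t01 /=]; last by rewrite subKr.
by rewrite hq // -(dpath1 p) hp // lexx ler01.
Qed.

Definition subpath p (dp : directed_path p) (a b : R) (a0 : 0 <= a) (ab : a <= b) (b1 : b <= 1) :
    dpath (p a) (p b) :=
  @DPath _ _ X _ _ (path_restriction p a b) (directed_path_comp dp (affine_increasing a0 ab b1))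
    (congr1 p (etrans (congr1 (+%R a) (mul0r _)) (addr0 a)))
    (congr1 p (etrans (congr1 (+%R a) (mul1r _)) (subrKC a b))).

Lemma subpath_cat p (dp : directed_path p) (a b c : R) (a0 : 0 <= a) (ab : a <= b) (b0 : 0 <= b)
    (b1 : b <= 1) (bc : b <= c) (c1 : c <= 1) (ac : a <= c) :
  class_concat (dpath_class (subpath dp a0 ab b1)) (dpath_class (subpath dp b0 bc c1)) =
  dpath_class (subpath dp a0 ac c1).
Proof.
rewrite class_concatE; apply/dpath_classP/rst_sym.
have [ca|aLc] := leP c a.
  apply: dequiv_ext => t /IE t01; rewrite /= /path_concat /path_restriction.
  have e : b = a by lin.
  have e' : c = a by lin.
  by rewrite e e' !subrr !mulr0 !addr0; case: leP.
pose k := (b - a) / (c - a).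
have k01 : 0 <= k <= 1.
  by rewrite /k divr_ge0 ?ler_pdivrMr ?mul1r ?subr_gt0 //; lin.
have kE : k * (c - a) = b - a by rewrite /k divfK // subr_eq0 gt_eqF.
pose s t := k * clamp (2 * t + 0) + (1 - k) * clamp (2 * t - 1).
apply: (dequiv_reparam (s := s)).
- have [c1' I1 m1] := @clamp_affine_increasing R 2 0 (ler0n R 2).
  have [c2' I2 m2] := @clamp_affine_increasing R 2 (-1) (ler0n R 2).
  split.
  + move=> t; apply: cvgD; apply: cvgM; try exact: cvg_cst; [exact: c1'|exact: c2'].
  + by move=> t _; apply/IE; rewrite /s; have := clamp01 (2 * t + 0); have := clamp01 (2 * t - 1); nra.
  + by move=> t u It Iu tu; rewrite /s; have := m1 t u It Iu tu; have := m2 t u It Iu tu => /=; nra.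
- by rewrite /s mulr0 !add0r; case: (clampE (0 : R)) => -[? ->]; case: (clampE (-1 : R)) => -[? ->]; lin.
- rewrite /s mulr1; case: (clampE (2 + 0 : R)) => -[? ->]; try lin.
  by case: (clampE (2 - 1 : R)) => -[? ->]; lin.
move=> t /IE t01; rewrite /= /path_concat /path_restriction /s; case: leP => ht; congr p.
  have -> : clamp (2 * t + 0) = 2 * t by rewrite addr0 clamp_id //; lin.
  have -> : clamp (2 * t - 1) = 0 by case: (clampE (2 * t - 1)) => -[? ->]; lin.
  by rewrite -kE; ring.
have -> : clamp (2 * t + 0) = 1 by case: (clampE (2 * t + 0)) => -[? ->]; lin.
have -> : clamp (2 * t - 1) = 2 * t - 1 by rewrite clamp_id //; lin.
have -> : c - b = (1 - k) * (c - a) by rewrite mulrBl mul1r kE; ring.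
have {1}-> : b = a + k * (c - a) by rewrite kE; ring.
by ring.
Qed.

End Cells.

Section Cones.
Variables (R : realType) (d : nat) (X : manifold_with_defect R d).
Variable T : directed_triangulation X.
Local Notation I := (`[(0 : R), 1]%classic).
Local Notation vpt := (@vertex_point _ _ X T).
Local Notation dv i := (in_defect (vpt i)).
Local Notation car := (carrier_simplex T).
Implicit Types (x y z : X) (p q : R -> X) (a b : R -> R) (r s t : R).

Let IE t : I t <-> 0 <= t <= 1.
Proof. by rewrite /= in_itv. Qed.

Lemma carrier_mix_half x y : joinable T x y -> car (mix T x y 2^-1) = car x :|: car y.
Proof.
move=> jxy; rewrite carrier_mix //; last by lin.
have [-> ->] : (2^-1 == 1 :> R) = false /\ (2^-1 == 0 :> R) = false.
  by split; apply/negbTE/eqP; lin.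
by [].
Qed.

Lemma mix_facing c x y r w : joinable T x y -> 0 <= r <= 1 -> ~~ in_defect (mix T x y r) ->
  facing T c (mix T x y 2^-1) -> w \in car (mix T x y r) -> dv w -> facing T c (mix T x y r).
Proof.
move=> jxy r01 bk fc wr dw; apply: facing_ge fc bk wr dw.
by rewrite carrier_mix_half //; exact: carrier_mix_sub.
Qed.

Let comp_continuous p a : {within I, continuous p} -> weakly_increasing a ->
  {within I, continuous (fun r => p (a r))}.
Proof. by move=> cp [ca Ia _]; exact: within_comp ca cp Ia. Qed.

Section Cone.
Variables (p : R -> X) (z : X).
Hypothesis cp : {within I, continuous p}.
Hypothesis jp : forall t, 0 <= t <= 1 -> joinable T (p t) z.
Hypothesis p_defect : forall t, 0 <= t <= 1 -> in_defect (p t) -> in_defect z.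

Let mix_pz_continuous a b : weakly_increasing a -> weakly_increasing b ->
  {within I, continuous (fun r => mix T (p (a r)) z (b r))}.
Proof.
move=> ma mb; have [ca Ia _] := ma; have [cb Ib _] := mb.
apply: mix_continuous => //.
- exact: comp_continuous.
- by apply: continuous_subspaceT; exact: cst_continuous.
- by move=> r /Ia /IE; exact: jp.
Qed.

(** Such a path enters the defect once, and until then runs through inward-facing
    simplices. *)
Lemma cone_in_directed a b :
  (forall s t, 0 <= s -> s <= t -> t <= 1 -> in_defect (p s) -> in_defect (p t)) ->
  (forall t, 0 <= t <= 1 -> ~~ in_defect (p t) -> in_defect z -> facing T true (mix T (p t) z 2^-1)) ->
  weakly_increasing a -> weakly_increasing b ->
  directed_path (fun r => mix T (p (a r)) z (b r)).
Proof.
move=> stay faces ma mb; have [ca Ia mona] := ma; have [cb Ib monb] := mb.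
have cq := mix_pz_continuous ma mb; set q := fun r => _ in cq *.
apply/(directed_pathP T); split=> // t t0 t1.
apply: near_inW (within_near_in cq t0 t1 (near_carrier T (q t))) => u u0 u1 /fintype.subsetP cu qD qn.
have It : I t by apply/IE; rewrite t0.
have Iu : I u by apply/IE; rewrite u0.
have /IE at01 := Ia t It; have /IE au01 := Ia u Iu.
have /IE bt01 := Ib t It; have /IE bu01 := Ib u Iu.
have zD : in_defect z.
  have := qD; rewrite in_defect_mix ?jp // => /andP[h1 h2].
  case/orP: h2 => [/eqP b0|//]; move: h1; rewrite b0 eq_sym oner_eq0 /=; exact: p_defect.
have [b1 pn] : b u != 1 /\ ~~ in_defect (p (a u)).
  have := qn; rewrite in_defect_mix ?jp // zD orbT andbT negb_or; case/andP; split=> //.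
split=> ut.
  have [w wt] := carrier_neq0 T (q t).
  apply: (@mix_facing _ _ _ _ w) => //; try exact: jp; first exact: faces.
    exact: cu.
  exact: carrier_in_defect wt.
exfalso; have := qD; rewrite in_defect_mix ?jp // zD orbT andbT.
case/orP => [/eqP bt1|pD].
  case/eqP: b1; have := monb t u It Iu (ltW ut); rewrite bt1; lin.
case/negP: pn; apply: stay pD; [lin|exact: mona (ltW ut)|lin].
Qed.

(** Coning the path to z gives a map of the square that collapses the top side to z, so that
    its boundary paths are bot followed by right_, and left_. *)
Lemma cone_in x y (bot : dpath x y) (left_ : dpath x z) (right_ : dpath y z) :
  (forall s t, 0 <= s -> s <= t -> t <= 1 -> in_defect (p s) -> in_defect (p t)) ->
  (forall t, 0 <= t <= 1 -> ~~ in_defect (p t) -> in_defect z -> facing T true (mix T (p t) z 2^-1)) ->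
  (forall t, 0 <= t <= 1 -> [/\ bot t = p t, left_ t = mix T x z t & right_ t = mix T y z t]) ->
  class_concat (dpath_class bot) (dpath_class right_) = dpath_class left_.
Proof.
move=> stay faces hE.
rewrite -[RHS](class_concatf1 (dpath_class left_)) !class_concatE; apply/dpath_classP.
have [I0 I1] : 0 <= (0 : R) <= 1 /\ 0 <= (1 : R) <= 1 by rewrite !lexx ler01.
have [e0 _ _] := hE 0 I0; have [e1 _ _] := hE 1 I1.
rewrite dpath0 in e0; rewrite dpath1 in e1.
apply: (cell_dequiv (h := fun v => mix T (p v.1) z v.2)).
- apply: mix_continuous.
  + apply: (@within_comp _ _ _ (I `*` I) I fst p) => //; last by move=> v [].
    by apply: continuous_subspaceT => v; exact: cvg_fst.
  + by apply: continuous_subspaceT; exact: cst_continuous.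
  + by apply: continuous_subspaceT => v; exact: cvg_snd.
  + by move=> v [/IE v1 _]; exact: jp.
  + by move=> v [_ /IE].
- by move=> a b ma mb; exact: cone_in_directed.
- move=> t t01; have [h1 h2 h3] := hE t t01.
  by rewrite /= mix0 mix1 -e0 -e1.
Qed.

Hypothesis jp' : forall t, 0 <= t <= 1 -> joinable T z (p t).

Let mix_zp_continuous a b : weakly_increasing a -> weakly_increasing b ->
  {within I, continuous (fun r => mix T z (p (a r)) (b r))}.
Proof.
move=> ma mb; have [ca Ia _] := ma; have [cb Ib _] := mb.
apply: mix_continuous => //.
- by apply: continuous_subspaceT; exact: cst_continuous.
- exact: comp_continuous.
- by move=> r /Ia /IE; exact: jp'.
Qed.

(** Such a path leaves the defect once, and from then on runs through outward-facing
    simplices. *)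
Lemma cone_out_directed a b :
  (forall s t, 0 <= s -> s <= t -> t <= 1 -> in_defect (p t) -> in_defect (p s)) ->
  (forall t, 0 <= t <= 1 -> ~~ in_defect (p t) -> in_defect z -> facing T false (mix T z (p t) 2^-1)) ->
  weakly_increasing a -> weakly_increasing b ->
  directed_path (fun r => mix T z (p (a r)) (b r)).
Proof.
move=> stay faces ma mb; have [ca Ia mona] := ma; have [cb Ib monb] := mb.
have cq := mix_zp_continuous ma mb; set q := fun r => _ in cq *.
apply/(directed_pathP T); split=> // t t0 t1.
apply: near_inW (within_near_in cq t0 t1 (near_carrier T (q t))) => u u0 u1 /fintype.subsetP cu qD qn.
have It : I t by apply/IE; rewrite t0.
have Iu : I u by apply/IE; rewrite u0.
have /IE at01 := Ia t It; have /IE au01 := Ia u Iu.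
have /IE bt01 := Ib t It; have /IE bu01 := Ib u Iu.
have zD : in_defect z.
  have := qD; rewrite in_defect_mix ?jp' // => /andP[h1 h2].
  case/orP: h1 => [/eqP b0|//]; move: h2; rewrite b0 oner_eq0 /=; exact: p_defect.
have [b0 pn] : b u != 0 /\ ~~ in_defect (p (a u)).
  have := qn; rewrite in_defect_mix ?jp' // zD orbT andTb negb_or; case/andP; split=> //.
split=> ut; last first.
  have [w wt] := carrier_neq0 T (q t).
  apply: (@mix_facing _ _ _ _ w) => //; try exact: jp'; first exact: faces.
    exact: cu.
  exact: carrier_in_defect wt.
exfalso; have := qD; rewrite in_defect_mix ?jp' // zD orbT andTb.
case/orP => [/eqP bt0|pD].
  case/eqP: b0; have := monb u t Iu It (ltW ut); rewrite bt0; lin.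
case/negP: pn; apply: stay pD; [lin|exact: mona (ltW ut)|lin].
Qed.

Lemma cone_out x y (top_ : dpath x y) (left_ : dpath z x) (right_ : dpath z y) :
  (forall s t, 0 <= s -> s <= t -> t <= 1 -> in_defect (p t) -> in_defect (p s)) ->
  (forall t, 0 <= t <= 1 -> ~~ in_defect (p t) -> in_defect z -> facing T false (mix T z (p t) 2^-1)) ->
  (forall t, 0 <= t <= 1 -> [/\ top_ t = p t, left_ t = mix T z x t & right_ t = mix T z y t]) ->
  class_concat (dpath_class left_) (dpath_class top_) = dpath_class right_.
Proof.
move=> stay faces hE.
rewrite -[RHS](class_concat1f (dpath_class right_)) !class_concatE; apply/dpath_classP/rst_sym.
have [I0 I1] : 0 <= (0 : R) <= 1 /\ 0 <= (1 : R) <= 1 by rewrite !lexx ler01.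
have [e0 _ _] := hE 0 I0; have [e1 _ _] := hE 1 I1.
rewrite dpath0 in e0; rewrite dpath1 in e1.
apply: (cell_dequiv (h := fun v => mix T z (p v.1) v.2)).
- apply: mix_continuous.
  + by apply: continuous_subspaceT; exact: cst_continuous.
  + apply: (@within_comp _ _ _ (I `*` I) I fst p) => //; last by move=> v [].
    by apply: continuous_subspaceT => v; exact: cvg_fst.
  + by apply: continuous_subspaceT => v; exact: cvg_snd.
  + by move=> v [/IE v1 _]; exact: jp'.
  + by move=> v [_ /IE].
- by move=> a b ma mb; exact: cone_out_directed.
- move=> t t01; have [h1 h2 h3] := hE t t01.
  by rewrite /= mix0 mix1 -e0 -e1.
Qed.

End Cone.

Lemma mix_directed x y : joinable T x y ->
  (~~ in_defect x -> in_defect y -> facing T true (mix T x y 2^-1)) ->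
  (in_defect x -> ~~ in_defect y -> facing T false (mix T x y 2^-1)) ->
  directed_path (mix T x y).
Proof.
move=> jxy f1 f2.
have ccst w : {within I, continuous (fun _ : R => w : X)}.
  by apply: continuous_subspaceT; exact: cst_continuous.
have id_incr := @weakly_increasing_id R.
have jyx := joinable_sym jxy.
have [yD|yn] := boolP (in_defect y).
  apply: (@cone_in_directed (fun=> x) y _ _ _ id id) => // t _ xn _; exact: f1.
have [xD|xn] := boolP (in_defect x).
  apply: (@cone_out_directed (fun=> y) x _ _ _ id id) => // t _ _ _.
  exact: f2.
apply: single_stratum_directed; first exact: mix_path_continuous.
by move=> t t01; rewrite !in_defect_mix_same ?lexx ?ler01 // (negbTE xn) (negbTE yn).
Qed.

Definition mix_dpath x y (dxy : directed_path (mix T x y)) : dpath x y :=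
  DPath dxy (mix0 T x y) (mix1 T x y).

End Cones.

(** * Colorings as functors on the fundamental category *)

Section Transports.
Variables (R : realType) (d : nat) (X : manifold_with_defect R d).
Variable T : directed_triangulation X.
Variable C : parcel Gamma2.
Hypothesis C_regular : regular_parcel C.
Local Notation vpt := (@vertex_point _ _ X T).
Local Notation dv i := (in_defect (vpt i)).
Local Notation car := (carrier_simplex T).
Local Notation vtx := (nearby_vertex T).
Local Notation K := (simplices T).
Local Notation one x := (unit_over C (kind (in_defect x))).
Local Notation idw v := (@id_arrow (path_category Gamma2) v).
Implicit Types (x y z : X) (r s t : R) (u v w : 'I_(nvertices T)).

Definition arrow_assignment : Type :=
  forall x y : X, dpath_class_type x y -> option (arrow C).

(** These are the functors from the fundamental category to C over the path category,
    normalized on the segments to the nearby vertices; values in [option (arrow C)] spare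
    the bookkeeping of sources and targets. *)
Record is_transport (Phi : arrow_assignment) : Prop := IsTransport {
  transport_comp : forall x y z (f : dpath_class_type x y) (g : dpath_class_type y z),
    Phi x z (class_concat f g) = Phi x y f ** Phi y z g;
  transport_above : forall x y (p : dpath x y) (a : arrow (path_category Gamma2)),
    traverses p 0 1 a -> lies_above a (Phi x y (dpath_class p));
  transport_normal : forall x (l : dpath x (vpt (vtx x))),
    (forall t, 0 <= t <= 1 -> l t = mix T x (vpt (vtx x)) t) ->
    Phi x _ (dpath_class l) = one x }.

Lemma mix_traverses x y : joinable T x y ->
  traverses (mix T x y) 0 1 (step_arrow (in_defect x) (in_defect y)).
Proof.
move=> jxy.
have same : in_defect x = in_defect y -> forall t t', 0 <= t <= 1 -> 0 <= t' <= 1 ->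
    stratum (mix T x y t) (mix T x y t').
  move=> xy; apply: path_stratum; first exact: mix_path_continuous.
  by move=> t t01; rewrite !in_defect_mix_same ?lexx ?ler01.
have I01 : 0 <= (0 : R) <= 1 /\ 0 <= (1 : R) <= 1 by rewrite !lexx ler01.
have cab (a b : R) : 0 <= a -> b <= 1 -> {within `[a, b]%classic, continuous (mix T x y)}.
  move=> a0 b1; apply: within_sub (mix_path_continuous jxy) => t.
  by rewrite /= !in_itv /=; lin.
have [xD|xn] := boolP (in_defect x); have [yD|yn] := boolP (in_defect y).
- apply: traverses_defect; rewrite ?ler01 ?mix0 //; first exact/in_defectP.
  by move=> t t01; rewrite -{1}(mix0 T x y); apply: same; rewrite ?xD ?yD //; case: I01.
- apply: (@traverses_omega _ _ _ _ 0 0 1); rewrite ?ler01 ?ltr01 ?mix0 ?mix1 ?lexx //.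
  + exact/in_defectP.
  + exact/in_defectP.
  + by move=> t t0; have -> : t = 0 by [lin]; rewrite mix0; exact: stratum_refl.
  + move=> t /andP[t0 t1]; rewrite -{1}(mix1 T x y).
    apply: (@path_stratum _ _ _ t 1); [by apply: cab; lin| |by rewrite t1 lexx|by rewrite t1 lexx].
    move=> t' /andP[u0 u1].
    by rewrite !in_defect_mix ?(negbTE yn) ?orbF ?(gt_eqF t0) ?(gt_eqF (lt_le_trans t0 u0)) ?andbF //;
      apply/andP; split; lin.
- apply: (@traverses_iota _ _ _ _ 0 1 1); rewrite ?ler01 ?ltr01 ?mix0 ?mix1 ?lexx //.
  + exact/in_defectP.
  + exact/in_defectP.
  + move=> t /andP[t0 t1]; rewrite -{1}(mix0 T x y).
    apply: (@path_stratum _ _ _ 0 t); [by apply: cab; lin| |by rewrite t0 lexx|by rewrite t0 lexx].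
    move=> t' /andP[u0 u1].
    have u1' : t' < 1 by lin.
    by rewrite !in_defect_mix ?(negbTE xn) ?orbF ?(lt_eqF u1') ?(lt_eqF (@ltr01 R)) //;
      apply/andP; split; lin.
  + by move=> t t0; have -> : t = 1 by [lin]; rewrite mix1; exact: stratum_refl.
- apply: traverses_bulk; rewrite ?ler01 ?mix0 //; first exact/in_defectP.
  move=> t t01; rewrite -{1}(mix0 T x y); apply: same => //; last by case: I01.
  by rewrite (negbTE xn) (negbTE yn).
Qed.

Section FromSystem.
Variable L : edge_system T C.

Definition system_transport : arrow_assignment :=
  fun x y f => holonomy L (repr f) 0 1.

Lemma system_transportE x y (p : dpath x y) :
  system_transport (dpath_class p) = holonomy L p 0 1.
Proof. by apply: holonomy_dequiv; apply/dpath_classP; rewrite dpath_class_repr. Qed.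

(** The interior of the edge is one open simplex: up to its middle the edge can be reached
    in one step from u, and after its middle it can step to v. *)
Lemma holonomy_edge u v (p : dpath (vpt u) (vpt v)) : edge_dir u v ->
  (forall t, 0 <= t <= 1 -> p t = mix T (vpt u) (vpt v) t) -> holonomy L p 0 1 = L u v.
Proof.
move=> euv hp; have [ne uvK] := edge_dirP euv.
have [h0 h1] : 0 <= (2^-1 : R) /\ (2^-1 : R) <= 1 by lin.
have dp := dpath_directed p.
have juv : joinable T (vpt u) (vpt v) by rewrite joinable_vertices.
have car_p t : 0 <= t <= 1 -> car (p t) \subset [set u; v]%SET.
  move=> t01; rewrite hp //.
  by apply: (fintype.subset_trans (carrier_mix_sub juv t01)); rewrite !carrier_vertex.
have vin t : 0 <= t <= 1 -> vtx (p t) \in [set u; v]%SET.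
  by move=> t01; apply: (fintype.subsetP (car_p t t01)); exact: nearby_vertex_in.
have pass_u t : 0 <= t <= 1 -> point_passable T (vpt u) (p t).
  move=> t01; rewrite point_passableE nearby_vertexK; have := vin t t01.
  rewrite -(nearby_vertex_in_defect T (p t)) finset.in_set2 => /orP[] /eqP ->.
    by rewrite eqxx.
  by rewrite euv orbT.
have pass_v t : 0 <= t <= 1 -> point_passable T (p t) (vpt v).
  move=> t01; rewrite point_passableE nearby_vertexK; have := vin t t01.
  rewrite -(nearby_vertex_in_defect T (p t)) finset.in_set2 => /orP[] /eqP ->.
    by rewrite euv orbT.
  by rewrite eqxx.
have p0 : p 0 = vpt u by exact: dpath0.
have p1 : p 1 = vpt v by exact: dpath1.
have uin t : 0 <= t <= 1 -> t != 1 -> u \in car (p t).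
  by move=> t01 t1; rewrite hp // carrier_mix // (negbTE t1) carrier_vertex !inE eqxx.
have vin' t : 0 <= t <= 1 -> t != 0 -> v \in car (p t).
  by move=> t01 t0; rewrite hp // carrier_mix // (negbTE t0) !carrier_vertex !inE eqxx orbT.
rewrite -(holonomy_cat L dp (lexx 0) h0 h1 (lexx 1)).
rewrite (holonomy_from L dp (lexx 0) h0 h1); last first.
  move=> t t0 t1; have t01 : 0 <= t <= 1 by lin.
  rewrite p0 carrier_vertex finset.sub1set uin ?pass_u //.
  by apply/eqP; lin.
rewrite (holonomy_to L dp h0 h1 (lexx 1)); last first.
  move=> t t0 t1; have t01 : 0 <= t <= 1 by lin.
  rewrite p1 carrier_vertex finset.sub1set vin' ?pass_v //.
  by apply/eqP; lin.
have h01 : 0 <= (2^-1 : R) <= 1 by lin.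
rewrite p0 p1 (point_transition_cocycle L uvK) ?pass_u ?pass_v ?vin //.
- by rewrite /point_transition !nearby_vertexK transition_edge.
- by rewrite nearby_vertexK !inE eqxx.
- by rewrite nearby_vertexK !inE eqxx orbT.
- by rewrite -p0; apply: pass_v; rewrite lexx ler01.
Qed.

Lemma system_transport_is_transport : is_transport system_transport.
Proof.
split.
- move=> x y z f g; rewrite system_transportE.
  apply: holonomy_concat; [exact: dpath_directed|exact: dpath_directed|].
  by rewrite dpath1 dpath0.
- move=> x y p a pw; rewrite system_transportE.
  by apply: holonomy_traverses pw _ _ => //; exact: dpath_directed.
- move=> x l hl; rewrite system_transportE; have dl := dpath_directed l.
  have jx : joinable T x (vpt (vtx x)) by exact/joinable_vertex/nearby_vertex_in.
  rewrite holonomy_to ?ler01 //.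
    rewrite dpath0 dpath1 /point_transition nearby_vertexK transition_refl.
    by rewrite nearby_vertex_in_defect.
  move=> t t0 t1; have t01 : 0 <= t <= 1 by rewrite t0.
  rewrite dpath1 carrier_vertex finset.sub1set hl //; split.
    rewrite carrier_mix // carrier_vertex !inE.
    have [->|_] := eqVneq t 0; last by rewrite inE eqxx orbT.
    by rewrite eq_sym oner_eq0 nearby_vertex_in.
  apply: same_pass; rewrite in_defect_mix_same // nearby_vertex_in_defect //.
Qed.

End FromSystem.

Section ToSystem.
Variable Phi : arrow_assignment.
Hypothesis Phi_transport : is_transport Phi.
Local Notation PhiP := Phi_transport.
Local Notation ph p := (Phi (dpath_class p)).

Lemma unit_idempotent k f : lies_above (idw k) f -> f ** f = f -> f = unit_over C k.
Proof.
move=> vf ff; have [_ fi _] := pinvP C_regular vf.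
by rewrite -fi -{2}ff -pcompA fi (comp_unit C_regular (w := idw k)).
Qed.

Lemma transport_id x : ph (dpath_id x) = one x.
Proof.
apply: unit_idempotent; last by rewrite -(transport_comp PhiP) class_concat1f.
rewrite -step_arrow_same -{2}(mix_same T x 0).
apply: (transport_above PhiP).
have := @mix_traverses x x (joinable_subset (fintype.subxx _)); rewrite mix_same.
have -> : mix T x x = fun=> x by apply/funext => t; exact: mix_same.
by [].
Qed.

Lemma transport_one x y (f : dpath_class_type x y) : Phi f ** one y = Phi f.
Proof. by rewrite -transport_id -(transport_comp PhiP) class_concatf1. Qed.

Lemma one_transport x y (f : dpath_class_type x y) : one x ** Phi f = Phi f.
Proof. by rewrite -transport_id -(transport_comp PhiP) class_concat1f. Qed.

Lemma transport_ext x y (p q : dpath x y) : (forall t, 0 <= t <= 1 -> p t = q t) -> ph p = ph q.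
Proof.
move=> pq; congr (Phi _); apply/dpath_classP/dequiv_ext => t; rewrite /= in_itv /= => t01.
by rewrite pq.
Qed.

Lemma transport_normal_rev x (l : dpath (vpt (vtx x)) x) :
  (forall t, 0 <= t <= 1 -> l t = mix T (vpt (vtx x)) x t) -> ph l = one x.
Proof.
move=> hl.
have jx : joinable T (vpt (vtx x)) x by apply/joinable_sym/joinable_vertex/nearby_vertex_in.
have hd t : 0 <= t <= 1 -> in_defect (l t) = in_defect (vpt (vtx x)).
  by move=> t01; rewrite hl // in_defect_mix_same // !nearby_vertex_in_defect.
have [q [hq lq ql]] := stratum_path_inverse hd.
have hq' t : 0 <= t <= 1 -> q t = mix T x (vpt (vtx x)) t.
  by move=> t01; rewrite hq hl; [rewrite mix_sym subKr|lin].
have := congr1 (@Phi _ _) ql; rewrite (transport_comp PhiP) transport_id.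
rewrite (transport_normal PhiP hq').
have <- : one (vpt (vtx x)) = one x by rewrite nearby_vertex_in_defect.
by rewrite one_transport.
Qed.

Definition transport_color (u v : 'I_(nvertices T)) : option (arrow C) :=
  match pselect (edge_dir u v) with
  | left e => ph (mix_dpath (edge_directed e))
  | right _ => None
  end.

Lemma transport_colorE u v (p : dpath (vpt u) (vpt v)) : edge_dir u v ->
  (forall t, 0 <= t <= 1 -> p t = mix T (vpt u) (vpt v) t) -> ph p = transport_color u v.
Proof.
move=> euv hp; rewrite /transport_color; case: pselect => // e.
exact: transport_ext.
Qed.

Lemma transport_color_above u v : edge_dir u v ->
  lies_above (step_arrow (dv u) (dv v)) (transport_color u v).
Proof.
move=> euv; rewrite /transport_color; case: pselect => // e.
apply: (transport_above PhiP); apply: mix_traverses.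
by rewrite joinable_vertices; case/edge_dirP: euv.
Qed.

(** A triangle is a cone over one of its edges: over the first edge towards w when w lies in
    the defect or no vertex does, and from u over the last edge when u lies in the defect and
    w in the bulk. *)
Lemma transport_color_triangle u v w : edge_dir u v -> edge_dir v w -> edge_dir u w ->
  [set u; v; w]%SET \in K ->
  transport_color u v ** transport_color v w = transport_color u w.
Proof.
move=> euv evw euw sK.
rewrite -(transport_colorE (p := mix_dpath (edge_directed euv))) //.
rewrite -(transport_colorE (p := mix_dpath (edge_directed evw))) //.
rewrite -(transport_colorE (p := mix_dpath (edge_directed euw))) //.
rewrite -(transport_comp PhiP); congr (Phi _).
have inu : u \in [set u; v; w]%SET by rewrite !inE eqxx.
have inv_ : v \in [set u; v; w]%SET by rewrite !inE eqxx orbT.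
have inw : w \in [set u; v; w]%SET by rewrite !inE eqxx orbT.
have jv i j : i \in [set u; v; w]%SET -> j \in [set u; v; w]%SET -> joinable T (vpt i) (vpt j).
  by move=> is_ js; apply: (joinable_sub sK); rewrite carrier_vertex finset.sub1set.
have cmix i j t : 0 <= t <= 1 -> i \in [set u; v; w]%SET -> j \in [set u; v; w]%SET ->
    car (mix T (vpt i) (vpt j) t) \subset [set u; v; w]%SET.
  move=> t01 is_ js; apply: (fintype.subset_trans (carrier_mix_sub (jv i j is_ js) t01)).
  by rewrite !carrier_vertex finset.subUset !finset.sub1set is_.
have jmix i j k t : 0 <= t <= 1 -> i \in [set u; v; w]%SET -> j \in [set u; v; w]%SET ->
    k \in [set u; v; w]%SET -> joinable T (mix T (vpt i) (vpt j) t) (vpt k).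
  by move=> t01 is_ js ks; apply: (joinable_sub sK); [exact: cmix|rewrite carrier_vertex finset.sub1set].
have fc c i k y : leads c i k -> i \in [set u; v; w]%SET -> k \in [set u; v; w]%SET ->
    ~~ dv i -> dv k -> ~~ in_defect y -> car y \subset [set u; v; w]%SET ->
    (exists2 l, l \in car y & dv l) -> facing T c y.
  move=> cik is_ ks ni dk /(bulk_carrier T)[u' uy nu'] /fintype.subsetP ys [l ly dl].
  apply/facingP; exists u', l; split=> //.
  by apply: (simplex_leads sK is_ _ ks _ ni _ dk _ cik) => //; exact: ys.
have half01 : 0 <= (2^-1 : R) <= 1 by lin.
have half0 : (2^-1 == 0 :> R) = false by apply/negbTE/eqP; lin.
have half1 : (2^-1 == 1 :> R) = false by apply/negbTE/eqP; lin.
have [wD|wn] := boolP (dv w).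
  (* with v in the bulk, the edges to it and from it would cross the defect in opposite
     directions *)
  have vu : dv u -> dv v.
    move=> uD; apply/negPn/negP => vn.
    apply: (@leads_exclusive _ _ _ T true v w) => //=.
    exact: (simplex_leads (c := false) sK inv_ inv_ inu inw vn vn uD wD euv).
  apply: (@cone_in _ _ _ T (mix T (vpt u) (vpt v)) (vpt w)) => //.
  - exact/mix_path_continuous/jv.
  - by move=> t t01; apply: jmix.
  - move=> s t s0 st t1; have [s01 t01] := le_unit s0 st t1; rewrite !in_defect_mix ?jv //.
    case/andP => h1 h2; case/orP: h1 => [/eqP s1|uD]; last by rewrite uD (vu uD) !orbT.
    move: h2; rewrite s1 oner_eq0 /= => vD; have -> : t = 1 by lin.
    by rewrite eqxx vD orbT.
  move=> t t01 tn _.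
  have [i [is_ ni ilead]] : exists i, [/\ i \in [set u; v; w]%SET, ~~ dv i & leads true i w].
    have [uD|un] := boolP (dv u); last by exists u.
    move: tn; rewrite in_defect_mix ?jv // uD (vu uD) !orbT //.
  apply: (fc true i w) => //.
  - by rewrite in_defect_mix ?jmix // half0 half1 (negbTE tn).
  - apply: (fintype.subset_trans (carrier_mix_sub (jmix u v w t t01 inu inv_ inw) half01)).
    by rewrite finset.subUset cmix // carrier_vertex finset.sub1set.
  - by exists w => //; rewrite carrier_mix_half ?jmix // carrier_vertex !inE eqxx orbT.
have jvw : joinable T (vpt v) (vpt w) by exact: jv.
have [uD|un] := boolP (dv u).
  apply: (@cone_out _ _ _ T (mix T (vpt v) (vpt w)) (vpt u)) => //.
  - exact/mix_path_continuous/jv.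
  - by move=> t t01; apply/joinable_sym/jmix.
  - move=> s t s0 st t1; have [s01 t01] := le_unit s0 st t1; rewrite !in_defect_mix ?jv //.
    rewrite (negbTE wn) !orbF => /andP[h1 /eqP t0].
    have -> : s = 0 by lin.
    by move: h1; rewrite t0 eqxx andbT.
  move=> t t01 tn _.
  apply: (fc false w u) => //.
  - by rewrite in_defect_mix ?(joinable_sym (jmix _ _ _ _ _ _ _ _)) // half0 half1 (negbTE tn) andbF.
  - apply: (fintype.subset_trans (carrier_mix_sub (joinable_sym (jmix v w u t t01 inv_ inw inu)) half01)).
    by rewrite finset.subUset cmix // carrier_vertex finset.sub1set inu.
  - exists u => //; rewrite carrier_mix_half ?carrier_vertex ?inE ?eqxx //.
    exact/joinable_sym/jmix.
(* a defect vertex v between u and w would be entered and left in one simplex *)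
have vn : ~~ dv v.
  apply/negP => vD.
  apply: (@leads_exclusive _ _ _ T true u v) => //=.
  exact: (simplex_leads (c := false) sK inw inu inv_ inv_ wn un vD vD evw).
have bulk t : 0 <= t <= 1 -> ~~ in_defect (mix T (vpt u) (vpt v) t).
  by move=> t01; rewrite in_defect_mix_same ?jv // (negbTE un) (negbTE vn).
apply: (@cone_in _ _ _ T (mix T (vpt u) (vpt v)) (vpt w)) => //.
- exact/mix_path_continuous/jv.
- by move=> t t01; apply: jmix.
- by move=> t t01; rewrite (negbTE (bulk t t01)).
- by move=> s t s0 st t1; have [s01 _] := le_unit s0 st t1; rewrite (negbTE (bulk s s01)).
- by move=> t t01 _; rewrite (negbTE wn).
Qed.

Definition transport_system : edge_system T C :=
  EdgeSystem C_regular transport_color_above transport_color_triangle.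

End ToSystem.

End Transports.

Section TransportHolonomy.
Variables (R : realType) (d : nat) (X : manifold_with_defect R d).
Variable T : directed_triangulation X.
Variable C : parcel Gamma2.
Hypothesis C_regular : regular_parcel C.
Local Notation vpt := (@vertex_point _ _ X T).
Local Notation dv i := (in_defect (vpt i)).
Local Notation car := (carrier_simplex T).
Local Notation vtx := (nearby_vertex T).
Local Notation K := (simplices T).
Local Notation one x := (unit_over C (kind (in_defect x))).
Local Notation idw v := (@id_arrow (path_category Gamma2) v).
Implicit Types (x y z : X) (r s t : R) (u v w : 'I_(nvertices T)).

Variable Phi : arrow_assignment X C.
Hypothesis Phi_transport : is_transport T Phi.
Local Notation PhiP := Phi_transport.
Local Notation ph p := (Phi (dpath_class p)).
Let L := transport_system C_regular Phi_transport.
Local Notation G := (point_transition L).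

(** Only segments inside a stratum may run against an edge, and the reversed segment is then
    the inverse of the edge. *)
Lemma transport_segment u v (p : dpath (vpt u) (vpt v)) : [set u; v]%SET \in K ->
  passable u v -> (forall t, 0 <= t <= 1 -> p t = mix T (vpt u) (vpt v) t) ->
  ph p = transition L u v.
Proof.
move=> uvK; have [euv _ hp|neuv] := boolP (edge_dir u v).
  by rewrite transition_edge // (transport_colorE _ euv hp).
rewrite /passable (negbTE neuv) orbF => /eqP same hp.
have [uv|ne] := eqVneq u v.
  case: v / uv same uvK neuv p hp => _ _ _ p hp.
  rewrite transition_refl -(transport_id C_regular PhiP); apply: transport_ext => t t01.
  by rewrite hp // mix_same.
have evu := edge_dir_neg ne uvK neuv.
have juv : joinable T (vpt u) (vpt v) by rewrite joinable_vertices.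
have hd t : 0 <= t <= 1 -> in_defect (p t) = dv u.
  by move=> t01; rewrite hp // in_defect_mix_same.
have [q [hq pq qp]] := stratum_path_inverse hd.
have hq' t : 0 <= t <= 1 -> q t = mix T (vpt v) (vpt u) t.
  by move=> t01; rewrite hq hp; [rewrite mix_sym subKr|lin].
rewrite (transition_rev L evu) -[system_color L v u](transport_colorE _ evu hq').
have qa : lies_above (idw (kind (dv u))) (ph q).
  by rewrite -step_arrow_same {1}same (transport_colorE _ evu hq'); exact: transport_color_above.
have pa : lies_above (idw (kind (dv u))) (ph p).
  have dm : directed_path (mix T (vpt u) (vpt v)).
    apply: (directed_path_ext _ (dpath_directed p)) => t; rewrite /= in_itv /= => t01.
    exact: hp.
  rewrite -step_arrow_same {2}same (transport_ext Phi (q := mix_dpath dm)) //.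
  by apply: (transport_above PhiP); exact: mix_traverses.
apply: (pinv_uniq C_regular qa pa).
by rewrite -(transport_comp PhiP) qp (transport_id C_regular PhiP) -same.
Qed.

(** A short arc that ends at p b is contracted, by a cone, to the segment from p a to the
    vertex near p b, and this segment, by a second cone, to the segment between the nearby
    vertices. *)
Lemma transport_into p (dp : directed_path p) (a b : R) (a0 : 0 <= a) (ab : a <= b) (b1 : b <= 1) :
  (forall t, a <= t -> t <= b -> car (p b) \subset car (p t) /\
     (~~ in_defect (p t) -> in_defect (p b) -> facing T true (p t))) ->
  ph (subpath dp a0 ab b1) = G (p a) (p b).
Proof.
move=> star; set w := vtx (p b); set u := vtx (p a); set q := path_restriction p a b.
have [cp wp] := (directed_pathP T p).1 dp.
have tI r : 0 <= r <= 1 -> a <= a + r * (b - a) <= b by move=> ?; apply/andP; split; nra.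
have qstar r : 0 <= r <= 1 -> car (p b) \subset car (q r) /\
     (~~ in_defect (q r) -> in_defect (p b) -> facing T true (q r)).
  by move=> /tI/andP[h1 h2]; exact: star.
have wq r : 0 <= r <= 1 -> w \in car (q r).
  by move=> /qstar[h _]; apply: (fintype.subsetP h); exact: nearby_vertex_in.
have dw : dv w = in_defect (p b) by exact: nearby_vertex_in_defect.
have qD r : 0 <= r <= 1 -> in_defect (q r) -> dv w.
  by move=> r01 qrD; exact: carrier_in_defect qrD (wq r r01).
have cq := proj1 (dpath_directed (subpath dp a0 ab b1)).
have [I0 I1] : 0 <= (0 : R) <= 1 /\ 0 <= (1 : R) <= 1 by rewrite !lexx ler01.
have q0 : q 0 = p a by exact: (dpath0 (subpath dp a0 ab b1)).
have q1 : q 1 = p b by exact: (dpath1 (subpath dp a0 ab b1)).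
have jq r : 0 <= r <= 1 -> joinable T (q r) (vpt w) by move=> /wq; exact: joinable_vertex.
have jpa : joinable T (p a) (vpt w) by rewrite -q0; exact: jq.
have jpb : joinable T (p b) (vpt w) by rewrite -q1; exact: jq.
have stay s t : 0 <= s -> s <= t -> t <= 1 -> in_defect (q s) -> in_defect (q t).
  move=> s0 st t1 sD; rewrite /q /path_restriction.
  apply: (stays_in_defect cp wp (a := a + s * (b - a)) (b := b)) => //; try nra.
  move=> t' t1' t2' tn; have [|_ h] := star t' _ t2'; first by nra.
  apply: h => //; rewrite -dw; apply: qD sD; lin.
have half01 : 0 <= (2^-1 : R) <= 1 by lin.
have faces r : 0 <= r <= 1 -> ~~ in_defect (q r) -> dv w -> facing T true (mix T (q r) (vpt w) 2^-1).
  move=> r01 qn wD; have [_ h] := qstar r r01.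
  apply: facing_le (h qn _); last by rewrite -dw.
  by rewrite carrier_mix_half ?jq //; exact: finset.subsetUl.
have dpa : directed_path (mix T (p a) (vpt w)).
  apply: mix_directed => // [an wD|aD wn]; first by rewrite -q0; apply: faces; rewrite ?q0.
  by case/negP: wn; apply: (qD 0 I0); rewrite q0.
have dpb : directed_path (mix T (p b) (vpt w)).
  by apply: mix_directed => // [bn|bD]; rewrite dw; [rewrite (negbTE bn)|rewrite bD].
have e1 : ph (subpath dp a0 ab b1) = ph (mix_dpath dpa).
  rewrite -(@cone_in _ _ _ T q (vpt w) cq jq qD _ _ (subpath dp a0 ab b1) (mix_dpath dpa) (mix_dpath dpb)) //.
  rewrite (transport_comp PhiP) (transport_normal PhiP (l := mix_dpath dpb)) //.
  by rewrite (transport_one C_regular PhiP).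
have jau : joinable T (p a) (vpt u) by exact/joinable_vertex/nearby_vertex_in.
have du : dv u = in_defect (p a) by exact: nearby_vertex_in_defect.
have ucar : u \in car (p a) by exact: nearby_vertex_in.
have wcar : w \in car (p a) by rewrite -q0; exact: wq.
have juw : joinable T (vpt u) (vpt w).
  by apply: (joinable_sub (carrier_in T (p a))); rewrite carrier_vertex finset.sub1set.
have cmix r : 0 <= r <= 1 -> car (mix T (p a) (vpt u) r) \subset car (p a).
  move=> r01; apply: (fintype.subset_trans (carrier_mix_sub jau r01)).
  by rewrite carrier_vertex finset.subUset finset.sub1set fintype.subxx.
have mixD r : 0 <= r <= 1 -> in_defect (mix T (p a) (vpt u) r) = in_defect (p a).
  by move=> r01; rewrite in_defect_mix_same // du.
have jmw r : 0 <= r <= 1 -> joinable T (mix T (p a) (vpt u) r) (vpt w).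
  move=> r01; apply: (joinable_sub (carrier_in T (p a))); first exact: cmix.
  by rewrite carrier_vertex finset.sub1set.
have aD_w : in_defect (p a) -> dv w by move=> aD; apply: (qD 0 I0); rewrite q0.
have facesa y : ~~ in_defect (p a) -> dv w -> ~~ in_defect y -> car y \subset car (p a) ->
    w \in car y -> facing T true y.
  move=> an wD yn ya wy.
  have fa : facing T true (p a) by rewrite -q0; have [_ h] := qstar 0 I0; apply: h; rewrite ?q0 -?dw.
  exact: facing_ge ya fa yn wy wD.
have duw : directed_path (mix T (vpt u) (vpt w)).
  apply: mix_directed => // [un wD|uD wn]; last by case/negP: wn; apply: aD_w; rewrite -du.
  apply: facesa => //; first by rewrite -du.
  - rewrite in_defect_mix // negb_and negb_or un andbT; apply/orP; left; apply/eqP; lin.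
  - by rewrite carrier_mix_half // !carrier_vertex finset.subUset !finset.sub1set ucar.
  - by rewrite carrier_mix_half // !carrier_vertex !inE eqxx orbT.
have dau : directed_path (mix T (p a) (vpt u)).
  apply: single_stratum_directed; first exact: mix_path_continuous.
  by move=> r r01; rewrite !mixD.
have e2 : ph (mix_dpath dpa) = ph (mix_dpath duw).
  rewrite -(@cone_in _ _ _ T (mix T (p a) (vpt u)) (vpt w) _ jmw _ _ _ (mix_dpath dau)
    (mix_dpath dpa) (mix_dpath duw)) //.
  - rewrite (transport_comp PhiP) (transport_normal PhiP (l := mix_dpath dau)) //.
    have <- : one (vpt u) = one (p a) by rewrite du.
    by rewrite (one_transport C_regular PhiP).
  - exact: mix_path_continuous.
  - by move=> t t01; rewrite mixD.
  - by move=> s t s0 st t1; have [s01 t01] := le_unit s0 st t1; rewrite !mixD.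
  - move=> t t01; rewrite mixD // => an wD; apply: facesa => //.
    + rewrite in_defect_mix ?jmw // mixD // (negbTE an) orbF negb_and.
      by apply/orP; left; apply/eqP; lin.
    + rewrite carrier_mix_half ?jmw // finset.subUset cmix //.
      by rewrite carrier_vertex finset.sub1set.
    + by rewrite carrier_mix_half ?jmw // carrier_vertex !inE eqxx orbT.
rewrite e1 e2; apply: transport_segment => //; first by rewrite -joinable_vertices.
rewrite /passable du dw; have [aD|an] := boolP (in_defect (p a)).
  by rewrite -dw aD_w.
have [bD|//] := boolP (in_defect (p b)).
have fa : facing T true (p a) by apply: facesa => //; rewrite dw.
by apply/orP; right; apply: (facing_leads fa); rewrite ?du ?dw.
Qed.

Lemma transport_out_of p (dp : directed_path p) (a b : R) (a0 : 0 <= a) (ab : a <= b) (b1 : b <= 1) :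
  (forall t, a <= t -> t <= b -> car (p a) \subset car (p t) /\
     (~~ in_defect (p t) -> in_defect (p a) -> facing T false (p t))) ->
  ph (subpath dp a0 ab b1) = G (p a) (p b).
Proof.
move=> star; set w := vtx (p a); set u := vtx (p b); set q := path_restriction p a b.
have [cp wp] := (directed_pathP T p).1 dp.
have tI r : 0 <= r <= 1 -> a <= a + r * (b - a) <= b by move=> ?; apply/andP; split; nra.
have qstar r : 0 <= r <= 1 -> car (p a) \subset car (q r) /\
     (~~ in_defect (q r) -> in_defect (p a) -> facing T false (q r)).
  by move=> /tI/andP[h1 h2]; exact: star.
have wq r : 0 <= r <= 1 -> w \in car (q r).
  by move=> /qstar[h _]; apply: (fintype.subsetP h); exact: nearby_vertex_in.
have dw : dv w = in_defect (p a) by exact: nearby_vertex_in_defect.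
have qD r : 0 <= r <= 1 -> in_defect (q r) -> dv w.
  by move=> r01 qrD; exact: carrier_in_defect qrD (wq r r01).
have cq := proj1 (dpath_directed (subpath dp a0 ab b1)).
have [I0 I1] : 0 <= (0 : R) <= 1 /\ 0 <= (1 : R) <= 1 by rewrite !lexx ler01.
have q0 : q 0 = p a by exact: (dpath0 (subpath dp a0 ab b1)).
have q1 : q 1 = p b by exact: (dpath1 (subpath dp a0 ab b1)).
have jq r : 0 <= r <= 1 -> joinable T (vpt w) (q r).
  by move=> /wq; move=> h; apply/joinable_sym/joinable_vertex.
have jpa : joinable T (vpt w) (p a) by rewrite -q0; exact: jq.
have jpb : joinable T (vpt w) (p b) by rewrite -q1; exact: jq.
have stay s t : 0 <= s -> s <= t -> t <= 1 -> in_defect (q t) -> in_defect (q s).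
  move=> s0 st t1 sD; rewrite /q /path_restriction.
  apply: (stayed_in_defect cp wp (a := a) (b := a + t * (b - a))) => //; try nra.
  move=> t' t1' t2' tn; have [|_ h] := star t' t1' _; first by nra.
  apply: h => //; rewrite -dw; apply: qD sD; lin.
have half01 : 0 <= (2^-1 : R) <= 1 by lin.
have faces r : 0 <= r <= 1 -> ~~ in_defect (q r) -> dv w -> facing T false (mix T (vpt w) (q r) 2^-1).
  move=> r01 qn wD; have [_ h] := qstar r r01.
  apply: facing_le (h qn _); last by rewrite -dw.
  by rewrite carrier_mix_half ?jq //; exact: finset.subsetUr.
have dpb : directed_path (mix T (vpt w) (p b)).
  apply: mix_directed => // [wn bD|wD bn]; last by rewrite -q1; apply: faces; rewrite ?q1.
  by case/negP: wn; apply: (qD 1 I1); rewrite q1.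
have dpa : directed_path (mix T (vpt w) (p a)).
  by apply: mix_directed => //; rewrite dw; case: (in_defect (p a)).
have e1 : ph (subpath dp a0 ab b1) = ph (mix_dpath dpb).
  rewrite -(@cone_out _ _ _ T q (vpt w) cq qD jq _ _ (subpath dp a0 ab b1) (mix_dpath dpa) (mix_dpath dpb)) //.
  rewrite (transport_comp PhiP) (transport_normal_rev C_regular PhiP (l := mix_dpath dpa)) //.
  by rewrite (one_transport C_regular PhiP).
have jau : joinable T (vpt u) (p b) by apply/joinable_sym/joinable_vertex/nearby_vertex_in.
have du : dv u = in_defect (p b) by exact: nearby_vertex_in_defect.
have ucar : u \in car (p b) by exact: nearby_vertex_in.
have wcar : w \in car (p b) by rewrite -q1; exact: wq.
have juw : joinable T (vpt w) (vpt u).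
  by apply: (joinable_sub (carrier_in T (p b))); rewrite carrier_vertex finset.sub1set.
have cmix r : 0 <= r <= 1 -> car (mix T (vpt u) (p b) r) \subset car (p b).
  move=> r01; apply: (fintype.subset_trans (carrier_mix_sub jau r01)).
  by rewrite carrier_vertex finset.subUset finset.sub1set fintype.subxx ucar.
have mixD r : 0 <= r <= 1 -> in_defect (mix T (vpt u) (p b) r) = in_defect (p b).
  by move=> r01; rewrite in_defect_mix_same // du.
have jmw r : 0 <= r <= 1 -> joinable T (vpt w) (mix T (vpt u) (p b) r).
  move=> r01; apply: (joinable_sub (carrier_in T (p b))); last exact: cmix.
  by rewrite carrier_vertex finset.sub1set.
have bD_w : in_defect (p b) -> dv w by move=> bD; apply: (qD 1 I1); rewrite q1.
have facesb y : ~~ in_defect (p b) -> dv w -> ~~ in_defect y -> car y \subset car (p b) ->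
    w \in car y -> facing T false y.
  move=> bn wD yn yb wy.
  have fb : facing T false (p b) by rewrite -q1; have [_ h] := qstar 1 I1; apply: h; rewrite ?q1 -?dw.
  exact: facing_ge yb fb yn wy wD.
have duw : directed_path (mix T (vpt w) (vpt u)).
  apply: mix_directed => // [wn uD|wD un]; first by case/negP: wn; apply: bD_w; rewrite -du.
  apply: facesb => //; first by rewrite -du.
  - by rewrite in_defect_mix // (negbTE un) orbF negb_and; apply/orP; right; apply/eqP; lin.
  - by rewrite carrier_mix_half // !carrier_vertex finset.subUset !finset.sub1set ucar wcar.
  - by rewrite carrier_mix_half // !carrier_vertex !inE eqxx.
have dau : directed_path (mix T (vpt u) (p b)).
  apply: single_stratum_directed; first exact: mix_path_continuous.
  by move=> r r01; rewrite !mixD.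
have e2 : ph (mix_dpath dpb) = ph (mix_dpath duw).
  rewrite -(@cone_out _ _ _ T (mix T (vpt u) (p b)) (vpt w) _ _ jmw _ _ (mix_dpath dau)
    (mix_dpath duw) (mix_dpath dpb)) //.
  - rewrite (transport_comp PhiP) (transport_normal_rev C_regular PhiP (l := mix_dpath dau)) //.
    have <- : one (vpt u) = one (p b) by rewrite du.
    by rewrite (transport_one C_regular PhiP).
  - exact: mix_path_continuous.
  - by move=> t t01; rewrite mixD.
  - by move=> s t s0 st t1; have [s01 t01] := le_unit s0 st t1; rewrite !mixD.
  - move=> t t01; rewrite mixD // => bn wD; apply: facesb => //.
    + rewrite in_defect_mix ?jmw // mixD // (negbTE bn) orbF negb_and.
      by apply/orP; right; apply/eqP; lin.
    + rewrite carrier_mix_half ?jmw // finset.subUset cmix // andbT.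
      by rewrite carrier_vertex finset.sub1set.
    + by rewrite carrier_mix_half ?jmw // carrier_vertex !inE eqxx.
rewrite e1 e2; apply: transport_segment => //; first by rewrite -joinable_vertices.
rewrite /passable du dw; have [bD|bn] := boolP (in_defect (p b)).
  by rewrite -dw bD_w.
have [aD|//] := boolP (in_defect (p a)).
have fb : facing T false (p b) by apply: facesb => //; rewrite dw.
by apply/orP; right; apply: (facing_leads fb); rewrite ?du ?dw.
Qed.

(** The transport along the initial parts of a path is parallel, and parallel sections are
    determined by their initial value. *)
Lemma transport_holonomy x y (p : dpath x y) : ph p = holonomy L p 0 1.
Proof.
case: p => p dp p0 p1; case: x / p0; case: y / p1.
pose s t := match pselect (0 <= t /\ t <= 1) with
  | left h => ph (subpath dp (lexx 0) (proj1 h) (proj2 h)) | right _ => None end.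
have sE t (t0 : 0 <= t) (t1 : t <= 1) : s t = ph (subpath dp (lexx 0) t0 t1).
  rewrite /s; case: pselect => [h|[]//].
  by rewrite (Prop_irrelevance (proj1 h) t0) (Prop_irrelevance (proj2 h) t1).
have ps : parallel L p 0 1 s.
  move=> t t0 t1; have wp := directed_crosses_well T dp t0 t1.
  have [e e0 he] := near_in_window (near_inI
    (within_near_in (proj1 dp) t0 t1 (near_carrier T (p t))) wp).
  exists e => // u u0 u1; rewrite ltr_norml => /andP[ut tu].
  split=> [hut|htu].
    rewrite (sE t t0 t1) (sE u u0 u1) -(transport_into dp u0 hut t1).
      by rewrite -(transport_comp PhiP) subpath_cat.
    move=> r ur rt; have [||||cr wr] := he r; try lin.
    split=> // rn tD; have [h _] := wr tD rn; apply: h.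
    by rewrite lt_neqAle rt andbT; apply: contraNneq rn => ->.
  rewrite (sE t t0 t1) (sE u u0 u1) -(transport_out_of dp t0 htu u1).
    by rewrite -(transport_comp PhiP) subpath_cat.
  move=> r tr ru; have [||||cr wr] := he r; try lin.
  split=> // rn tD; have [_ h] := wr tD rn; apply: h.
  by rewrite lt_neqAle tr andbT; apply: contraNneq rn => <-.
have := holonomyP dp (lexx 0) ler01 (lexx 1) ps.
have -> : s 0 = one (p 0).
  rewrite (sE 0 (lexx 0) ler01) -(transport_id C_regular PhiP); apply: transport_ext => t t01.
  by rewrite /= /path_restriction subr0 mulr0 addr0.
rewrite one_holonomy ?lexx ?ler01 // => <-.
rewrite (sE 1 ler01 (lexx 1)); apply: transport_ext => t t01.
by rewrite /= /path_restriction subr0 mulr1 add0r.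
Qed.

End TransportHolonomy.

(** * Functors on a family of points *)

Section Families.
Variables (R : realType) (d : nat) (X : manifold_with_defect R d).
Variable C : parcel Gamma2.
Hypothesis C_regular : regular_parcel C.
Local Notation I := (`[(0 : R), 1]%classic).
Local Notation one x := (unit_over C (kind (in_defect x))).
Local Notation idw v := (@id_arrow (path_category Gamma2) v).
Implicit Types (x y z : X) (r s t : R).

Lemma traverses_affine (p : R -> X) a' b' w : traverses p a' b' w ->
  forall k l a b : R, 0 < k -> a' = k * a + l -> b' = k * b + l ->
  traverses (fun t => p (k * t + l)) a b w.
Proof.
have le k l (t u : R) : 0 < k -> (k * t + l <= k * u + l) = (t <= u).
  by move=> k0; rewrite lerD2r ler_pM2l.
have lt k l (t u : R) : 0 < k -> (k * t + l < k * u + l) = (t < u).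
  by move=> k0; rewrite ltrD2r ltr_pM2l.
have inv_ k l (c : R) : 0 < k -> c = k * ((c - l) / k) + l.
  by move=> k0; rewrite mulrC divfK ?subrK // gt_eqF.
elim=> {a' b' w}.
- move=> a' b' ab an h k l a b k0 ea eb; apply: traverses_bulk; rewrite -?ea //.
    by rewrite -(le k l) // -ea -eb.
  by move=> t tab; apply: h; rewrite ea eb !le.
- move=> a' b' ab aD h k l a b k0 ea eb; apply: traverses_defect; rewrite -?ea //.
    by rewrite -(le k l) // -ea -eb.
  by move=> t tab; apply: h; rewrite ea eb !le.
- move=> a' c' b' acb an bD h1 h2 k l a b k0 ea eb.
  apply: (@traverses_iota _ _ _ _ _ ((c' - l) / k)); rewrite -?ea -?eb //.
  + by rewrite -(lt k l) // -(le k l) // -inv_ // -ea -eb.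
  + by move=> t tab; apply: h1; rewrite ea (inv_ k l c') // le // lt.
  + by move=> t tab; apply: h2; rewrite eb (inv_ k l c') // !le.
- move=> a' c' b' acb aD bn h1 h2 k l a b k0 ea eb.
  apply: (@traverses_omega _ _ _ _ _ ((c' - l) / k)); rewrite -?ea -?eb //.
  + by rewrite -(lt k l) // -(le k l) // -inv_ // -ea -eb.
  + by move=> t tab; apply: h1; rewrite ea (inv_ k l c') // !le.
  + by move=> t tab; apply: h2; rewrite eb (inv_ k l c') // le // lt.
- move=> a' c' b' v w u _ IH1 _ IH2 vwu k l a b k0 ea eb.
  apply: (traverses_concat (c := (c' - l) / k) _ _ vwu).
    by apply: IH1 => //; exact: inv_.
  by apply: IH2 => //; exact: inv_.
Qed.

Lemma traverses_ext (p q : R -> X) a b w : traverses p a b w ->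
  (forall t, a <= t <= b -> p t = q t) -> traverses q a b w.
Proof.
elim=> {a b w}.
- move=> a b ab an h pq; have ea := pq a; apply: traverses_bulk; rewrite -?ea ?lexx //.
  by move=> t tab; rewrite -pq //; exact: h.
- move=> a b ab an h pq; have ea := pq a; apply: traverses_defect; rewrite -?ea ?lexx //.
  by move=> t tab; rewrite -pq //; exact: h.
- move=> a c b /[dup] acb /andP[ac cb] an bD h1 h2 pq.
  have ea : p a = q a by apply: pq; rewrite lexx; lin.
  have eb : p b = q b by apply: pq; rewrite lexx andbT; lin.
  apply: (traverses_iota acb); rewrite -?ea -?eb //.
  + by move=> t /andP[t1 t2]; rewrite -pq; [apply: h1; rewrite t1|apply/andP; split; lin].
  + by move=> t /andP[t1 t2]; rewrite -pq; [apply: h2; rewrite t1|apply/andP; split; lin].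
- move=> a c b /[dup] acb /andP[ac cb] an bD h1 h2 pq.
  have ea : p a = q a by apply: pq; rewrite lexx; lin.
  have eb : p b = q b by apply: pq; rewrite lexx andbT; lin.
  apply: (traverses_omega acb); rewrite -?ea -?eb //.
  + by move=> t /andP[t1 t2]; rewrite -pq; [apply: h1; rewrite t1|apply/andP; split; lin].
  + by move=> t /andP[t1 t2]; rewrite -pq; [apply: h2; rewrite t1|apply/andP; split; lin].
- move=> a c b v w u hv IH1 hw IH2 vwu pq.
  have ac := traverses_le hv; have cb := traverses_le hw.
  apply: (traverses_concat (c := c) _ _ vwu).
    by apply: IH1 => t /andP[t1 t2]; apply: pq; apply/andP; split; lin.
  by apply: IH2 => t /andP[t1 t2]; apply: pq; apply/andP; split; lin.
Qed.

Lemma traverses_endpoints (p : R -> X) a b w : traverses p a b w ->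
  src w = kind (in_defect (p a)) /\ tgt w = kind (in_defect (p b)).
Proof.
elim=> {a b w}.
- move=> a b ab /in_defectP/negbTE an h; have /stratum_in_defect -> : stratum (p a) (p b).
    by apply: h; rewrite ab lexx.
  by rewrite an.
- move=> a b ab /in_defectP an h; have /stratum_in_defect -> : stratum (p a) (p b).
    by apply: h; rewrite ab lexx.
  by rewrite an.
- by move=> a c b _ /in_defectP/negbTE -> /in_defectP ->.
- by move=> a c b _ /in_defectP -> /in_defectP/negbTE ->.
- by move=> a c b v w u _ [<- _] _ [_ <-] vwu; rewrite (composes_src vwu) (composes_tgt vwu).
Qed.

Lemma first_entry (p : R -> X) a b : {within I, continuous p} -> 0 <= a -> a <= b -> b <= 1 ->
  ~~ in_defect (p a) -> in_defect (p b) ->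
  exists c, [/\ a < c, c <= b, in_defect (p c) & forall t, a <= t -> t < c -> ~~ in_defect (p t)].
Proof.
move=> cp a0 ab b1 an bD; apply: contrapT => none.
suff h : forall t, a <= t -> t <= b -> ~~ in_defect (p t).
  by have := h b ab (lexx b); rewrite bD.
apply: interval_continuous_induction => //.
- move=> t ta tb tn; have [||e e0 he] := near_in_window (within_near_in cp _ _ (near_bulk tn)); try lin.
  by exists e => // y ty yb yt; apply: he; lin.
- move=> t ta tb tn; apply/negP => tD; apply: none.
  by exists t; split.
Qed.

Lemma last_exit (p : R -> X) a b : {within I, continuous p} -> 0 <= a -> a <= b -> b <= 1 ->
  in_defect (p a) -> ~~ in_defect (p b) ->
  exists c, [/\ a <= c, c < b, in_defect (p c) & forall t, c < t -> t <= b -> ~~ in_defect (p t)].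
Proof.
move=> cp a0 ab b1 aD bn; pose q t := p (1 - t).
have cq : {within I, continuous q}.
  apply: (within_comp _ cp); last by move=> t; rewrite /= !in_itv /=; lin.
  by apply: continuous_subspaceT => t; apply: cvgB; [exact: cvg_cst|exact: cvg_id].
have [|||||c [bc ca cD cn]] := @first_entry q (1 - b) (1 - a) cq; rewrite /q ?subKr //; try lin.
exists (1 - c); split=> //; [lin|lin|].
by move=> t ct tb; have := cn (1 - t); rewrite /q subKr; apply; lin.
Qed.

(** Around each of its times a directed path enters the defect at most once before and
    leaves it at most once after; finitely many such windows cover the path. *)
Lemma exists_traverses (T : directed_triangulation X) (p : R -> X) : directed_path p ->
  exists w, traverses p 0 1 w.
Proof.
move=> dp; have [cp _] := dp.
have wp t : 0 <= t -> t <= 1 -> crosses_well T p t by exact: directed_crosses_well.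
have add (a c b : R) v w : traverses p a c v -> traverses p c b w -> exists u, traverses p a b u.
  move=> hv hw; have [_ vt] := traverses_endpoints hv; have [ws _] := traverses_endpoints hw.
  have [u vwu] : exists u, composes v w u by apply: exists_composes; rewrite vt ws.
  by exists u; exact: traverses_concat hv hw vwu.
have st (a b : R) s t : 0 <= a -> b <= 1 -> a <= s <= b -> a <= t <= b ->
    (forall r, a <= r <= b -> in_defect (p r) = in_defect (p a)) -> stratum (p s) (p t).
  move=> a0 b1 sab tab h; apply: (@path_stratum _ _ _ a b) => //.
  by apply: within_sub cp => r; rewrite /= !in_itv /=; lin.
have trD (a b : R) : 0 <= a -> a <= b -> b <= 1 ->
    (forall r, a <= r -> r <= b -> in_defect (p r)) -> exists w, traverses p a b w.
  move=> a0 ab b1 h; have aD : in_defect (p a) by apply: h.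
  exists Id_delta; apply: traverses_defect => //; first exact/in_defectP.
  move=> t tab; apply: (st a b); rewrite ?lexx //.
  by move=> r /andP[r1 r2]; rewrite aD h.
have trB (a b : R) : 0 <= a -> a <= b -> b <= 1 ->
    (forall r, a <= r -> r <= b -> ~~ in_defect (p r)) -> exists w, traverses p a b w.
  move=> a0 ab b1 h; have an : ~~ in_defect (p a) by apply: h.
  exists Id_beta; apply: traverses_bulk => //; first exact/in_defectP.
  move=> t tab; apply: (st a b); rewrite ?lexx //.
  by move=> r /andP[r1 r2]; rewrite (negbTE an) (negbTE (h r r1 r2)).
apply: (@interval_additive_induction _ (fun a b => exists w, traverses p a b w)); rewrite ?ler01 //.
  by move=> x y z _ _ _ _ [v hv] [w hw]; exact: add hv hw.
move=> t /andP[t0 t1]; have [tD|tn] := boolP (in_defect (p t)); last first.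
  have [e e0 he] := near_in_window (within_near_in cp t0 t1 (near_bulk tn)).
  exists e => // x y x0 xt ty y1 xe ye; apply: trB => //; first lin.
  by move=> r xr ry; apply: he; lin.
have [e e0 he] := near_in_window (wp t t0 t1).
exists e => // x y x0 xt ty y1 xe ye.
have [v hv] : exists v, traverses p x t v.
  have [xD|xn] := boolP (in_defect (p x)).
    apply: trD => // r xr rt; apply: (stays_in_defect cp wp (a := x) (b := t)) => //.
    move=> s xs st_ sn; have [||||//|//|h _] := he s; try lin.
    by apply: h; rewrite lt_neqAle st_ andbT; apply: contraNneq sn => ->.
  have [c [xc ct cD cn]] := first_entry cp x0 xt t1 xn tD.
  have inD r : c <= r -> r <= t -> in_defect (p r).
    move=> cr rt; apply: (stays_in_defect cp wp (a := c) (b := t)) => //; first lin.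
    move=> s xs st_ sn; have [||||//|//|h _] := he s; try lin.
    by apply: h; rewrite lt_neqAle st_ andbT; apply: contraNneq sn => ->.
  exists arrow_iota; apply: (@traverses_iota _ _ _ p x c t).
  + by rewrite xc.
  + exact/in_defectP.
  + exact/in_defectP.
  + move=> r /andP[xr rc]; apply: (st x r); rewrite ?lexx ?xr //; first lin.
    by move=> s /andP[s1 s2]; rewrite (negbTE xn); apply/negbTE/cn => //; lin.
  + move=> r /andP[cr rt]; apply: (st c t); rewrite ?cr ?rt ?ct ?lexx //; first lin.
    by move=> s /andP[s1 s2]; rewrite cD inD.
have [w hw] : exists w, traverses p t y w.
  have [yD|yn] := boolP (in_defect (p y)).
    apply: trD => // r tr ry; apply: (stayed_in_defect cp wp (a := t) (b := y)) => //.
    move=> s ts sy sn; have [||||//|//|_ h] := he s; try lin.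
    by apply: h; rewrite lt_neqAle ts andbT; apply: contraNneq sn => <-.
  have [c [tc cy cD cn]] := last_exit cp t0 ty y1 tD yn.
  have inD r : t <= r -> r <= c -> in_defect (p r).
    move=> tr rc; apply: (stayed_in_defect cp wp (a := t) (b := c)) => //; first lin.
    move=> s ts sy sn; have [||||//|//|_ h] := he s; try lin.
    by apply: h; rewrite lt_neqAle ts andbT; apply: contraNneq sn => <-.
  exists arrow_omega; apply: (@traverses_omega _ _ _ p t c y).
  + by rewrite tc.
  + exact/in_defectP.
  + exact/in_defectP.
  + move=> r /andP[tr rc]; apply: (st t c); rewrite ?tr ?rc ?tc ?lexx //; first lin.
    by move=> s /andP[s1 s2]; rewrite !inD.
  + move=> r /andP[cr ry]; apply: (st r y); rewrite ?lexx ?ry //; first lin.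
    by move=> s /andP[s1 s2]; rewrite (negbTE (cn r cr ry)); apply/negbTE/cn => //; lin.
exact: add hv hw.
Qed.

Definition represented x y (f : dpath_class_type x y) (w : arrow (path_category Gamma2)) : Prop :=
  exists p : dpath x y, dpath_class p = f /\ traverses p 0 1 w.

Lemma represented_concat x y z (f : dpath_class_type x y) (g : dpath_class_type y z) v w u :
  composes v w u -> represented f v -> represented g w -> represented (class_concat f g) u.
Proof.
move=> vwu [p [<- pv]] [q [<- qw]]; exists (dpath_concat p q); split; first by rewrite class_concatE.
have h2 : 0 < (2 : R) by lin.
apply: (traverses_concat (c := 2^-1) _ _ vwu).
  apply: (@traverses_ext (fun t => p (2 * t + 0))).
    by apply: (traverses_affine pv) => //; lin.
  by move=> t /andP[t0 t1]; rewrite /= /path_concat t1 addr0.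
apply: (@traverses_ext (fun t => q (2 * t + - 1))).
  by apply: (traverses_affine qw) => //; lin.
move=> t /andP[t0 t1]; rewrite /= /path_concat; case: leP => // ht.
have -> : t = 2^-1 by lin.
have -> : 2 * 2^-1 = 1 :> R by field.
by rewrite subrr dpath0 dpath1.
Qed.

Lemma represented_same x y (p : dpath x y) :
  (forall t, 0 <= t <= 1 -> in_defect (p t) = in_defect x) ->
  represented (dpath_class p) (idw (kind (in_defect x))).
Proof.
move=> hp; exists p; split=> //.
have p0 : p 0 = x by exact: dpath0.
have st t : 0 <= t <= 1 -> stratum (p 0) (p t).
  move=> t01; apply: (@path_stratum _ _ _ 0 1) => //; rewrite ?lexx ?ler01 //.
    exact: (proj1 (dpath_directed p)).
  by move=> u u01; rewrite !hp ?lexx ?ler01.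
have [xD|xn] := boolP (in_defect x).
  by apply: traverses_defect; rewrite ?ler01 //; apply/in_defectP; rewrite p0.
by apply: traverses_bulk; rewrite ?ler01 //; apply/in_defectP; rewrite p0.
Qed.

Lemma represented_id x : represented (dpath_class (dpath_id x)) (idw (kind (in_defect x))).
Proof. exact: represented_same. Qed.

Lemma composes_idl (w : arrow (path_category Gamma2)) : composes (idw (src w)) w w.
Proof. by apply/composesE; rewrite arrow_comp1f. Qed.

Lemma composes_idr (w : arrow (path_category Gamma2)) : composes w (idw (tgt w)) w.
Proof. by apply/composesE; rewrite arrow_compf1. Qed.

Section Family.
Variables (J : Type) (pt : J -> X).

Definition assignment : Type := forall i j : J, dpath_class_type (pt i) (pt j) -> option (arrow C).

(** These are the functors over the path category from the full subcategory on the points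
    of a family, with sources and targets left implicit. *)
Record is_family (Lam : assignment) : Prop := IsFamily {
  family_comp : forall i j k (f : dpath_class_type (pt i) (pt j)) (g : dpath_class_type (pt j) (pt k)),
    Lam i k (class_concat f g) = Lam i j f ** Lam j k g;
  family_above : forall i j (f : dpath_class_type (pt i) (pt j)) w,
    represented f w -> lies_above w (Lam i j f) }.

Variable Lam : assignment.
Hypothesis Lam_family : is_family Lam.

Lemma family_id i : Lam (dpath_class (dpath_id (pt i))) = one (pt i).
Proof.
apply: (unit_idempotent C_regular); first exact: (family_above Lam_family (represented_id _)).
by rewrite -(family_comp Lam_family) class_concat1f.
Qed.

Lemma family_one i j (f : dpath_class_type (pt i) (pt j)) : Lam f ** one (pt j) = Lam f.
Proof. by rewrite -family_id -(family_comp Lam_family) class_concatf1. Qed.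

Lemma one_family i j (f : dpath_class_type (pt i) (pt j)) : one (pt i) ** Lam f = Lam f.
Proof. by rewrite -family_id -(family_comp Lam_family) class_concat1f. Qed.

End Family.

(** A path inside the stratum is inverted by the same path travelled backwards. *)
Lemma exists_stratum_class (T : directed_triangulation X) x y : stratum x y ->
  exists fg : dpath_class_type x y * dpath_class_type y x,
    [/\ class_concat fg.1 fg.2 = dpath_class (dpath_id x),
        class_concat fg.2 fg.1 = dpath_class (dpath_id y),
        represented fg.1 (idw (kind (in_defect x))) &
        represented fg.2 (idw (kind (in_defect x)))].
Proof.
move=> xy; have yx := stratum_in_defect xy.
have [p [cp p0 p1 hp]] := stratum_path T xy.
have dp : directed_path p.
  by apply: single_stratum_directed => // t t01; rewrite !hp ?lexx ?ler01.
have [q [hq pq qp]] := @stratum_path_inverse _ _ _ x y (DPath dp p0 p1) hp.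
exists (dpath_class (DPath dp p0 p1), dpath_class q); split=> //=.
  exact: represented_same.
rewrite -yx; apply: represented_same => t t01; rewrite hq /= hp ?yx //.
by apply/andP; split; lin.
Qed.

End Families.

(** * Colorings and functors on the vertices *)

Section VertexFamilies.
Variables (R : realType) (d : nat) (X : manifold_with_defect R d).
Variable T : directed_triangulation X.
Variable C : parcel Gamma2.
Hypothesis C_regular : regular_parcel C.
Local Notation vpt := (@vertex_point _ _ X T).
Local Notation dv i := (in_defect (vpt i)).
Local Notation vtx := (nearby_vertex T).
Local Notation K := (simplices T).
Local Notation one x := (unit_over C (kind (in_defect x))).
Local Notation idw v := (@id_arrow (path_category Gamma2) v).
Implicit Types (x y z : X) (r s t : R) (u v w : 'I_(nvertices T)).

Lemma edge_kind u v x : [set u; v]%SET \in K -> dv u = dv v ->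
  simplex [set u; v]%SET x -> in_defect x = dv u.
Proof.
move=> uvK same /(simplexP _ uvK) /fintype.subsetP xs.
have := xs _ (nearby_vertex_in T x); rewrite -(nearby_vertex_in_defect T x).
by rewrite finset.in_set2 => /orP[] /eqP ->.
Qed.

Lemma coloring_above c (e : oriented_edge T) : colorings C T c ->
  above C (step_arrow (dv (initial e)) (dv (terminal e))) (c e).
Proof.
move=> [c1 c2 c3 c4 _]; have [_ uvK] := edge_dirP (svalP e).
case iD : (dv (initial e)); case tD : (dv (terminal e)) => /=.
- apply: c2 => x /(edge_kind uvK); rewrite -/(initial e) iD tD => /(_ erefl) /in_defectP.
  by [].
- by apply: c4; [exact/in_defectP|apply/in_defectP; rewrite tD].
- by apply: c3; [apply/in_defectP; rewrite iD|exact/in_defectP].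
- apply: c1 => x /(edge_kind uvK); rewrite -/(initial e) iD tD => /(_ erefl) xn.
  by move=> /in_defectP; rewrite xn.
Qed.

Definition pair_color (c : oriented_edge T -> arrow C) u v : option (arrow C) :=
  omap c (insub (u, v)).

Lemma pair_colorE c (e : oriented_edge T) : pair_color c (initial e) (terminal e) = Some (c e).
Proof.
by rewrite /pair_color /initial /terminal -surjective_pairing valK.
Qed.

Lemma pair_color_above c : colorings C T c -> forall u v, edge_dir u v ->
  lies_above (step_arrow (dv u) (dv v)) (pair_color c u v).
Proof.
move=> Hc u v uv; pose e : oriented_edge T := exist _ (u, v) uv.
by exists (c e); [exact: (pair_colorE c e)|exact: (coloring_above e Hc)].
Qed.

Lemma pair_color_triangle c : colorings C T c -> forall u v w, edge_dir u v -> edge_dir v w ->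
  edge_dir u w -> [set u; v; w]%SET \in K ->
  pair_color c u v ** pair_color c v w = pair_color c u w.
Proof.
move=> [_ _ _ _ c5] u v w uv vw uw sK.
pose e : oriented_edge T := exist _ (u, v) uv; pose f : oriented_edge T := exist _ (v, w) vw.
pose g : oriented_edge T := exist _ (u, w) uw.
rewrite (pair_colorE c e) (pair_colorE c f) (pair_colorE c g).
by apply/composesE; apply: (c5 e f g).
Qed.

Definition coloring_system c (Hc : colorings C T c) : edge_system T C :=
  EdgeSystem C_regular (pair_color_above Hc) (pair_color_triangle Hc).

Lemma system_eq (L L' : edge_system T C) : (forall u v, edge_dir u v -> L u v = L' u v) ->
  (forall u v, ~~ edge_dir u v -> L u v = L' u v) -> L = L'.
Proof.
case: L => r l a t; case: L' => r' l' a' t' /= h1 h2.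
have e : l = l'.
  by apply/funext => u; apply/funext => v; case: (boolP (edge_dir u v)); [exact: h1|exact: h2].
case: l' / e a' t' h1 h2 => a' t' _ _.
by rewrite (Prop_irrelevance r r') (Prop_irrelevance a a') (Prop_irrelevance t t').
Qed.

(** A functor on the vertices extends to all points along the segments to their nearby
    vertices. *)
Section Extension.
Variable Lam : assignment C vpt.
Hypothesis Lam_family : is_family Lam.

Lemma to_vertex_directed x : directed_path (mix T x (vpt (vtx x))).
Proof.
have jx : joinable T x (vpt (vtx x)) by exact/joinable_vertex/nearby_vertex_in.
apply: single_stratum_directed; first exact: mix_path_continuous.
by move=> t t01; rewrite !in_defect_mix_same ?nearby_vertex_in_defect ?lexx ?ler01.
Qed.

Lemma from_vertex_directed x : directed_path (mix T (vpt (vtx x)) x).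
Proof.
have jx : joinable T (vpt (vtx x)) x by apply/joinable_sym/joinable_vertex/nearby_vertex_in.
apply: single_stratum_directed; first exact: mix_path_continuous.
by move=> t t01; rewrite !in_defect_mix_same ?nearby_vertex_in_defect ?lexx ?ler01.
Qed.

Definition to_vertex x := dpath_class (mix_dpath (to_vertex_directed x)).
Definition from_vertex x := dpath_class (mix_dpath (from_vertex_directed x)).

Lemma to_from_vertex x : class_concat (to_vertex x) (from_vertex x) = dpath_class (dpath_id x).
Proof.
have jx : joinable T x (vpt (vtx x)) by exact/joinable_vertex/nearby_vertex_in.
have [|q [hq pq _]] := @stratum_path_inverse _ _ _ _ _ (mix_dpath (to_vertex_directed x)).
  by move=> t t01; rewrite in_defect_mix_same // nearby_vertex_in_defect.
rewrite -[RHS]pq; congr class_concat; apply/dpath_classP/dequiv_ext => t _ /=.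
by rewrite hq /= mix_sym subKr.
Qed.

Lemma from_to_vertex x :
  class_concat (from_vertex x) (to_vertex x) = dpath_class (dpath_id (vpt (vtx x))).
Proof.
have jx : joinable T x (vpt (vtx x)) by exact/joinable_vertex/nearby_vertex_in.
have [|q [hq _ qp]] := @stratum_path_inverse _ _ _ _ _ (mix_dpath (to_vertex_directed x)).
  by move=> t t01; rewrite in_defect_mix_same // nearby_vertex_in_defect.
rewrite -[RHS]qp; congr class_concat; apply/dpath_classP/dequiv_ext => t _ /=.
by rewrite hq /= mix_sym subKr.
Qed.

Lemma represented_to_vertex x : represented (to_vertex x) (idw (kind (in_defect x))).
Proof.
apply: represented_same => t t01.
rewrite /= in_defect_mix_same ?nearby_vertex_in_defect //.
exact/joinable_vertex/nearby_vertex_in.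
Qed.

Lemma represented_from_vertex x : represented (from_vertex x) (idw (kind (in_defect x))).
Proof.
rewrite -(nearby_vertex_in_defect T x); apply: represented_same => t t01.
rewrite /= in_defect_mix_same ?nearby_vertex_in_defect //.
exact/joinable_sym/joinable_vertex/nearby_vertex_in.
Qed.

Definition extension : arrow_assignment X C := fun x y f =>
  Lam (i := vtx x) (j := vtx y) (class_concat (from_vertex x) (class_concat f (to_vertex y))).

(** The nearby vertex of a vertex is itself, up to an equality of indices. *)
Lemma extensionE u v (f : dpath_class_type (vpt u) (vpt v)) : extension f = Lam f.
Proof.
rewrite /extension.
have triv (w w' : 'I_(nvertices T)) (e : w = w') (p : dpath (vpt w) (vpt w')) :
    (forall t, p t = mix T (vpt w) (vpt w') t) -> dpath_class p =
    eq_rect w (fun v => dpath_class_type (vpt w) (vpt v)) (dpath_class (dpath_id _)) w' e.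
  case: w' / e p => p hp /=; apply/dpath_classP/dequiv_ext => t _.
  by rewrite hp mix_same.
rewrite /from_vertex (triv _ _ (nearby_vertexK u)) // /to_vertex
  (triv _ _ (esym (nearby_vertexK v))) //.
have gen (u' v' : 'I_(nvertices T)) (eu : u' = u) (ev : v = v') :
  Lam (i := u') (j := v') (class_concat
    (eq_rect u' (fun v => dpath_class_type (vpt u') (vpt v)) (dpath_class (dpath_id _)) u eu)
    (class_concat f
      (eq_rect v (fun w => dpath_class_type (vpt v) (vpt w)) (dpath_class (dpath_id _)) v' ev))) =
  Lam f.
  case: v' / ev; move: f; case: u / eu => f /=.
  by rewrite class_concatf1 class_concat1f.
exact: gen.
Qed.

Lemma extension_transport : is_transport T extension.
Proof.
split.
- move=> x y z f g; rewrite /extension -(family_comp Lam_family); congr (Lam _).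
  rewrite !class_concatA; congr class_concat; congr class_concat.
  by rewrite -(class_concatA (to_vertex y)) to_from_vertex class_concat1f.
- move=> x y p a pa; apply: (family_above Lam_family).
  have pr : represented (dpath_class p) a by exists p.
  have [sa ta] := traverses_endpoints pa; rewrite dpath0 dpath1 in sa ta.
  apply: (represented_concat (composes_idl a)); first by rewrite sa; exact: represented_from_vertex.
  apply: (represented_concat (composes_idr a) pr).
  by rewrite ta; exact: represented_to_vertex.
- move=> x l hl.
  have -> : dpath_class l = to_vertex x.
    apply/dpath_classP/dequiv_ext => t; rewrite /= in_itv /= => t01.
    by rewrite hl.
  rewrite /extension -class_concatA from_to_vertex class_concat1f.
  have triv w (e : vtx x = w) (p : dpath (vpt (vtx x)) (vpt w)) :
      (forall t, p t = mix T (vpt (vtx x)) (vpt (vtx x)) t) -> Lam (dpath_class p) = one x.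
    case: w / e p => p hp; have -> : dpath_class p = dpath_class (dpath_id _).
      by apply/dpath_classP/dequiv_ext => t _; rewrite hp mix_same.
    by rewrite (family_id C_regular Lam_family) nearby_vertex_in_defect.
  apply: (triv _ (esym (nearby_vertexK (vtx x)))) => t /=.
  by rewrite nearby_vertexK.
Qed.

End Extension.

Definition colored_by (c : oriented_edge T -> arrow C) (Lam : assignment C vpt) : Prop :=
  forall (e : oriented_edge T) (p : dpath (vpt (initial e)) (vpt (terminal e))),
    (forall t, 0 <= t <= 1 -> p t = mix T (vpt (initial e)) (vpt (terminal e)) t) ->
    Lam _ _ (dpath_class p) = Some (c e).

Lemma coloring_family c : colorings C T c -> exists2 Lam, is_family Lam & colored_by c Lam.
Proof.
move=> Hc; have Phi := system_transport_is_transport (coloring_system Hc).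
exists (fun u v f => system_transport (coloring_system Hc) f).
  split=> [u v w f g|u v f a [p [<- pa]]]; first exact: (transport_comp Phi).
  exact: (transport_above Phi).
move=> e p hp; rewrite system_transportE (holonomy_edge _ (svalP e) hp).
exact: pair_colorE.
Qed.

Lemma family_coloring Lam : is_family Lam -> exists2 c, colorings C T c & colored_by c Lam.
Proof.
move=> Lf; have Phi := extension_transport Lf.
have colE u v (p : dpath (vpt u) (vpt v)) : edge_dir u v ->
    (forall t, 0 <= t <= 1 -> p t = mix T (vpt u) (vpt v) t) ->
    Lam u v (dpath_class p) = transport_color (extension Lam) u v.
  by move=> uv hp; rewrite -extensionE; exact: transport_colorE.
have [c hc] : exists c : oriented_edge T -> arrow C, forall e,
    transport_color (extension Lam) (initial e) (terminal e) = Some (c e).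
  have hex (e : oriented_edge T) : exists a, transport_color (extension Lam) (initial e) (terminal e) = Some a.
    by have [a ea _] := transport_color_above Phi (svalP e); exists a.
  by exists (fun e => projT1 (cid (hex e))) => e; case: cid.
have cab (e : oriented_edge T) : above C (step_arrow (dv (initial e)) (dv (terminal e))) (c e).
  by have [a] := transport_color_above Phi (svalP e); rewrite hc => -[->].
have ends (e : oriented_edge T) : edge_simplex e (vpt (initial e)) /\ edge_simplex e (vpt (terminal e)).
  have [_ eK] := edge_dirP (svalP e).
  by split; apply/(simplexP _ eK); rewrite carrier_vertex finset.sub1set !inE eqxx ?orbT.
exists c; last by move=> e p hp; rewrite colE ?hc //; exact: (svalP e).
split=> [e eb|e eD|e ib tD|e iD tb|e f g te ie tf sK].
- have [/eb/in_defectP/negbTE i0 /eb/in_defectP/negbTE t0] := ends e.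
  by have := cab e; rewrite i0 t0.
- have [/eD/in_defectP i0 /eD/in_defectP t0] := ends e.
  by have := cab e; rewrite i0 t0.
- by have := cab e; move: ib tD => /in_defectP/negbTE -> /in_defectP ->.
- by have := cab e; move: iD tb => /in_defectP -> /in_defectP/negbTE ->.
- have ef : edge_dir (terminal e) (terminal f) by rewrite te; exact: (svalP f).
  have eg : edge_dir (initial e) (terminal f) by rewrite ie tf; exact: (svalP g).
  apply/composesE; change (Some (c e) ** Some (c f) = Some (c g)).
  rewrite -!hc -te -ie -tf.
  exact: (transport_color_triangle Phi (svalP e)).
Qed.

Lemma colored_by_coloring c c' Lam : colored_by c Lam -> colored_by c' Lam -> c = c'.
Proof.
move=> h h'; apply/funext => e; apply: Some_inj.
by rewrite -(h e (mix_dpath (edge_directed (svalP e)))) // -(h' e (mix_dpath (edge_directed (svalP e)))).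
Qed.

(** The extension to all points is a transport, so it is the holonomy of the coloring. *)
Lemma colored_by_family c Lam Lam' : is_family Lam -> is_family Lam' ->
  colored_by c Lam -> colored_by c Lam' -> Lam = Lam'.
Proof.
move=> Lf Lf' h h'; have Phi := extension_transport Lf; have Phi' := extension_transport Lf'.
have e : transport_system C_regular Phi = transport_system C_regular Phi'.
  apply: system_eq => u v uv /=; last by rewrite /transport_color; case: pselect => // uv1; rewrite uv1 in uv.
  pose e : oriented_edge T := exist _ (u, v) uv.
  rewrite -(transport_colorE (extension Lam) (p := mix_dpath (edge_directed uv))) //.
  rewrite -(transport_colorE (extension Lam') (p := mix_dpath (edge_directed uv))) // !extensionE.
  by rewrite (h e (mix_dpath (edge_directed uv))) // (h' e (mix_dpath (edge_directed uv))).
apply: functional_extensionality_dep => u; apply: functional_extensionality_dep => v; apply/funext => f.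
rewrite -(extensionE Lam) -(extensionE Lam') -(dpath_class_repr f).
by rewrite (transport_holonomy C_regular Phi) (transport_holonomy C_regular Phi') e.
Qed.

End VertexFamilies.

(** * Changing the base points *)

Section Gauges.
Variables (R : realType) (d : nat) (X : manifold_with_defect R d).
Variable T : directed_triangulation X.
Variable C : parcel Gamma2.
Hypothesis C_regular : regular_parcel C.
Variable B : set X.
Hypothesis B_base : base_points B.
Local Notation vpt := (@vertex_point _ _ X T).
Local Notation dv i := (in_defect (vpt i)).
Local Notation vtx := (nearby_vertex T).
Local Notation one x := (unit_over C (kind (in_defect x))).
Local Notation idw v := (@id_arrow (path_category Gamma2) v).
Local Notation "f @; g" := (class_concat f g) (at level 60, right associativity).
Local Notation bpt := {x : X | B x}.
Local Notation basept := (fun o : bpt => sval o).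
Implicit Types (x y z : X) (u v w : 'I_(nvertices T)) (o : bpt).

Lemma exists_base v : exists o : bpt, stratum (sval o) (vpt v).
Proof.
have [b [[Bb vb] _]] := B_base (vpt v).
by exists (exist _ b Bb); exact: stratum_sym.
Qed.

Definition base v : bpt := projT1 (cid (exists_base v)).

Lemma base_stratum v : stratum (sval (base v)) (vpt v).
Proof. by rewrite /base; case: cid. Qed.

Lemma base_uniq o v : stratum (sval o) (vpt v) -> o = base v.
Proof.
move=> ov; have bv := base_stratum v; have [b [_ bu]] := B_base (vpt v).
case: o ov => x Bx /= xv; case: (base v) bv => y By /= yv.
have e : x = y by rewrite -(bu x) ?(bu y) //; split=> //; exact: stratum_sym.
by case: y / e By {yv} => By; rewrite (Prop_irrelevance Bx By).
Qed.

(** The vertex that stands for the stratum of o. *)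
Definition root o : 'I_(nvertices T) := vtx (sval o).

Lemma root_stratum o : stratum (sval o) (vpt (root o)).
Proof. exact: nearby_vertex_stratum. Qed.

Lemma base_root o : o = base (root o).
Proof. exact/base_uniq/root_stratum. Qed.

Definition is_root v := root (base v) == v.

Lemma is_root_root o : is_root (root o).
Proof. by rewrite /is_root -base_root. Qed.

Section Joins.
Variables (o : bpt) (v : 'I_(nvertices T)) (ov : stratum (sval o) (vpt v)).

Let pair := projT1 (cid (exists_stratum_class T ov)).
Definition join : dpath_class_type (sval o) (vpt v) := pair.1.
Definition back : dpath_class_type (vpt v) (sval o) := pair.2.

Lemma join_back : join @; back = dpath_class (dpath_id (sval o)).
Proof. by rewrite /join /back /pair; case: cid => p []. Qed.

Lemma back_join : back @; join = dpath_class (dpath_id (vpt v)).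
Proof. by rewrite /join /back /pair; case: cid => p []. Qed.

Lemma represented_join : represented join (idw (kind (in_defect (sval o)))).
Proof. by rewrite /join /pair; case: cid => p []. Qed.

Lemma represented_back : represented back (idw (kind (in_defect (sval o)))).
Proof. by rewrite /back /pair; case: cid => p []. Qed.

End Joins.

Lemma joinK o v (ov : stratum (sval o) (vpt v)) y (f : dpath_class_type (sval o) y) :
  join ov @; back ov @; f = f.
Proof. by rewrite -class_concatA join_back class_concat1f. Qed.

Lemma backK o v (ov : stratum (sval o) (vpt v)) y (f : dpath_class_type (vpt v) y) :
  back ov @; join ov @; f = f.
Proof. by rewrite -class_concatA back_join class_concat1f. Qed.

Lemma represented_conj x x' y y' (e : dpath_class_type x' x) (f : dpath_class_type x y)
    (g : dpath_class_type y y') (a : arrow (path_category Gamma2)) : represented f a ->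
  represented e (idw (kind (in_defect x))) -> represented g (idw (kind (in_defect y))) ->
  represented (e @; f @; g) a.
Proof.
move=> [p [<- pw]] he hg; have [sw tw] := traverses_endpoints pw; rewrite dpath0 dpath1 in sw tw.
apply: (represented_concat (composes_idl a)); first by rewrite sw.
by apply: (represented_concat (composes_idr a)); [exists p|rewrite tw].
Qed.

Lemma stratum_defect o v : stratum (sval o) (vpt v) -> in_defect (sval o) = dv v.
Proof. by move=> /stratum_in_defect. Qed.

(** Changes of trivialization at the vertices; at the roots the trivialization is fixed by
    the one at the base point. *)
Definition gauges : set ('I_(nvertices T) -> option (arrow C)) :=
  [set h | forall v, lies_above (idw (kind (dv v))) (h v) /\ (is_root v -> h v = one (vpt v))].

Definition descend (Lam : assignment C vpt) : assignment C basept := fun o o' f =>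
  Lam (root o) (root o') (back (root_stratum o) @; f @; join (root_stratum o')).

(** The value of Lam on the way from the root to v through the base point, that is, the
    trivialization of Lam at v when the one at the root is the identity. *)
Definition comparison (Lam : assignment C vpt) v : option (arrow C) :=
  Lam (root (base v)) v (back (root_stratum (base v)) @; join (base_stratum v)).

Definition ascend (Psi : assignment C basept) (h : 'I_(nvertices T) -> option (arrow C)) :
    assignment C vpt := fun u v f =>
  pinv (h u) ** Psi (base u) (base v) (join (base_stratum u) @; f @; back (base_stratum v)) ** h v.

Lemma descend_family Lam : is_family Lam -> is_family (descend Lam).
Proof.
move=> Lf; split=> [b1 b2 b3 f g|b b' f a fa].
  rewrite /descend -(family_comp Lf); congr (Lam _ _ _).
  by rewrite !class_concatA joinK.
apply: (family_above Lf); apply: represented_conj fa _ _; first exact: represented_back.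
exact: represented_join.
Qed.

Lemma comparison_above Lam v : is_family Lam -> lies_above (idw (kind (dv v))) (comparison Lam v).
Proof.
move=> Lf; apply: (family_above Lf).
rewrite -(stratum_defect (base_stratum v)).
apply: (represented_concat (composes_idr _)); first exact: represented_back.
exact: represented_join.
Qed.

Lemma comparison_root Lam v : is_family Lam -> is_root v -> comparison Lam v = one (vpt v).
Proof.
move=> Lf /eqP rv; rewrite /comparison.
move: (root_stratum (base v)) (base_stratum v); rewrite rv => h h'.
by rewrite (Prop_irrelevance h h') back_join (family_id C_regular Lf).
Qed.

Lemma comparison_gauge Lam : is_family Lam -> gauges (comparison Lam).
Proof. by move=> Lf v; split; [exact: comparison_above|exact: comparison_root]. Qed.

Lemma ascend_family Psi h : is_family Psi -> gauges h -> is_family (ascend Psi h).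
Proof.
move=> Pf hg; split=> [u v w f g|u v f a fa].
  have [hv _] := hg v; have [_ hi _] := pinvP C_regular hv.
  rewrite /ascend !pcompA -[_ ** h v ** pinv (h v)]pcompA hi.
  rewrite -(stratum_defect (base_stratum v)) -[X in _ = X ** _ ** _]pcompA (family_one C_regular Pf).
  rewrite -[in RHS](pcompA (pinv (h u))) -(family_comp Pf) !class_concatA.
  by rewrite -(class_concatA (back _) (join _)) back_join class_concat1f.
have [hu _] := hg u; have [hv _] := hg v; have [iu _ _] := pinvP C_regular hu.
have [p [_ pa]] := fa; have [sa ta] := traverses_endpoints pa; rewrite dpath0 dpath1 in sa ta.
rewrite -sa in iu; rewrite -ta in hv.
apply: (lies_above_comp C_regular (composes_idr a)) hv.
apply: (lies_above_comp C_regular (composes_idl a) iu).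
apply: (family_above Pf); apply: represented_conj fa _ _.
  by rewrite -(stratum_defect (base_stratum u)); exact: represented_join.
by rewrite -(stratum_defect (base_stratum v)); exact: represented_back.
Qed.

Lemma ascend_descend Lam : is_family Lam -> ascend (descend Lam) (comparison Lam) = Lam.
Proof.
move=> Lf; apply: functional_extensionality_dep => u; apply: functional_extensionality_dep => v.
apply/funext => f; rewrite /ascend.
have cu := comparison_above u Lf.
have <- : Lam u (root (base u)) (back (base_stratum u) @; join (root_stratum (base u))) =
    pinv (comparison Lam u).
  apply: (pinv_uniq C_regular cu).
    apply: (family_above Lf); rewrite -(stratum_defect (base_stratum u)).
    apply: (represented_concat (composes_idr _)); first exact: represented_back.
    exact: represented_join.
  rewrite /comparison -(family_comp Lf) !class_concatA joinK back_join (family_id C_regular Lf).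
  by rewrite -(stratum_defect (root_stratum (base u))) (stratum_defect (base_stratum u)).
rewrite /descend /comparison -!(family_comp Lf) !class_concatA.
by rewrite !joinK !backK back_join class_concatf1.
Qed.

(** The base points of the roots are equal to the given ones only propositionally; they are
    generalized here to be substituted. *)
Lemma conj_base (Psi : assignment C basept) o1 o2 b1 b2 u v (e1 : o1 = b1) (e2 : o2 = b2)
    (ou : stratum (sval o1) (vpt u)) (bu : stratum (sval b1) (vpt u))
    (ov : stratum (sval o2) (vpt v)) (bv : stratum (sval b2) (vpt v))
    (f : dpath_class_type (sval o1) (sval o2)) :
  Psi b1 b2 (join bu @; (back ou @; f @; join ov) @; back bv) = Psi o1 o2 f.
Proof.
case: b1 / e1 bu => bu; case: b2 / e2 bv => bv.
rewrite (Prop_irrelevance bu ou) (Prop_irrelevance bv ov).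
by rewrite !class_concatA joinK join_back class_concatf1.
Qed.

Lemma descend_ascend Psi h : is_family Psi -> gauges h -> descend (ascend Psi h) = Psi.
Proof.
move=> Pf hg; apply: functional_extensionality_dep => o; apply: functional_extensionality_dep => o'.
apply/funext => f; rewrite /descend /ascend.
rewrite (conj_base Psi (base_root o) (base_root o')).
have hr o1 : h (root o1) = one (sval o1).
  by rewrite (proj2 (hg (root o1)) (is_root_root o1)) -(stratum_defect (root_stratum o1)).
by rewrite !hr (pinv_unit C_regular) (one_family C_regular Pf) (family_one C_regular Pf).
Qed.

Lemma comparison_ascend Psi h : is_family Psi -> gauges h -> comparison (ascend Psi h) = h.
Proof.
move=> Pf hg; apply/funext => v; rewrite /comparison /ascend.
have := @conj_base Psi _ _ _ _ _ _ (base_root (base v)) (erefl (base v))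
  (root_stratum (base v)) (base_stratum _) (base_stratum v) (base_stratum v)
  (dpath_class (dpath_id _)).
rewrite class_concat1f => ->.
rewrite (family_id C_regular Pf).
have [hv _] := hg v; have [_ /(_ (is_root_root _)) ->] := hg (root (base v)).
rewrite -(stratum_defect (root_stratum (base v))).
rewrite (pinv_unit C_regular) (stratum_defect (base_stratum v)) -pcompA.
by rewrite !(unit_comp C_regular (w := idw (kind (dv v)))).
Qed.

End Gauges.

(** * Functors from the fundamental parcel *)

Section ParcelFunctors.
Variables (R : realType) (d : nat) (X : manifold_with_defect R d).
Variable T : directed_triangulation X.
Variable C : parcel Gamma2.
Hypothesis C_regular : regular_parcel C.
Variable B : set X.
Local Notation bpt := {x : X | B x}.
Local Notation basept := (fun o : bpt => sval o).
Local Notation P := (fundamental_parcel B).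

(** F and Psi are the same functor, with typed and untyped values. *)
Definition agrees (F : functor P C) (Psi : assignment C basept) : Prop :=
  forall (x y : bpt) (f : dpath_class_type (sval x) (sval y)),
    Psi x y f = Some (map_arrow F (@Arrow P x y f)).

Lemma functor_family F : parcel_functors B C F -> exists2 Psi, is_family Psi & agrees F Psi.
Proof.
move=> [_ FG].
exists (fun x y f => Some (map_arrow F (@Arrow P x y f))) => //.
split=> [x y z f g|x y f a [p [<- pa]]].
  by rewrite /= arrow_compE /map_arrow /= -fmor_comp.
eexists; first by [].
by apply: FG; exists x, y, p.
Qed.

(** The source and target are forced by regularity once the class is known to lie above some
    arrow of the path category. *)
Lemma family_value (Psi : assignment C basept) x y (f : dpath_class_type (sval x) (sval y)) : is_family Psi ->
  exists m : @mor C (object_over C (structure_ob (sval x))) (object_over C (structure_ob (sval y))),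
    Psi x y f = Some (Arrow m).
Proof.
move=> Pf; have [w pw] := exists_traverses T (dpath_directed (repr f)).
have [sw tw] := traverses_endpoints pw; rewrite dpath0 dpath1 in sw tw.
have [|a -> aw] := family_above Pf (f := f) (w := w).
  by exists (repr f); rewrite dpath_class_repr.
have := above_src C_regular aw; have := above_tgt C_regular aw; rewrite sw tw.
case: a {aw} => a b m /= eb ea; rewrite eb ea in m *.
by exists m.
Qed.

Section FamilyFunctor.
Variable Psi : assignment C basept.
Hypothesis Psi_family : is_family Psi.

Let value (x y : bpt) f := projT1 (cid (@family_value Psi x y f Psi_family)).

Let valueE x y f : @Psi x y f = Some (Arrow (@value x y f)).
Proof. by rewrite /value; case: cid. Qed.

Lemma value_id x : value (dpath_class (dpath_id (sval x))) = idm (object_over C (structure_ob (sval x))).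
Proof.
apply: arrow_inj; apply: Some_inj; rewrite -valueE.
exact: (family_id C_regular Psi_family).
Qed.

Lemma value_comp x y z f g : @value x z (class_concat f g) = mcomp (@value x y f) (@value y z g).
Proof.
apply: arrow_inj; apply: Some_inj; rewrite -valueE (family_comp Psi_family) !valueE.
exact: arrow_compE.
Qed.

Definition family_functor : functor P C :=
  @Functor P C (fun x => object_over C (structure_ob (sval x))) value value_id value_comp.

Lemma family_functor_agrees : agrees family_functor Psi.
Proof. by move=> x y f; rewrite valueE. Qed.

Lemma family_functor_parcel : parcel_functors B C family_functor.
Proof.
split=> [x|f w [x [y [p [-> pw]]]]]; first exact: object_overK.
have [|a + aw] := family_above Psi_family (i := x) (j := y) (f := dpath_class p) (w := w).
  by exists p.
by rewrite valueE => -[e]; rewrite -aw -e.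
Qed.

End FamilyFunctor.

Lemma agrees_family F Psi Psi' : agrees F Psi -> agrees F Psi' -> Psi = Psi'.
Proof.
move=> h h'; apply: functional_extensionality_dep => x; apply: functional_extensionality_dep => y.
by apply/funext => f; rewrite h h'.
Qed.

Lemma agrees_functor F F' Psi : parcel_functors B C F -> parcel_functors B C F' ->
  agrees F Psi -> agrees F' Psi -> F = F'.
Proof.
move=> [FO _] [FO' _] h h'.
have e : fob F = fob F'.
  by apply/funext => x; apply: C_regular; rewrite FO FO'.
case: F F' e h h' {FO FO'} => [b m i c] [b' m' i' c'] /= e; case: b' / e m' i' c' => m' i' c' h h'.
have em : m = m'.
  apply: functional_extensionality_dep => x; apply: functional_extensionality_dep => y.
  apply/funext => f; apply: arrow_inj; apply: Some_inj.
  by rewrite -[LHS]h -[RHS]h'.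
case: m' / em i' c' {h'} => i' c'.
by rewrite (Prop_irrelevance i i') (Prop_irrelevance c c').
Qed.

End ParcelFunctors.

(** * Counting *)

Section Counting.
Local Open Scope card_scope.

(** Bijections are given as relations: functions between types that may be empty would need
    default values. *)
Lemma one_to_one_card (S U : Type) (A : set S) (D : set U) (r : S -> U -> Prop) :
  (forall a, A a -> exists2 b, D b & r a b) ->
  (forall b, D b -> exists2 a, A a & r a b) ->
  (forall a a' b, A a -> A a' -> D b -> r a b -> r a' b -> a = a') ->
  (forall a b b', A a -> D b -> D b' -> r a b -> r a b' -> b = b') -> A #= D.
Proof.
move=> tot sur inj fn.
pose f a := if pselect (exists2 b, D b & r a b) is left h then Some (s2val (cid2 h)) else None.
have fP a : A a -> exists b, [/\ f a = Some b, D b & r a b].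
  move=> /tot h; rewrite /f; case: pselect => // h'.
  by case: (cid2 h') => b Db rb /=; exists b.
have finj : {in A &, injective f}.
  move=> a a' /set_mem Aa /set_mem Aa' ff.
  have [b [fb Db rb]] := fP a Aa; have [b' [fb' Db' rb']] := fP a' Aa'.
  by apply: (inj a a' b) => //; move: fb'; rewrite -ff fb => -[->].
apply: card_eq_trans (card_esym (inj_card_eq finj)) _.
suff -> : f @` A = some @` D by exact: card_some.
apply/seteqP; split=> [_ [a Aa <-]|_ [b Db <-]].
  by have [b [-> Db _]] := fP a Aa; exists b.
have [a Aa rab] := sur b Db; exists a => //.
have [b' [-> Db' rab']] := fP a Aa; congr Some; exact: (fn a).
Qed.

Lemma card_one_to_one (S U : Type) (A : set S) (D : set U) : A #= D ->
  exists r : S -> U -> Prop,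
    [/\ forall a, A a -> exists2 b, D b & r a b,
        forall b, D b -> exists2 a, A a & r a b,
        forall a a' b, r a b -> r a' b -> a = a' &
        forall a b b', r a b -> r a b' -> b = b'].
Proof.
move=> /card_bijP[f [g fK gK]].
exists (fun a b => exists x : A, a = val x /\ b = val (f x)); split.
- move=> a /mem_set Aa; exists (val (f (SigSub Aa))); first exact: set_valP.
  by exists (SigSub Aa).
- move=> b /mem_set Db; exists (val (g (SigSub Db))); first exact: set_valP.
  by exists (g (SigSub Db)); rewrite gK.
- by move=> _ _ _ [x [-> ->]] [x' [-> /val_inj/(can_inj fK) ->]].
- by move=> _ _ _ [x [-> ->]] [x' [/val_inj -> ->]].
Qed.

Lemma card_finType (F : finType) : [set: F] #= `I_#|F|.
Proof.
apply: (@one_to_one_card _ _ _ _ (fun x i => i = enum_rank x :> nat)) => //.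
- by move=> x _; exists (enum_rank x) => //=.
- by move=> i /= iF; exists (enum_val (Ordinal iF)) => //; rewrite enum_valK.
- by move=> x y i _ _ _ -> /ord_inj /enum_rank_inj.
- by move=> x i j _ _ _ -> ->.
Qed.

Lemma ncardP (S : Type) (A : set S) (n : nat) : A #= `I_n -> ncard A = n.
Proof.
move=> An; rewrite /ncard; case: xgetP => [m _ Am|/(_ n)//].
by apply/card_eq_II; exact: card_eq_trans (card_esym Am) An.
Qed.

Lemma finite_ncard (S : Type) (A : set S) : finite_set A -> A #= `I_(ncard A).
Proof. by move=> [n An]; rewrite (ncardP An). Qed.

Lemma ncard_eq (S U : Type) (A : set S) (D : set U) : A #= D -> finite_set D ->
  finite_set A /\ ncard A = ncard D.
Proof.
move=> AD /finite_ncard Dn; have An := card_eq_trans AD Dn.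
by split; [exists (ncard D)|exact: ncardP].
Qed.

Lemma ncard_finset (F : finType) (A : set F) (P : pred F) : (forall x, A x <-> P x) ->
  ncard A = #|P|.
Proof.
move=> AP; apply: ncardP; rewrite -[#|P|]card_sig.
apply: card_eq_trans (card_finType _).
apply: (@one_to_one_card _ _ _ _ (fun x y => x = sval y)) => //.
- by move=> x /AP Px; exists (exist _ x Px).
- by move=> y _; exists (sval y) => //; apply/AP/(svalP y).
- by move=> x x' y _ _ _ -> ->.
- by move=> x y y' _ _ _ -> /val_inj.
Qed.

Lemma ncard_prod (S U : Type) (A : set S) (D : set U) : finite_set A -> finite_set D ->
  finite_set (A `*` D) /\ ncard (A `*` D) = (ncard A * ncard D)%N.
Proof.
move=> /finite_ncard An /finite_ncard Dn.
have e : A `*` D #= `I_(ncard A * ncard D).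
  have := card_finType ('I_(ncard A) * 'I_(ncard D))%type; rewrite card_prod !card_ord.
  apply: card_eq_trans.
  have [r [r1 r2 r3 r4]] := card_one_to_one (card_eq_trans An card_II).
  have [s [s1 s2 s3 s4]] := card_one_to_one (card_eq_trans Dn card_II).
  apply: (@one_to_one_card _ _ _ _ (fun x y => r x.1 y.1 /\ s x.2 y.2)).
  - by move=> [a b] [/= /r1[i _ ri] /s1[j _ sj]]; exists (i, j).
  - by move=> [i j] _; have [a Aa ra] := r2 i I; have [b Db sb] := s2 j I; exists (a, b).
  - by move=> [a b] [a' b'] [i j] _ _ _ /= [ra sb] [ra' sb']; rewrite (r3 _ _ _ ra ra') (s3 _ _ _ sb sb').
  - by move=> [a b] [i j] [i' j'] _ _ _ /= [ra sb] [ra' sb']; rewrite (r4 _ _ _ ra ra') (s4 _ _ _ sb sb').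
by split; [exists (ncard A * ncard D)%N|exact: ncardP].
Qed.

Lemma ncard_functions (F : finType) (S : Type) (A : F -> set S) : (forall i, finite_set (A i)) ->
  finite_set [set h : F -> S | forall i, A i (h i)] /\
  ncard [set h : F -> S | forall i, A i (h i)] = (\prod_i ncard (A i))%N.
Proof.
move=> finA.
have e : [set h : F -> S | forall i, A i (h i)] #= `I_(\prod_i ncard (A i)).
  have := card_finType {dffun forall i : F, 'I_(ncard (A i))}.
  rewrite card_dep_ffun foldrE big_image /=.
  under eq_bigr => i _ do rewrite card_ord.
  apply: card_eq_trans.
  have hr i : exists r : S -> 'I_(ncard (A i)) -> Prop,
    [/\ forall a, A i a -> exists b, r a b,
        forall b, exists2 a, A i a & r a b,
        forall a a' b, r a b -> r a' b -> a = a' &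
        forall a b b', r a b -> r a b' -> b = b'].
    have [r [r1 r2 r3 r4]] := card_one_to_one (card_eq_trans (finite_ncard (finA i)) card_II).
    by exists r; split=> // [a /r1[b _ ra]|b]; [exists b|exact: r2].
  pose r i := projT1 (cid (hr i)).
  have rP i : [/\ forall a, A i a -> exists b, r i a b,
        forall b, exists2 a, A i a & r i a b,
        forall a a' b, r i a b -> r i a' b -> a = a' &
        forall a b b', r i a b -> r i a b' -> b = b'] by rewrite /r; case: cid.
  apply: (@one_to_one_card _ _ _ _ (fun h (p : {dffun forall i : F, 'I_(ncard (A i))}) =>
    forall i, r i (h i) (p i))) => //.
  - move=> h Ah; have ex i : exists b, r i (h i) b by have [+ _ _ _] := rP i; apply; exact: Ah.
    by exists [ffun i => projT1 (cid (ex i))] => // i; rewrite ffunE; case: cid.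
  - move=> p _; have ex i : exists2 a, A i a & r i a (p i) by have [_ + _ _] := rP i; apply.
    by exists (fun i => s2val (cid2 (ex i))) => i; case: cid2.
  - move=> h h' p _ _ _ hp hp'; apply/funext => i; have [_ _ inj _] := rP i.
    exact: inj (hp i) (hp' i).
  - move=> h p p' _ _ _ hp hp'; apply/ffunP => i; have [_ _ _ fn] := rP i.
    exact: fn (hp i) (hp' i).
by split; [exists (\prod_i ncard (A i))%N|exact: ncardP].
Qed.

End Counting.

(** * The number of functors *)

Section Conclusion.
Variables (R : realType) (d : nat) (X : manifold_with_defect R d).
Variable T : directed_triangulation X.
Variable C : parcel Gamma2.
Hypothesis C_regular : regular_parcel C.
Hypothesis C_finite : fiber_finite C.
Variable B : set X.
Hypothesis B_base : base_points B.
Local Notation vpt := (@vertex_point _ _ X T).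
Local Notation dv i := (in_defect (vpt i)).
Local Notation one x := (unit_over C (kind (in_defect x))).
Local Notation idw v := (@id_arrow (path_category Gamma2) v).
Local Notation basept := (fun o : {x : X | B x} => sval o).
Local Notation fiber b := (above C (idw (kind b))).
Local Notation is_root := (@is_root R d X T B B_base).
Local Notation gauge_set := (@gauges R d X T C B B_base).
Local Open Scope card_scope.

Lemma fiber_neq0 b : ncard (fiber b) != 0%N.
Proof.
apply/eqP => e; have := finite_ncard (C_finite (idw (kind b))).
rewrite e II0 card_eq0 => /eqP f0.
have [a _ aP] := lies_above_unit C (kind b).
by move: aP; rewrite f0.
Qed.

Lemma colorings_families : colorings C T #= [set Lam : assignment C vpt | is_family Lam].
Proof.
apply: (one_to_one_card (r := @colored_by _ _ _ T C)).
- by move=> c /(coloring_family C_regular)[Lam Lf cL]; exists Lam.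
- by move=> Lam /(family_coloring C_regular)[c Hc cL]; exists c.
- by move=> c c' Lam _ _ _; exact: colored_by_coloring.
- by move=> c Lam Lam' _; exact: colored_by_family.
Qed.

Lemma functors_families :
  parcel_functors B C #= [set Psi : assignment C basept | is_family Psi].
Proof.
apply: (one_to_one_card (r := @agrees _ _ _ C B)).
- by move=> F /functor_family[Psi Pf FP]; exists Psi.
- move=> Psi Pf; exists (family_functor T C_regular Pf); first exact: family_functor_parcel.
  exact: family_functor_agrees.
- by move=> F F' Psi hF hF' _; exact: agrees_functor.
- by move=> F Psi Psi' _ _ _; exact: agrees_family.
Qed.

Lemma families_trivialization : [set Lam : assignment C vpt | is_family Lam] #=
  [set Psi : assignment C basept | is_family Psi] `*` gauge_set.
Proof.
apply: (one_to_one_card (r := fun Lam Ph =>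
  descend (B := B) Lam = Ph.1 /\ comparison B_base Lam = Ph.2)).
- move=> Lam Lf; exists (descend Lam, comparison B_base Lam) => //.
  by split; [exact: descend_family|exact: comparison_gauge].
- move=> [Psi h] [/= Pf hg]; exists (ascend B_base Psi h); first exact: ascend_family.
  by rewrite descend_ascend // comparison_ascend.
- move=> Lam Lam' [Psi h] Lf Lf' _ /= [e1 e2] [e1' e2'].
  by rewrite -(ascend_descend C_regular B_base Lf) -(ascend_descend C_regular B_base Lf') e1 e2 e1' e2'.
- by move=> Lam [Psi h] [Psi' h'] _ _ _ /= [-> ->] [-> ->].
Qed.

Local Notation gauge_at v :=
  [set f | lies_above (idw (kind (dv v))) f /\ (is_root v -> f = one (vpt v))].

Lemma ncard_gauge_at v : finite_set (gauge_at v) /\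
  ncard (gauge_at v) = if is_root v then 1%N else ncard (fiber (dv v)).
Proof.
set A := gauge_at v; case: ifP => rv.
  have e : A #= `I_1.
    rewrite (_ : A = [set one (vpt v)]); first exact: card_set1.
    apply/seteqP; split=> [f [_ /(_ rv)]//|_ ->].
    by split=> //; exact: lies_above_unit.
  by split; [exists 1%N|exact: ncardP].
rewrite (_ : A = some @` fiber (dv v)).
  by apply: ncard_eq => //; exact: card_some.
apply/seteqP; split=> [f [[a -> aP] _]|_ [a aP <-]]; first by exists a.
by split=> [|rv']; [exists a|rewrite rv' in rv].
Qed.

Lemma ncard_gauges : finite_set gauge_set /\ ncard gauge_set =
  (ncard (fiber false) ^ #|[pred v | ~~ is_root v & ~~ dv v]| *
   ncard (fiber true) ^ #|[pred v | ~~ is_root v & dv v]|)%N.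
Proof.
have [fin ->] := ncard_functions (fun v => proj1 (ncard_gauge_at v)); split=> //.
rewrite (bigID (fun v => is_root v)) /= big1 => [|v rv]; last first.
  by have [_ ->] := ncard_gauge_at v; rewrite rv.
rewrite mul1n (bigID (fun v => dv v)) /= mulnC -!prod_nat_const.
congr (_ * _)%N; apply: eq_big => // v /andP[/negbTE rv dvv].
  by have [_ ->] := ncard_gauge_at v; rewrite rv (negbTE dvv).
by have [_ ->] := ncard_gauge_at v; rewrite rv dvv.
Qed.

(** Each stratum contains exactly one root, the root of its base point. *)
Lemma card_roots b :
  ncard [set stratum x | x in [set x : X | in_defect x = b]] = #|[pred v | is_root v & dv v == b]|.
Proof.
rewrite -(@ncard_finset _ [set v | is_root v /\ dv v = b]); last first.
  by move=> v; split=> [[rv /eqP dvb]|/andP[rv /eqP dvb]]; [apply/andP|].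
apply: (ncard_eq _ finite_finset).2.
apply: (one_to_one_card (r := fun S v => S = stratum (vpt v))).
- move=> _ [x xb <-]; pose o := base B_base (nearby_vertex T x); pose r := root T o.
  have xr : stratum x (vpt r).
    apply: stratum_trans (nearby_vertex_stratum T x) _.
    apply: stratum_trans (root_stratum T o); apply: stratum_sym.
    exact: base_stratum.
  exists r; last exact: stratum_eq.
  by split; [exact: is_root_root|rewrite (stratum_in_defect xr)].
- by move=> v [rv vb]; exists (stratum (vpt v)) => //; exists (vpt v).
- by move=> S S' v _ _ _ -> ->.
- move=> S v v' _ [/eqP rv _] [/eqP rv' _] -> e.
  rewrite -rv -rv'; congr (root _ _); apply: base_uniq.
  have := base_stratum B_base v; move/stratum_eq=> vv.
  have : stratum (vpt v) (vpt v') by rewrite e; exact: stratum_refl.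
  by apply: stratum_trans; exact: base_stratum.
Qed.

Lemma card_bulk_vertices : ncard (bulk_vertices T) =
  (#|[pred v | ~~ is_root v & ~~ dv v]| + ncard (bulk_strata X))%N.
Proof.
have -> : bulk_strata X = [set stratum x | x in [set x : X | in_defect x = false]].
  by congr (_ @` _); apply/seteqP; split=> x /=; [move=> /in_defectP/negbTE|move=> h /in_defectP; rewrite h].
rewrite card_roots (@ncard_finset _ _ [pred v | ~~ dv v]); last first.
  by move=> v; split=> /in_defectP.
rewrite -(cardID is_root) addnC; congr addn; apply: eq_card => v; rewrite !inE //.
by rewrite eqbF_neg andbC.
Qed.

Lemma card_defect_vertices : ncard (defect_vertices T) =
  (#|[pred v | ~~ is_root v & dv v]| + ncard (defect_strata X))%N.
Proof.
have -> : defect_strata X = [set stratum x | x in [set x : X | in_defect x = true]].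
  by congr (_ @` _); apply/seteqP; split=> x /in_defectP.
rewrite card_roots (@ncard_finset _ _ [pred v | dv v]); last first.
  by move=> v; split=> /in_defectP.
rewrite -(cardID is_root) addnC; congr addn; apply: eq_card => v; rewrite !inE //.
by rewrite eqb_id andbC.
Qed.

Lemma finite_colorings : finite_set (colorings C T).
Proof.
pose A (e : {e : 'I_(nvertices T) * 'I_(nvertices T) | edge_dir e.1 e.2}) :=
  above C (step_arrow (dv (sval e).1) (dv (sval e).2)).
have [fin _] := ncard_functions (fun e => C_finite _ : finite_set (A e)).
by apply: sub_finite_set fin => c Hc e; exact: coloring_above.
Qed.

End Conclusion.

Theorem theorem4p4 (R : realType) (d : nat) (X : manifold_with_defect R d)
    (C : parcel Gamma2) (C_regular : regular_parcel C) (C_finite : fiber_finite C)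
    (T : directed_triangulation X)
    (B : set X) (B_base : base_points B) :
  [/\ finite_set (parcel_functors B C),
      finite_set (colorings C T) &
      (ncard (parcel_functors B C))%:R =
        (ncard (colorings C T))%:R /
        ((ncard (above C Id_beta))%:R
           ^ ((ncard (bulk_vertices T))%:Z - (ncard (bulk_strata X))%:Z) *
         (ncard (above C Id_delta))%:R
           ^ ((ncard (defect_vertices T))%:Z - (ncard (defect_strata X))%:Z))
        :> rat].
Proof.
have fin_col := finite_colorings T C_finite.
have trivial_ := card_eq_trans (card_esym (families_trivialization T C_regular B_base))
  (card_esym (colorings_families T C_regular)).
have [fin_prod card_prod] := ncard_eq trivial_ fin_col.
have [fin_gauges card_gauges] := ncard_gauges T C_finite B_base.
have fin_fam : finite_set [set Psi : assignment C (fun o : {x : X | B x} => sval o) | is_family Psi].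
  apply: sub_finite_set (finite_image fst fin_prod) => Psi Pf.
  exists (Psi, fun v => unit_over C (kind (in_defect (vertex_point v)))) => //; split=> // v.
  by split=> //; exact: lies_above_unit.
have [fin_fun card_fun] := ncard_eq (functors_families T C_regular B) fin_fam.
split=> //.
have [_ card_prod'] := ncard_prod fin_fam fin_gauges.
rewrite card_fun -card_prod card_prod' card_gauges.
rewrite (card_bulk_vertices T B_base) (card_defect_vertices T B_base) !PoszD !addrK.
rewrite !natrM !natrX -!exprnP mulfK //.
by rewrite mulf_neq0 // expf_neq0 // pnatr_eq0; exact: (fiber_neq0 C_finite).
Qed.
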